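(* For all integers $n\ge1$, there is a natural isomorphism of functors (from $H_n^f(A,z)$-modules to $H_n^f(A,z)$-modules) $${}^f\mathrm{Res}^{n+1}_n\,{}^f\mathrm{Ind}^{n+1}_n\;\cong\;\mathrm{id}^{\oplus d\dim(A_0)}\oplus\Pi^{\oplus d\dim(A_1)}\oplus{}^f\mathrm{Ind}^n_{n-1}\,{}^f\mathrm{Res}^n_{n-1}.$$
   Context: Conventions. $\Bbbk$ is a commutative ring of characteristic not equal to two, $z\in\Bbbk$, and all tensor products are over $\Bbbk$ unless indicated. All algebras and modules are associative superalgebras and (left) supermodules over $\Bbbk$; $\bar a$ is the parity of a homogeneous element $a$; $(a\otimes b)(c\otimes d)=(-1)^{\bar b\bar c}ac\otimes bd$. $A$ is a symmetric superalgebra: there is a parity-preserving linear map $\mathrm{tr}\colon A\to\Bbbk$ ($\Bbbk$ in parity zero) with $\mathrm{tr}(ab)=(-1)^{\bar a\bar b}\mathrm{tr}(ba)$ for homogeneous $a,b$, such that $a\mapsto(b\mapsto\mathrm{tr}(ab))$ is a parity-preserving isomorphism $A\to\mathrm{Hom}_\Bbbk(A,\Bbbk)$. $A$ is free over $\Bbbk$ with a homogeneous (necessarily finite) basis $B$, and dual basis $\{b^\vee\}$ given by $\mathrm{tr}(a^\vee b)=\delta_{a,b}$ for $a,b\in B$. $\dim(A_0)$ and $\dim(A_1)$ are the ranks over $\Bbbk$ of the even and odd parts of $A$ (the numbers of even and odd elements of $B$). For $n\ge1$ and $a\in A$, $a_i=1^{\otimes(i-1)}\otimes a\otimes1^{\otimes(n-i)}\in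 A^{\otimes n}$; $t_{i,j}=\sum_{b\in B}b_ib_j^\vee$ for $1\le i\ne j\le n$. $S_n$ acts on $A^{\otimes n}$ by superpermutation of factors; $s_i=(i,i+1)$. $H_n(A,z)$ is the algebra generated by $A^{\otimes n}$ and even elements $T_1,\dots,T_{n-1}$ (free product) modulo: $T_iT_j=T_jT_i$ for $|i-j|>1$; $T_iT_{i+1}T_i=T_{i+1}T_iT_{i+1}$; $T_i^2=zt_{i,i+1}T_i+1$; $T_i\mathbf a=s_i(\mathbf a)T_i$ for $\mathbf a\in A^{\otimes n}$ (so $H_1(A,z)=A$). $H_n^{\mathrm{aff}}(A,z)$ is the free product of $\Bbbk[X_1^{\pm1},\dots,X_n^{\pm1}]$ ($X_i$ even) and $H_n(A,z)$ modulo: $T_iX_j=X_jT_i$ for $j\ne i,i+1$; $T_iX_iT_i=X_{i+1}$; $X_i\mathbf a=\mathbf aX_i$ for $\mathbf a\in A^{\otimes n}$. Cyclotomic quotients. Let $Z(A)=\{a: ab=(-1)^{\bar a\bar b}ba\ \forall b\in A\}$ and $Z(A)_0$ its even part. Identify $A$ with $A\otimes1^{\otimes(n-1)}\subseteq A^{\otimes n}$. Fix a monic polynomial $f=X_1^d+a_{(d-1)}X_1^{d-1}+\dots+a_{(0)}$ of degree $d\ge1$ with all $a_{(i)}\in Z(A)_0$ and $a_{(0)}$ invertible. For $n\ge1$, $H_n^f(A,z)=H_n^{\mathrm{aff}}(A,z)/\langle f\rangle$, with $\langle f\rangle$ the two-sided ideal generated by $f$; $H_0^f(A,z)=\Bbbk$.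 The subalgebra of $H_{n+1}^f(A,z)$ generated by $X_1,\dots,X_n$, $A^{\otimes n}\otimes1$ and $T_1,\dots,T_{n-1}$ is isomorphic to (and identified with) $H_n^f(A,z)$. ${}^f\mathrm{Ind}_n^{n+1}=H_{n+1}^f(A,z)\otimes_{H_n^f(A,z)}-$ and ${}^f\mathrm{Res}^{n+1}_n$ are the corresponding induction and restriction functors between module categories. $\Pi$ is the functor on $H_n^f(A,z)$-modules reversing the parity of the elements of a module. *)

(* Defs.v *)
From HB Require Import structures.
From mathcomp Require Import all_boot all_algebra.
From mathcomp Require Import boolp.

Set Implicit Arguments.
Unset Strict Implicit.
Unset Printing Implicit Defensive.

Import GRing.Theory.
Local Open Scope ring_scope.
Local Open Scope quotient_scope.

(* A decomposition V = V_0 (+) V_1 is recorded by its component maps: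
   [part p x] is the component of x in V_p (p = false: even, p = true: odd),
   and V_p is {x | part p x = x}. *)
HB.mixin Record Zmodule_isSuper V of GRing.Zmodule V := {
  part : bool -> V -> V;
  partD : forall p, {morph part p : x y / x + y};
  part_sum : forall x, part false x + part true x = x;
  part_part : forall p q x, part p (part q x) = if p == q then part q x else 0
}.
#[short(type="superZmodType")]
HB.structure Definition SuperZmodule :=
  {V of Zmodule_isSuper V & GRing.Zmodule V}.

Definition homog (V : superZmodType) (p : bool) (x : V) : Prop := part p x = x.

(* A k-algebra is a ring A with a ring morphism c |-> c%:K from k to its
   centre. [algType] is not used because it only covers nonzero rings, whereas
   an algebra given by generators and relations is not known a priori to be
   nonzero. *)
HB.mixin Record isSuperAlgebra (k : comNzRingType) A
    of GRing.PzRing A & SuperZmodule A := {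
  inK : k -> A;
  inK1 : inK 1 = 1;
  inKD : {morph inK : c c' / c + c'};
  inKM : {morph inK : c c' / c * c'};
  inKC : forall (c : k) (x : A), inK c * x = x * inK c;
  homogK : forall c : k, homog false (inK c);
  homogM : forall p q (x y : A),
    homog p x -> homog q y -> homog (p (+) q) (x * y)
}.
#[short(type="superAlgType")]
HB.structure Definition SuperAlgebra (k : comNzRingType) :=
  {A of isSuperAlgebra k A & GRing.PzRing A & SuperZmodule A}.
Notation "c %:K" := (inK c) (at level 1, left associativity, format "c %:K") : ring_scope.

HB.mixin Record isSuperModule (k : comNzRingType) (H : superAlgType k) M
    of GRing.Lmodule H M & SuperZmodule M := {
  homog_scale : forall p q (h : H) (m : M),
    homog p h -> homog q m -> homog (p (+) q) (h *: m)
}.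
#[short(type="superModType")]
HB.structure Definition SuperModule (k : comNzRingType) (H : superAlgType k) :=
  {M of isSuperModule k H M & GRing.Lmodule H M & SuperZmodule M}.

Section SuperTheory.

Lemma inK0 k (A : superAlgType k) : (0 : k)%:K = 0 :> A.
Proof. by apply: (addIr (0 : k)%:K); rewrite -inKD !add0r. Qed.

Lemma inKN k (A : superAlgType k) (c : k) : (- c)%:K = - c%:K :> A.
Proof. by apply: (addIr c%:K); rewrite -inKD !addNr inK0. Qed.

Lemma homog1 k (A : superAlgType k) : homog false (1 : A).
Proof. by rewrite -(@inK1 k); exact: homogK. Qed.

Lemma part0 (V : superZmodType) p : part p (0 : V) = 0.
Proof. by apply: (addIr (part p 0)); rewrite -partD !add0r. Qed.

Lemma partN (V : superZmodType) p (x : V) : part p (- x) = - part p x.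
Proof. by apply: (addIr (part p x)); rewrite -partD !addNr part0. Qed.

Lemma homog_part (V : superZmodType) p (x : V) : homog p (part p x).
Proof. by rewrite /homog part_part eqxx. Qed.

Lemma homog_neq (V : superZmodType) p q (x : V) :
  homog q x -> p != q -> part p x = 0.
Proof. by move=> <- /negPf npq; rewrite part_part npq. Qed.

Lemma part_homog (V : superZmodType) p (x y : V) :
  homog p x -> homog (~~ p) y -> part p (x + y) = x.
Proof.
by move=> hx hy; rewrite partD hx (homog_neq hy) ?addr0 //; case: (p).
Qed.

Lemma homogD (V : superZmodType) p (x y : V) :
  homog p x -> homog p y -> homog p (x + y).
Proof. by rewrite /homog partD => -> ->. Qed.

Lemma partM k (A : superAlgType k) p (x y : A) :
  part p (x * y) = part false x * part p y + part true x * part (~~ p) y.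
Proof.
rewrite -{1}[x]part_sum -{1}[y]part_sum mulrDl !mulrDr.
set a := part false x; set b := part true x.
have ha q : homog q (a * part q y) by apply: (@homogM k A false); apply: homog_part.
have hb q : homog (~~ q) (b * part q y) by apply: (@homogM k A true); apply: homog_part.
rewrite !partD; case: p => /=.
  rewrite (homog_neq (ha false)) // (ha true) (hb false).
  by rewrite (homog_neq (hb true)) // add0r addr0.
rewrite (ha false) (homog_neq (ha true)) // (homog_neq (hb false)) // (hb true).
by rewrite add0r addr0.
Qed.

Lemma part_scale k (H : superAlgType k) (M : superModType H) p (x : H) (y : M) :
  part p (x *: y) = part false x *: part p y + part true x *: part (~~ p) y.
Proof.
rewrite -{1}[x]part_sum -{1}[y]part_sum scalerDl !scalerDr.
set a := part false x; set b := part true x.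
have ha q : homog q (a *: part q y) by apply: (@homog_scale k H M false); apply: homog_part.
have hb q : homog (~~ q) (b *: part q y) by apply: (@homog_scale k H M true); apply: homog_part.
rewrite !partD; case: p => /=.
  rewrite (homog_neq (ha false)) // (ha true) (hb false).
  by rewrite (homog_neq (hb true)) // add0r addr0.
rewrite (ha false) (homog_neq (ha true)) // (homog_neq (hb false)) // (hb true).
by rewrite add0r addr0.
Qed.

End SuperTheory.

Record superAlgHom (k : comNzRingType) (S S' : superAlgType k) := SuperAlgHom {
  sa_map :> {rmorphism S -> S'};
  sa_mapK : forall c : k, sa_map c%:K = c%:K;
  sa_map_part : forall p x, sa_map (part p x) = part p (sa_map x)
}.

Record superModHom (k : comNzRingType) (H : superAlgType k)
    (M N : superModType H) := SuperModHom {
  sm_map :> {linear M -> N};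
  sm_map_part : forall p x, sm_map (part p x) = part p (sm_map x)
}.

Inductive term (k G : Type) : Type :=
| TVar of G
| TConst of k
| TAdd of term k G & term k G
| TOpp of term k G
| TMul of term k G & term k G
| TPart of bool & term k G.
Arguments TVar {k G}. Arguments TConst {k G}.

Declare Scope term_scope.
Delimit Scope term_scope with term.
Bind Scope term_scope with term.
Notation "c %:K" := (TConst c%R) : term_scope.
Notation "0" := (TConst 0%R) : term_scope.
Notation "1" := (TConst 1%R) : term_scope.
Infix "+" := TAdd : term_scope.
Infix "*" := TMul : term_scope.
Notation "- x" := (TOpp x) : term_scope.
Notation "\sum_ ( i < n ) F" :=
  (\big[@TAdd _ _/TConst 0%R]_(i < n) F%term) : term_scope.
Notation "\sum_ ( i : T ) F" :=
  (\big[@TAdd _ _/TConst 0%R]_(i : T) F%term) : term_scope.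
Notation "x ^+ n" := (iter n (TMul x) (TConst 1%R)) : term_scope.

(* The congruence generated by R and the axioms of superalgebras, so that the
   quotient is the free superalgebra on G modulo the (graded) ideal generated
   by the relations R. *)
Inductive cong (k : comNzRingType) (G : Type) (R : term k G -> term k G -> Prop)
  : term k G -> term k G -> Prop :=
| c_rel s t : R s t -> cong R s t
| c_refl s : cong R s s
| c_sym s t : cong R s t -> cong R t s
| c_trans s t u : cong R s t -> cong R t u -> cong R s u
| c_add s s' t t' : cong R s s' -> cong R t t' -> cong R (s + t) (s' + t')
| c_opp s s' : cong R s s' -> cong R (- s) (- s')
| c_mul s s' t t' : cong R s s' -> cong R t t' -> cong R (s * t) (s' * t')
| c_part p s s' : cong R s s' -> cong R (TPart p s) (TPart p s')
| c_addA s t u : cong R (s + (t + u)) (s + t + u)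
| c_addC s t : cong R (s + t) (t + s)
| c_add0 s : cong R (0 + s) s
| c_addN s : cong R (- s + s) 0
| c_mulA s t u : cong R (s * (t * u)) (s * t * u)
| c_mul1 s : cong R (1 * s) s
| c_1mul s : cong R (s * 1) s
| c_mulDl s t u : cong R ((s + t) * u) (s * u + t * u)
| c_mulDr s t u : cong R (s * (t + u)) (s * t + s * u)
| c_constD c c' : cong R (c + c')%:K (c%:K + c'%:K)
| c_constM c c' : cong R (c * c')%:K (c%:K * c'%:K)
| c_constC c s : cong R (c%:K * s) (s * c%:K)
| c_partD p s t : cong R (TPart p (s + t)) (TPart p s + TPart p t)
| c_part_sum s : cong R (TPart false s + TPart true s) s
| c_part_part p q s :
    cong R (TPart p (TPart q s)) (if p == q then TPart q s else 0%term)
| c_partK c : cong R (TPart false c%:K) c%:K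
| c_partM p q s t :
    cong R (TPart (p (+) q) (TPart p s * TPart q t)) (TPart p s * TPart q t).

HB.instance Definition _ k G := gen_eqMixin (term k G).
HB.instance Definition _ k G := gen_choiceMixin (term k G).

Section Presented.
Variables (k : comNzRingType) (G : Type) (R : term k G -> term k G -> Prop).

Definition congb : rel (term k G) := fun s t => `[< cong R s t >].

Lemma congb_equiv : equiv_class_of congb.
Proof.
split=> [s|s t|t s u]; rewrite /congb.
- by apply/asboolP; exact: c_refl.
- by apply/asboolP/asboolP => ?; exact: c_sym.
- by move=> /asboolP st /asboolP tu; apply/asboolP; exact: c_trans st tu.
Qed.

Canonical cong_equiv := EquivRelPack congb_equiv.

Definition presAlg : Type := {eq_quot cong_equiv}.

HB.instance Definition _ := Choice.on presAlg.

Definition cls (t : term k G) : presAlg := \pi_({eq_quot cong_equiv}) t.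
Definition rep (x : presAlg) : term k G := repr (x : {eq_quot cong_equiv}).

Lemma repK x : cls (rep x) = x.
Proof. exact: reprK. Qed.

Lemma clsE s t : (cls s = cls t) <-> cong R s t.
Proof.
split=> [|st]; first by move/eqmodP/asboolP.
by apply/eqmodP/asboolP.
Qed.

Lemma rep_cls s : cong R (rep (cls s)) s.
Proof. by apply/clsE; rewrite repK. Qed.

Let add x y := cls (rep x + rep y).
Let opp x := cls (- rep x).
Let mul x y := cls (rep x * rep y).
Let ppart p x := cls (TPart p (rep x)).

Let addE s t : add (cls s) (cls t) = cls (s + t).
Proof. by apply/clsE/c_add; exact: rep_cls. Qed.
Let oppE s : opp (cls s) = cls (- s).
Proof. by apply/clsE/c_opp; exact: rep_cls. Qed.
Let mulE s t : mul (cls s) (cls t) = cls (s * t).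
Proof. by apply/clsE/c_mul; exact: rep_cls. Qed.
Let ppartE p s : ppart p (cls s) = cls (TPart p s).
Proof. by apply/clsE/c_part; exact: rep_cls. Qed.
Let clsW (P : presAlg -> Prop) : (forall s, P (cls s)) -> forall x, P x.
Proof. by move=> H x; rewrite -(repK x). Qed.

Let addA : associative add.
Proof.
by elim/clsW=> s; elim/clsW=> t; elim/clsW=> u; rewrite !addE; apply/clsE/c_addA.
Qed.
Let addC : commutative add.
Proof. by elim/clsW=> s; elim/clsW=> t; rewrite !addE; apply/clsE/c_addC. Qed.
Let add0 : left_id (cls 0) add.
Proof. by elim/clsW=> s; rewrite !addE; apply/clsE/c_add0. Qed.
Let addN : left_inverse (cls 0) opp add.
Proof. by elim/clsW=> s; rewrite oppE !addE; apply/clsE/c_addN. Qed.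
Let mulA : associative mul.
Proof.
by elim/clsW=> s; elim/clsW=> t; elim/clsW=> u; rewrite !mulE; apply/clsE/c_mulA.
Qed.
Let mul1 : left_id (cls 1) mul.
Proof. by elim/clsW=> s; rewrite mulE; apply/clsE/c_mul1. Qed.
Let mulx1 : right_id (cls 1) mul.
Proof. by elim/clsW=> s; rewrite mulE; apply/clsE/c_1mul. Qed.
Let mulDl : left_distributive mul add.
Proof.
elim/clsW=> s; elim/clsW=> t; elim/clsW=> u.
by rewrite ?(addE, mulE); apply/clsE/c_mulDl.
Qed.
Let mulDr : right_distributive mul add.
Proof.
elim/clsW=> s; elim/clsW=> t; elim/clsW=> u.
by rewrite ?(addE, mulE); apply/clsE/c_mulDr.
Qed.

HB.instance Definition _ := GRing.isZmodule.Build presAlg addA addC add0 addN.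
HB.instance Definition _ :=
  GRing.Zmodule_isPzRing.Build presAlg mulA mul1 mulx1 mulDl mulDr.

Lemma clsD s t : cls (s + t) = cls s + cls t.
Proof. exact: esym (addE s t). Qed.
Lemma clsM s t : cls (s * t) = cls s * cls t.
Proof. exact: esym (mulE s t). Qed.
Lemma clsN s : cls (- s) = - cls s.
Proof. exact: esym (oppE s). Qed.

Let ppartD p : {morph ppart p : x y / x + y}.
Proof.
elim/clsW=> s; elim/clsW=> t.
by rewrite -clsD !ppartE -clsD; apply/clsE/c_partD.
Qed.
Let ppart_sum x : ppart false x + ppart true x = x.
Proof. by elim/clsW: x => s; rewrite !ppartE -clsD; apply/clsE/c_part_sum. Qed.
Let ppart_part p q x : ppart p (ppart q x) = if p == q then ppart q x else 0.
Proof.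
elim/clsW: x => s; rewrite !ppartE.
by have /clsE -> := c_part_part R p q s; case: ifP.
Qed.

HB.instance Definition _ :=
  Zmodule_isSuper.Build presAlg ppartD ppart_sum ppart_part.

Lemma cls_part p s : cls (TPart p s) = part p (cls s).
Proof. exact: esym (ppartE p s). Qed.

Let const c := cls c%:K.
Let const1 : const 1 = 1. Proof. by []. Qed.
Let constD : {morph const : c c' / c + c'}.
Proof. by move=> c c'; rewrite -clsD; apply/clsE/c_constD. Qed.
Let constM : {morph const : c c' / c * c'}.
Proof. by move=> c c'; rewrite -clsM; apply/clsE/c_constM. Qed.
Let constC c x : const c * x = x * const c.
Proof. by elim/clsW: x => s; rewrite -!clsM; apply/clsE/c_constC. Qed.
Let homog_const c : homog false (const c).
Proof. by rewrite /homog -cls_part; apply/clsE/c_partK. Qed.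
Let phomogM p q (x y : presAlg) :
  homog p x -> homog q y -> homog (p (+) q) (x * y).
Proof.
elim/clsW: x => s; elim/clsW: y => t; rewrite /homog => <- <-.
by rewrite -(cls_part p s) -(cls_part q t) -clsM -cls_part; apply/clsE/c_partM.
Qed.

HB.instance Definition _ := isSuperAlgebra.Build k presAlg
  const1 constD constM constC homog_const phomogM.

Lemma clsP (P : presAlg -> Prop) : (forall s, P (cls s)) -> forall x, P x.
Proof. exact: clsW. Qed.

End Presented.

Section Lift.
Variables (k : comNzRingType) (G : Type) (R : term k G -> term k G -> Prop).
Variables (S : superAlgType k) (v : G -> S).

Fixpoint eval_term (t : term k G) : S :=
  match t with
  | TVar g => v g
  | TConst c => c%:K
  | TAdd s t => eval_term s + eval_term t
  | TOpp s => - eval_term s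
  | TMul s t => eval_term s * eval_term t
  | TPart p s => part p (eval_term s)
  end.

Hypothesis vR : forall s t, R s t -> eval_term s = eval_term t.

Lemma eval_cong s t : cong R s t -> eval_term s = eval_term t.
Proof.
elim=> //=; clear.
- by move=> s t u _ -> _ ->.
- by move=> s s' t t' _ -> _ ->.
- by move=> s s' _ ->.
- by move=> s s' t t' _ -> _ ->.
- by move=> p s s' _ ->.
- by move=> *; rewrite addrA.
- by move=> *; rewrite addrC.
- by move=> *; rewrite inK0 add0r.
- by move=> *; rewrite inK0 addNr.
- by move=> *; rewrite mulrA.
- by move=> *; rewrite inK1 mul1r.
- by move=> *; rewrite inK1 mulr1.
- by move=> *; rewrite mulrDl.
- by move=> *; rewrite mulrDr.
- by move=> *; rewrite inKD.
- by move=> *; rewrite inKM.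
- by move=> *; rewrite inKC.
- by move=> *; rewrite partD.
- by move=> *; rewrite part_sum.
- by move=> p q s; rewrite part_part; case: ifP => //=; rewrite inK0.
- by move=> *; exact: homogK.
- by move=> p q s t; apply: homogM; apply: homog_part.
Qed.

Definition lift_fun (x : presAlg R) : S := eval_term (rep x).

Lemma lift_cls s : lift_fun (cls R s) = eval_term s.
Proof. by apply: eval_cong; exact: rep_cls. Qed.

Let lift_zmod : zmod_morphism lift_fun.
Proof.
elim/clsP=> s; elim/clsP=> t.
by rewrite -clsN -clsD !lift_cls.
Qed.
Let lift_monoid : monoid_morphism lift_fun.
Proof.
split; first by rewrite (lift_cls 1%term) /= inK1.
by elim/clsP=> s; elim/clsP=> t; rewrite -clsM !lift_cls.
Qed.
HB.instance Definition _ :=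
  GRing.isZmodMorphism.Build (presAlg R) S lift_fun lift_zmod.
HB.instance Definition _ :=
  GRing.isMonoidMorphism.Build (presAlg R) S lift_fun lift_monoid.

Let lift_const (c : k) : lift_fun c%:K = c%:K.
Proof. exact: (lift_cls c%:K%term). Qed.
Let lift_part p x : lift_fun (part p x) = part p (lift_fun x).
Proof. by elim/clsP: x => s; rewrite -cls_part !lift_cls. Qed.

Definition lift_hom : superAlgHom (presAlg R) S :=
  @SuperAlgHom k (presAlg R) S lift_fun lift_const lift_part.

End Lift.

Section HomCategory.
Variables (k : comNzRingType) (H : superAlgType k).

Definition idModHom (M : superModType H) : superModHom M M :=
  @SuperModHom k H M M idfun (fun _ _ => erefl).

Lemma compModHom_subproof (M N P : superModType H) (g : superModHom N P)
  (f : superModHom M N) p x : (g \o f) (part p x) = part p ((g \o f) x).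
Proof. by rewrite /= !sm_map_part. Qed.

Definition compModHom (M N P : superModType H) (g : superModHom N P)
    (f : superModHom M N) : superModHom M P :=
  @SuperModHom k H M P (g \o f) (compModHom_subproof g f).

End HomCategory.

Record superFunctor (k : comNzRingType) (H K : superAlgType k) := SuperFunctor {
  fobj :> superModType H -> superModType K;
  fmap : forall M N : superModType H,
    superModHom M N -> superModHom (fobj M) (fobj N);
  fmap_ext : forall (M N : superModType H) (f g : superModHom M N), f =1 g -> fmap f =1 fmap g;
  fmap_id : forall M : superModType H, fmap (idModHom M) =1 id;
  fmap_comp : forall (M N P : superModType H) (g : superModHom N P) (f : superModHom M N),
    fmap (compModHom g f) =1 fmap g \o fmap f
}.

Arguments fmap {k H K} F {M N} f : rename.
Arguments fmap_ext {k H K} F {M N f g} : rename.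
Arguments fmap_id {k H K} F M : rename.
Arguments fmap_comp {k H K} F {M N P} g f : rename.

Definition naturally_isomorphic (k : comNzRingType) (H K : superAlgType k)
    (F G : superFunctor H K) : Prop :=
  exists eta : forall M : superModType H, superModHom (F M) (G M),
    (forall M, bijective (eta M)) /\
    (forall (M N : superModType H) (f : superModHom M N) (x : F M),
       eta N (fmap F f x) = fmap G f (eta M x)).

Section Functors.
Variable k : comNzRingType.

Definition idFunctor (H : superAlgType k) : superFunctor H H.
Proof.
by refine (@SuperFunctor k H H id (fun _ _ f => f) _ _ _).
Defined.

Definition compFunctor (H K L : superAlgType k) (G : superFunctor K L)
  (F : superFunctor H K) : superFunctor H L.
Proof.
refine (@SuperFunctor k H L (fun M => G (F M)) (fun _ _ f => fmap G (fmap F f))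
  _ _ _).
- by move=> M N f g fg; apply/fmap_ext/fmap_ext.
- by move=> M x; rewrite -[RHS](fmap_id G); apply/fmap_ext/fmap_id.
- move=> M N P g f x; rewrite -[RHS](fmap_comp G); apply/fmap_ext/fmap_comp.
Defined.

End Functors.

Section PairMod.
Variables (k : comNzRingType) (H : superAlgType k) (M N : superModType H).

Let ppart p (x : M * N) : M * N := (part p x.1, part p x.2).
Let ppartD p : {morph ppart p : x y / x + y}.
Proof. by move=> [x1 x2] [y1 y2]; rewrite /ppart /= !partD. Qed.
Let ppart_sum x : ppart false x + ppart true x = x.
Proof. by case: x => a b; congr (_, _); exact: part_sum. Qed.
Let ppart_part p q x : ppart p (ppart q x) = if p == q then ppart q x else 0.
Proof. by rewrite /ppart /= !part_part; case: ifP. Qed.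
HB.instance Definition _ :=
  Zmodule_isSuper.Build (M * N)%type ppartD ppart_sum ppart_part.

Let phomog_scale p q (h : H) (m : M * N) :
  homog p h -> homog q m -> homog (p (+) q) (h *: m).
Proof.
case: m => m1 m2 hh hm.
have [h1 h2] : part q m1 = m1 /\ part q m2 = m2.
  by split; [exact: (congr1 (@fst M N) hm) | exact: (congr1 (@snd M N) hm)].
by congr (_, _); apply: homog_scale.
Qed.
HB.instance Definition _ := isSuperModule.Build k H (M * N)%type phomog_scale.
End PairMod.

Section FfunMod.
Variables (k : comNzRingType) (H : superAlgType k) (I : finType).
Variable M : superModType H.
Notation fM := {ffun I -> M}.

Let fpart p (x : fM) : fM := [ffun i => part p (x i)].
Let fpartD p : {morph fpart p : x y / x + y}.
Proof. by move=> x y; apply/ffunP=> i; rewrite !ffunE partD. Qed.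
Let fpart_sum x : fpart false x + fpart true x = x.
Proof. by apply/ffunP=> i; rewrite !ffunE part_sum. Qed.
Let fpart_part p q x : fpart p (fpart q x) = if p == q then fpart q x else 0.
Proof. by apply/ffunP=> i; rewrite !ffunE part_part; case: ifP; rewrite ffunE. Qed.
HB.instance Definition _ :=
  Zmodule_isSuper.Build fM fpartD fpart_sum fpart_part.

Let fhomog_scale p q (h : H) (m : fM) :
  homog p h -> homog q m -> homog (p (+) q) (h *: m).
Proof.
move=> hh hm; apply/ffunP=> i; rewrite !ffunE; apply: homog_scale => //.
by rewrite /homog -{2}hm ffunE.
Qed.
HB.instance Definition _ := isSuperModule.Build k H fM fhomog_scale.
End FfunMod.

Section SumHoms.
Variables (k : comNzRingType) (H : superAlgType k).

Section PairHom.
Variables (M N M' N' : superModType H).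
Variables (f : superModHom M M') (g : superModHom N N').

Definition pairMap (x : M * N) : M' * N' := (f x.1, g x.2).
Let pairMap_linear : linear pairMap.
Proof. by move=> a x y; congr (_, _); rewrite /= linearP. Qed.
Let pairMap_comp p x : pairMap (part p x) = part p (pairMap x).
Proof. by congr (_, _); rewrite /= sm_map_part. Qed.
HB.instance Definition _ :=
  GRing.isLinear.Build H (M * N)%type (M' * N')%type *:%R pairMap pairMap_linear.

Definition pairModHom :
    superModHom ((M * N)%type : superModType H) (M' * N')%type :=
  @SuperModHom k H (M * N)%type (M' * N')%type pairMap pairMap_comp.
End PairHom.

Section FfunHom.
Variables (I : finType) (M N : superModType H) (f : superModHom M N).

Definition ffunMap (x : {ffun I -> M}) : {ffun I -> N} := [ffun i => f (x i)].
Let ffunMap_linear : linear ffunMap.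
Proof. by move=> a x y; apply/ffunP=> i; rewrite !ffunE linearP. Qed.
Let ffunMap_comp p x : ffunMap (part p x) = part p (ffunMap x).
Proof. by apply/ffunP=> i; rewrite !ffunE sm_map_part. Qed.
HB.instance Definition _ :=
  GRing.isLinear.Build H {ffun I -> M} {ffun I -> N} *:%R ffunMap ffunMap_linear.

Definition ffunModHom :
    superModHom ({ffun I -> M} : superModType H) {ffun I -> N} :=
  @SuperModHom k H {ffun I -> M} {ffun I -> N} ffunMap ffunMap_comp.
End FfunHom.

End SumHoms.

Section SumFunctors.
Variables (k : comNzRingType) (H K : superAlgType k).

Definition sumFunctor (F G : superFunctor H K) : superFunctor H K.
Proof.
refine (@SuperFunctor k H K (fun M => (F M * G M)%type)
  (fun _ _ f => pairModHom (fmap F f) (fmap G f)) _ _ _).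
- by move=> M N f g fg x; congr (_, _); apply: fmap_ext.
- by move=> M [x y]; congr (_, _); apply: fmap_id.
- by move=> M N P g f x; congr (_, _); apply: fmap_comp.
Defined.

Definition copiesFunctor (m : nat) (F : superFunctor H K) : superFunctor H K.
Proof.
refine (@SuperFunctor k H K (fun M => {ffun 'I_m -> F M})
  (fun _ _ f => ffunModHom 'I_m (fmap F f)) _ _ _).
- by move=> M N f g fg x; apply/ffunP=> i; rewrite !ffunE; apply: fmap_ext.
- by move=> M x; apply/ffunP=> i; rewrite !ffunE; apply: fmap_id.
- by move=> M N P g f x; apply/ffunP=> i; rewrite !ffunE; apply: fmap_comp.
Defined.

End SumFunctors.

Definition parity_shift (M : Type) : Type := M.

Section Shift.
Variables (k : comNzRingType) (H : superAlgType k).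

Section ShiftMod.
Variable M : superModType H.
HB.instance Definition _ := GRing.Lmodule.on (parity_shift M).
Let spart p (x : parity_shift M) : parity_shift M := part (~~ p) (x : M).
Let spartD p : {morph spart p : x y / x + y}.
Proof. exact: partD. Qed.
Let spart_sum x : spart false x + spart true x = x.
Proof. by rewrite addrC; exact: part_sum. Qed.
Let spart_part p q x : spart p (spart q x) = if p == q then spart q x else 0.
Proof. by rewrite /spart part_part; case: p q => [] []. Qed.
HB.instance Definition _ :=
  Zmodule_isSuper.Build (parity_shift M) spartD spart_sum spart_part.
Let shomog_scale p q (h : H) (m : parity_shift M) :
  homog p h -> homog q m -> homog (p (+) q) (h *: m : parity_shift M).
Proof.
move=> hh hm; change (homog (~~ (p (+) q)) (h *: (m : M))).
by rewrite -addbN; exact: homog_scale.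
Qed.
HB.instance Definition _ := isSuperModule.Build k H (parity_shift M) shomog_scale.
End ShiftMod.

Section ShiftHom.
Variables (M N : superModType H) (f : superModHom M N).
Definition shiftMap (x : parity_shift M) : parity_shift N := f x.
Let shiftMap_linear : linear shiftMap. Proof. exact: linearP. Qed.
Let shiftMap_comp p x : shiftMap (part p x) = part p (shiftMap x).
Proof. exact: (sm_map_part f (~~ p) x). Qed.
HB.instance Definition _ :=
  GRing.isLinear.Build H (parity_shift M) (parity_shift N) *:%R shiftMap shiftMap_linear.
Definition shiftHom : superModHom (parity_shift M : superModType H) (parity_shift N) :=
  @SuperModHom k H (parity_shift M) (parity_shift N) shiftMap shiftMap_comp.
End ShiftHom.

(* The action on [parity_shift M] is that of M, without sign. The variant where
   h acts by (-1)^|h| h is naturally isomorphic, via m |-> (-1)^|m| m. *)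
Definition parityFunctor : superFunctor H H.
Proof.
refine (@SuperFunctor k H H (fun M => parity_shift M) shiftHom _ _ _).
- by move=> M N f g fg x; apply: fg.
- by [].
- by [].
Defined.
End Shift.

Definition restr (k : comNzRingType) (H K : superAlgType k)
  (phi : superAlgHom H K) (M : Type) : Type := M.

Section Restriction.
Variables (k : comNzRingType) (H K : superAlgType k) (phi : superAlgHom H K).

Section ResMod.
Variable M : superModType K.
HB.instance Definition _ := SuperZmodule.on (restr phi M).
Let rscale (h : H) (x : restr phi M) : restr phi M := phi h *: (x : M).
Let rscaleA a b v : rscale a (rscale b v) = rscale (a * b) v.
Proof. by rewrite /rscale scalerA rmorphM. Qed.
Let rscale1 : left_id 1 rscale.
Proof. by move=> x; rewrite /rscale rmorph1 scale1r. Qed.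
Let rscaleDr : right_distributive rscale +%R.
Proof. by move=> a x y; exact: scalerDr. Qed.
Let rscaleDl v : {morph rscale^~ v: a b / a + b}.
Proof. by move=> a b; rewrite /rscale rmorphD; exact: scalerDl. Qed.
HB.instance Definition _ := GRing.Zmodule_isLmodule.Build H (restr phi M)
  rscaleA rscale1 rscaleDr rscaleDl.
Let rhomog_scale p q (h : H) (m : restr phi M) :
  homog p h -> homog q m -> homog (p (+) q) (h *: m : restr phi M).
Proof.
move=> hh hm; apply: (@homog_scale k K M p q (phi h) m) => //.
by rewrite /homog -sa_map_part hh.
Qed.
HB.instance Definition _ := isSuperModule.Build k H (restr phi M) rhomog_scale.
End ResMod.

Section ResHom.
Variables (M N : superModType K) (f : superModHom M N).
Definition resMap (x : restr phi M) : restr phi N := f x.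
Let resMap_linear : linear resMap. Proof. by move=> a x y; exact: linearP. Qed.
Let resMap_comp p x : resMap (part p x) = part p (resMap x).
Proof. exact: (sm_map_part f p x). Qed.
HB.instance Definition _ :=
  GRing.isLinear.Build H (restr phi M) (restr phi N) *:%R resMap resMap_linear.
Definition resHom : superModHom (restr phi M : superModType H) (restr phi N) :=
  @SuperModHom k H (restr phi M) (restr phi N) resMap resMap_comp.
End ResHom.

Definition resFunctor : superFunctor K H.
Proof.
refine (@SuperFunctor k K H (fun M => restr phi M) resHom _ _ _).
- by move=> M N f g fg x; apply: fg.
- by [].
- by [].
Defined.
End Restriction.

(* K ⊗_H M: the free abelian group on the symbols h ⊗ m, modulo biadditivity
   and (h phi(r)) ⊗ m = h ⊗ (r m). *)
Inductive tterm (K M : Type) : Type :=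
| TPure of K & M
| TtZero
| TtAdd of tterm K M & tterm K M
| TtOpp of tterm K M.
Arguments TtZero {K M}.

Declare Scope tterm_scope.
Delimit Scope tterm_scope with tterm.
Bind Scope tterm_scope with tterm.
Notation "0" := TtZero : tterm_scope.
Infix "+" := TtAdd : tterm_scope.
Notation "- x" := (TtOpp x) : tterm_scope.
Notation "x ⊗ y" := (TPure x%R y%R) (at level 40) : tterm_scope.

Inductive tcong (k : comNzRingType) (H K : superAlgType k)
    (phi : superAlgHom H K) (M : superModType H) :
    tterm K M -> tterm K M -> Prop :=
| t_refl s : tcong phi s s
| t_sym s t : tcong phi s t -> tcong phi t s
| t_trans s t u : tcong phi s t -> tcong phi t u -> tcong phi s u
| t_add s s' t t' :
    tcong phi s s' -> tcong phi t t' -> tcong phi (s + t) (s' + t')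
| t_opp s s' : tcong phi s s' -> tcong phi (- s) (- s')
| t_addA s t u : tcong phi (s + (t + u)) (s + t + u)
| t_addC s t : tcong phi (s + t) (t + s)
| t_add0 s : tcong phi (0 + s) s
| t_addN s : tcong phi (- s + s) 0
| t_pureDl h h' m : tcong phi ((h + h') ⊗ m) (h ⊗ m + h' ⊗ m)
| t_pureDr h m m' : tcong phi (h ⊗ (m + m')) (h ⊗ m + h ⊗ m')
| t_balanced h (r : H) m : tcong phi ((h * phi r) ⊗ m) (h ⊗ (r *: m)).

HB.instance Definition _ K M := gen_eqMixin (tterm K M).
HB.instance Definition _ K M := gen_choiceMixin (tterm K M).

Section Induced.
Variables (k : comNzRingType) (H K : superAlgType k) (phi : superAlgHom H K).

Section IndMod.
Variable M : superModType H.
Local Notation tcg := (@tcong k H K phi M).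

Definition tcongb : rel (tterm K M) := fun s t => `[< tcg s t >].

Lemma tcongb_equiv : equiv_class_of tcongb.
Proof.
split=> [s|s t|t s u]; rewrite /tcongb.
- by apply/asboolP; exact: t_refl.
- by apply/asboolP/asboolP => ?; exact: t_sym.
- by move=> /asboolP st /asboolP tu; apply/asboolP; exact: t_trans st tu.
Qed.

Canonical tcong_equiv := EquivRelPack tcongb_equiv.

Definition tensor : Type := {eq_quot tcong_equiv}.

HB.instance Definition _ := Choice.on tensor.

Definition tcls (t : tterm K M) : tensor := \pi_({eq_quot tcong_equiv}) t.
Definition trep (x : tensor) : tterm K M := repr (x : {eq_quot tcong_equiv}).

Lemma trepK x : tcls (trep x) = x.
Proof. exact: reprK. Qed.

Lemma tclsE s t : (tcls s = tcls t) <-> tcg s t.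
Proof.
split=> [|st]; first by move/eqmodP/asboolP.
by apply/eqmodP/asboolP.
Qed.

Lemma trep_cls s : tcg (trep (tcls s)) s.
Proof. by apply/tclsE; rewrite trepK. Qed.

Lemma tclsP (P : tensor -> Prop) : (forall s, P (tcls s)) -> forall x, P x.
Proof. by move=> h x; rewrite -(trepK x). Qed.

Let add x y := tcls (trep x + trep y).
Let opp x := tcls (- trep x).
Let addE s t : add (tcls s) (tcls t) = tcls (s + t).
Proof. by apply/tclsE/t_add; exact: trep_cls. Qed.
Let oppE s : opp (tcls s) = tcls (- s).
Proof. by apply/tclsE/t_opp; exact: trep_cls. Qed.
Let addA : associative add.
Proof.
by elim/tclsP=> s; elim/tclsP=> t; elim/tclsP=> u; rewrite !addE; apply/tclsE/t_addA.
Qed.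
Let addC : commutative add.
Proof. by elim/tclsP=> s; elim/tclsP=> t; rewrite !addE; apply/tclsE/t_addC. Qed.
Let add0 : left_id (tcls 0) add.
Proof. by elim/tclsP=> s; rewrite !addE; apply/tclsE/t_add0. Qed.
Let addN : left_inverse (tcls 0) opp add.
Proof. by elim/tclsP=> s; rewrite oppE !addE; apply/tclsE/t_addN. Qed.
HB.instance Definition _ := GRing.isZmodule.Build tensor addA addC add0 addN.

Definition pure (h : K) (m : M) : tensor := tcls (h ⊗ m).

Lemma tclsD s t : tcls (s + t) = tcls s + tcls t.
Proof. exact: esym (addE s t). Qed.
Lemma tclsN s : tcls (- s) = - tcls s.
Proof. exact: esym (oppE s). Qed.
Lemma pureDl h h' m : pure (h + h') m = pure h m + pure h' m.
Proof. by rewrite -tclsD; apply/tclsE/t_pureDl. Qed.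
Lemma pureDr h m m' : pure h (m + m') = pure h m + pure h m'.
Proof. by rewrite -tclsD; apply/tclsE/t_pureDr. Qed.
Lemma pure_balanced h r m : pure (h * phi r) m = pure h (r *: m).
Proof. exact/tclsE/t_balanced. Qed.

Lemma pure_ind (P : tensor -> Prop) :
  P 0 -> (forall x y, P x -> P y -> P (x + y)) -> (forall x, P x -> P (- x)) ->
  (forall h m, P (pure h m)) -> forall x, P x.
Proof.
move=> P0 PD PN Pp; elim/tclsP; elim=> //= [s Ps t Pt|s Ps].
  by rewrite tclsD; apply: PD.
by rewrite tclsN; apply: PN.
Qed.

Section TensorLift.
Variables (V : zmodType) (g : K -> M -> V).
Hypothesis gDl : forall h h' m, g (h + h') m = g h m + g h' m.
Hypothesis gDr : forall h m m', g h (m + m') = g h m + g h m'.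
Hypothesis gB : forall h r m, g (h * phi r) m = g h (r *: m).

Fixpoint teval (t : tterm K M) : V :=
  match t with
  | TPure h m => g h m
  | TtZero => 0
  | TtAdd s t => teval s + teval t
  | TtOpp s => - teval s
  end.

Lemma teval_cong s t : tcg s t -> teval s = teval t.
Proof.
elim=> //=; clear -gDl gDr gB.
- by move=> s t u _ -> _ ->.
- by move=> s s' t t' _ -> _ ->.
- by move=> s s' _ ->.
- by move=> *; rewrite addrA.
- by move=> *; rewrite addrC.
- by move=> *; rewrite add0r.
- by move=> *; rewrite addNr.
Qed.

Definition tlift (x : tensor) : V := teval (trep x).

Lemma tlift_cls s : tlift (tcls s) = teval s.
Proof. by apply: teval_cong; exact: trep_cls. Qed.
Lemma tlift_pure h m : tlift (pure h m) = g h m.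
Proof. exact: tlift_cls. Qed.
Lemma tliftD : {morph tlift : x y / x + y}.
Proof. by elim/tclsP=> s; elim/tclsP=> t; rewrite -tclsD !tlift_cls. Qed.
Lemma tlift0 : tlift 0 = 0.
Proof. by apply: (addIr (tlift 0)); rewrite -tliftD !add0r. Qed.
Lemma tliftN : {morph tlift : x / - x}.
Proof. by move=> x; apply: (addIr (tlift x)); rewrite -tliftD !addNr tlift0. Qed.
End TensorLift.

Lemma tens_ext (V : zmodType) (u v : tensor -> V) :
  {morph u : x y / x + y} -> {morph v : x y / x + y} ->
  (forall h m, u (pure h m) = v (pure h m)) -> u =1 v.
Proof.
move=> uD vD uv.
have z (w : tensor -> V) : {morph w : x y / x + y} -> w 0 = 0.
  by move=> wD; apply: (addIr (w 0)); rewrite -wD !add0r.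
have n (w : tensor -> V) : {morph w : x y / x + y} -> {morph w : x / - x}.
  by move=> wD x; apply: (addIr (w x)); rewrite -wD !addNr z.
elim/pure_ind=> [|x y ux uy|x ux|//]; first by rewrite !z.
  by rewrite uD vD ux uy.
by rewrite !n // ux.
Qed.

Let tscale (h : K) : tensor -> tensor := tlift (fun h' m => pure (h * h') m).
Let tscale_pure h h' m : tscale h (pure h' m) = pure (h * h') m.
Proof.
apply: (@tlift_pure _ (fun h' m => pure (h * h') m)) => *.
- by rewrite mulrDr pureDl.
- by rewrite pureDr.
- by rewrite mulrA pure_balanced.
Qed.
Let tscaleDr : right_distributive tscale +%R.
Proof.
move=> h; apply: tliftD => *.
- by rewrite mulrDr pureDl.
- by rewrite pureDr.
- by rewrite mulrA pure_balanced.
Qed.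
Let tscaleA a b v : tscale a (tscale b v) = tscale (a * b) v.
Proof.
move: v; apply: tens_ext => [x y|x y|h m]; rewrite ?tscaleDr //.
by rewrite !tscale_pure mulrA.
Qed.
Let tscale1 : left_id 1 tscale.
Proof.
apply: (@tens_ext tensor (tscale 1) id) => [x y|//|h m]; rewrite ?tscaleDr //.
by rewrite tscale_pure mul1r.
Qed.
Let tscaleDl v : {morph tscale^~ v: a b / a + b}.
Proof.
move=> a b; move: v; apply: (@tens_ext tensor (tscale (a + b))
  (fun v => tscale a v + tscale b v)) => [x y|x y|h m].
- by rewrite tscaleDr.
- by rewrite !tscaleDr addrACA.
- by rewrite !tscale_pure mulrDl pureDl.
Qed.
HB.instance Definition _ :=
  GRing.Zmodule_isLmodule.Build K tensor tscaleA tscale1 tscaleDr tscaleDl.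

Lemma scale_pure (h h' : K) m : h *: pure h' m = pure (h * h') m.
Proof. exact: tscale_pure. Qed.

Let cpure p (h : K) (m : M) : tensor :=
  pure (part false h) (part p m) + pure (part true h) (part (~~ p) m).
Let cpureDl p h h' m : cpure p (h + h') m = cpure p h m + cpure p h' m.
Proof. by rewrite /cpure !partD !pureDl addrACA. Qed.
Let cpureDr p h m m' : cpure p h (m + m') = cpure p h m + cpure p h m'.
Proof. by rewrite /cpure !partD !pureDr addrACA. Qed.
Let cpureB p h r m : cpure p (h * phi r) m = cpure p h (r *: m).
Proof.
rewrite /cpure !partM !part_scale -!sa_map_part !pureDl !pureDr.
by rewrite !pure_balanced addrACA [X in _ + X]addrC negbK.
Qed.
Let tpart p : tensor -> tensor := tlift (cpure p).
Let tpart_pure p h m : tpart p (pure h m) = cpure p h m.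
Proof. by apply: tlift_pure. Qed.
Let tpartD p : {morph tpart p : x y / x + y}.
Proof. by apply: tliftD. Qed.
Let tpart0 p : tpart p 0 = 0.
Proof. by apply: tlift0. Qed.
Let tpart_sum x : tpart false x + tpart true x = x.
Proof.
move: x; apply: (@tens_ext tensor (fun x => tpart false x + tpart true x) id)
  => [x y|//|h m]; first by rewrite !tpartD addrACA.
rewrite !tpart_pure /cpure /= addrACA -!pureDr.
by rewrite part_sum [part true m + _]addrC part_sum -pureDl part_sum.
Qed.
Let pure0l m : pure 0 m = 0.
Proof. by apply: (addIr (pure 0 m)); rewrite -pureDl !add0r. Qed.
Let pure0r h : pure h 0 = 0.
Proof. by apply: (addIr (pure h 0)); rewrite -pureDr !add0r. Qed.
Let tpart_part p q x : tpart p (tpart q x) = if p == q then tpart q x else 0.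
Proof.
move: x; apply: (@tens_ext tensor (fun x => tpart p (tpart q x))
  (fun x => if p == q then tpart q x else 0)) => [x y|x y|h m].
- by rewrite !tpartD.
- by case: ifP; rewrite ?tpartD ?addr0.
- rewrite !(tpart_pure, tpartD) /cpure !part_part /=.
  by case: p q => [] [] /=; rewrite ?(pure0l, pure0r, addr0, add0r).
Qed.
HB.instance Definition _ :=
  Zmodule_isSuper.Build tensor tpartD tpart_sum tpart_part.

Lemma part_pure p h m : part p (pure h m) =
  pure (part false h) (part p m) + pure (part true h) (part (~~ p) m).
Proof. exact: tpart_pure. Qed.

Let thomog_scale p q (h : K) (x : tensor) :
  homog p h -> homog q x -> homog (p (+) q) (h *: x).
Proof.
move=> hh <-; rewrite /homog; move: x.
apply: (@tens_ext tensor (fun x => part (p (+) q) (h *: part q x))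
  (fun x => h *: part q x)) => [x y|x y|h' m].
- by rewrite !(partD, scalerDr).
- by rewrite !(partD, scalerDr).
rewrite part_pure scalerDr !scale_pure partD !part_pure !partM !part_part -hh !part_part.
case: p q {hh} => [] [] /=; rewrite ?(mulr0, mul0r, addr0, add0r, pure0l, pure0r) //.
Qed.
HB.instance Definition _ := isSuperModule.Build k K tensor thomog_scale.
End IndMod.

Section IndHom.
Variables (M N : superModType H) (f : superModHom M N).
Let gf (h : K) (m : M) : tensor N := pure h (f m).
Let gfDl h h' m : gf (h + h') m = gf h m + gf h' m.
Proof. exact: pureDl. Qed.
Let gfDr h m m' : gf h (m + m') = gf h m + gf h m'.
Proof. by rewrite /gf linearD pureDr. Qed.
Let gfB h r m : gf (h * phi r) m = gf h (r *: m).
Proof. by rewrite /gf pure_balanced linearZ. Qed.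
Definition indMap : tensor M -> tensor N := tlift gf.
Let indMap_pure h m : indMap (pure h m) = pure h (f m).
Proof. by apply: tlift_pure. Qed.
Let indMapD : {morph indMap : x y / x + y}.
Proof. by apply: tliftD. Qed.
Let indMap_linear : linear indMap.
Proof.
move=> a x y; rewrite indMapD; congr (_ + _); move: x.
apply: (@tens_ext M (tensor N) (fun x => indMap (a *: x)) (fun x => a *: indMap x)).
- by move=> x z; rewrite scalerDr indMapD.
- by move=> x z; rewrite indMapD scalerDr.
- by move=> h m; rewrite scale_pure !indMap_pure scale_pure.
Qed.
Let indMap_comp p x : indMap (part p x) = part p (indMap x).
Proof.
move: x; apply: (@tens_ext M (tensor N) (fun x => indMap (part p x))
  (fun x => part p (indMap x))).
- by move=> x y; rewrite partD indMapD.
- by move=> x y; rewrite indMapD partD.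
- by move=> h m; rewrite part_pure indMapD !indMap_pure part_pure !sm_map_part.
Qed.
HB.instance Definition _ :=
  GRing.isLinear.Build K (tensor M) (tensor N) *:%R indMap indMap_linear.
Definition indHom : superModHom (tensor M : superModType K) (tensor N) :=
  @SuperModHom k K (tensor M) (tensor N) indMap indMap_comp.

Lemma indHom_pure h m : indHom (pure h m) = pure h (f m).
Proof. exact: indMap_pure. Qed.
End IndHom.

Definition indFunctor : superFunctor H K.
Proof.
refine (@SuperFunctor k H K (fun M => tensor M) indHom _ _ _).
- move=> M N f g fg; apply: (@tens_ext M (tensor N) (indHom f) (indHom g)).
  + exact: linearD.
  + exact: linearD.
  + by move=> h m; rewrite !indHom_pure fg.
- move=> M; apply: (@tens_ext M (tensor M) (indHom (idModHom M)) id) => //.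
    exact: linearD.
  by move=> h m; rewrite indHom_pure.
- move=> M N P g f; apply: (@tens_ext M (tensor P) (indHom (compModHom g f))
    (indHom g \o indHom f)).
  + exact: linearD.
  + exact: (linearD (compModHom (indHom g) (indHom f))).
  + move=> h m; rewrite indHom_pure; apply: esym.
    by apply: (etrans (congr1 (indHom g) (indHom_pure f h m))); exact: indHom_pure.
Defined.
End Induced.

Section Symmetric.
Variables (k : comNzRingType) (A : superAlgType k).

Definition k_linear (phi : A -> k) : Prop :=
  {morph phi : x y / x + y} /\ forall (c : k) x, phi (c%:K * x) = c * phi x.

(* The last clause says that a |-> tr(a _) is bijective onto Hom_k(A, k);
   that this map preserves parity is a consequence of the second clause. *)
Definition symmetrizing (tr : A -> k) : Prop :=
  [/\ k_linear tr,
      forall a, homog true a -> tr a = 0,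
      forall p q a b, homog p a -> homog q b ->
        tr (a * b) = (-1) ^+ (p && q) * tr (b * a)
    & forall phi : A -> k, k_linear phi ->
        exists! a, forall b, tr (a * b) = phi b].

Definition homogeneous_basis (B : finType) (b : B -> A) (par : B -> bool) :
    Prop :=
  (forall i, homog (par i) (b i)) /\
  (forall a, exists! u : {ffun B -> k}, a = \sum_i (u i)%:K * b i).

Definition dual_basis (tr : A -> k) (B : finType) (b bd : B -> A) : Prop :=
  forall i j, tr (bd i * b j) = (i == j)%:R.

Definition supercentral (a : A) : Prop :=
  forall p q b, homog q b ->
    part p a * b = (-1) ^+ (p && q) * (b * part p a).

Definition invertible (a : A) : Prop := exists u, u * a = 1 /\ a * u = 1.

End Symmetric.

(* Generators: [GTens a] is the pure tensor a_1 ⊗ ... ⊗ a_n, and [GT i] is T_i.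
   Indices are numbered from 0. *)
Inductive gen (A : choiceType) (n : nat) : Type :=
| GTens of {ffun 'I_n -> A}
| GX of 'I_n
| GXinv of 'I_n
| GT of 'I_n.-1.
Arguments GX {A n}. Arguments GXinv {A n}. Arguments GT {A n}.

Section Indices.
Variable n : nat.

(* For i : 'I_n.-1, the positions i and i+1 permuted by s_i. *)
Definition pos0 (i : 'I_n.-1) : 'I_n := widen_ord (leq_pred n) i.

Lemma pos1_subproof (i : 'I_n.-1) : (i.+1 < n)%N.
Proof. by case: n i => [[]|m i]//; rewrite ltnS. Qed.

Definition pos1 (i : 'I_n.-1) : 'I_n := Ordinal (pos1_subproof i).

Definition swap_pos (i : 'I_n.-1) (j : 'I_n) : 'I_n :=
  if j == pos0 i then pos1 i else if j == pos1 i then pos0 i else j.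

End Indices.

Section Hecke.
Variables (k : comNzRingType) (z : k) (A : superAlgType k).
Variables (B : finType) (b bd : B -> A).

Section Relations.
Variable n : nat.
Notation tm := (term k (gen A n)).
Implicit Types (a : {ffun 'I_n -> A}) (p q : {ffun 'I_n -> bool}).

Definition tens a : tm := TVar (GTens a).
Definition tX (i : 'I_n) : tm := TVar (GX i).
Definition tXinv (i : 'I_n) : tm := TVar (GXinv i).
Definition tT (i : 'I_n.-1) : tm := TVar (GT i).

Definition upd a (i : 'I_n) (x : A) : {ffun 'I_n -> A} :=
  [ffun j => if j == i then x else a j].

(* x_i = 1 ⊗ ... ⊗ x ⊗ ... ⊗ 1 *)
Definition at_pos (i : 'I_n) (x : A) : tm := tens (upd [ffun=> 1] i x).

Definition t_elt (i j : 'I_n) : tm :=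
  (\sum_(e : B) at_pos i (b e) * at_pos j (bd e))%term.

Definition tparity p : bool := \big[addb/false]_i p i.

(* exponent of the sign in
   (a_1 ⊗ ... ⊗ a_n)(a'_1 ⊗ ... ⊗ a'_n) = ± a_1 a'_1 ⊗ ... ⊗ a_n a'_n *)
Definition koszul p q : nat := \sum_(i < n) \sum_(j < n | (j < i)%N) (p i && q j).

(* the superalgebra A^{⊗ n} *)
Inductive tens_rel : tm -> tm -> Prop :=
| r_linear a i (c : k) x y :
    tens_rel (tens (upd a i (c%:K * x + y)))
             (c%:K * tens (upd a i x) + tens (upd a i y))
| r_parity a p : (forall i, homog (p i) (a i)) ->
    tens_rel (TPart (tparity p) (tens a)) (tens a)
| r_one : tens_rel (tens [ffun=> 1]) 1
| r_mul a a' p q :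
    (forall i, homog (p i) (a i)) -> (forall i, homog (q i) (a' i)) ->
    tens_rel (tens a * tens a')
             (((-1) ^+ koszul p q)%:K * tens [ffun i => a i * a' i]).

(* the further relations of H_n(A, z) *)
Inductive hecke_rel : tm -> tm -> Prop :=
| r_Teven i : hecke_rel (TPart false (tT i)) (tT i)
| r_Tcomm (i j : 'I_n.-1) : (i.+1 < j)%N || (j.+1 < i)%N ->
    hecke_rel (tT i * tT j) (tT j * tT i)
| r_braid (i j : 'I_n.-1) : j = i.+1 :> nat ->
    hecke_rel (tT i * tT j * tT i) (tT j * tT i * tT j)
| r_quad i :
    hecke_rel (tT i * tT i) (z%:K * (t_elt (pos0 i) (pos1 i) * tT i) + 1)
| r_Ttens i a p : (forall j, homog (p j) (a j)) ->
    hecke_rel (tT i * tens a)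
      (((-1) ^+ (p (pos0 i) && p (pos1 i)))%:K
       * (tens [ffun j => a (swap_pos i j)] * tT i)).

(* the further relations of H_n^aff(A, z) *)
Inductive affine_rel : tm -> tm -> Prop :=
| r_Xeven i : affine_rel (TPart false (tX i)) (tX i)
| r_Xinveven i : affine_rel (TPart false (tXinv i)) (tXinv i)
| r_XXinv i : affine_rel (tX i * tXinv i) 1
| r_XinvX i : affine_rel (tXinv i * tX i) 1
| r_Xcomm i j : affine_rel (tX i * tX j) (tX j * tX i)
| r_TX i j : j <> pos0 i -> j <> pos1 i ->
    affine_rel (tT i * tX j) (tX j * tT i)
| r_TXT i : affine_rel (tT i * tX (pos0 i) * tT i) (tX (pos1 i))
| r_Xtens i a : affine_rel (tX i * tens a) (tens a * tX i).

Variables (d : nat) (c : 'I_d -> A).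

(* f = 0, imposed only if there is an X_1, i.e. if n >= 1 *)
Inductive cyclotomic_rel : tm -> tm -> Prop :=
| r_f (i : 'I_n) : i = 0%N :> nat ->
    cyclotomic_rel (tX i ^+ d + \sum_(l < d) at_pos i (c l) * tX i ^+ l) 0.

Definition Haff_rel (s t : tm) : Prop :=
  [\/ tens_rel s t, hecke_rel s t | affine_rel s t].

Definition Hf_rel (s t : tm) : Prop := Haff_rel s t \/ cyclotomic_rel s t.

End Relations.

Variables (d : nat) (c : 'I_d -> A).

(* For n = 0 this is the ground ring: see [Hf0_ground]. *)
Definition Hf (n : nat) : superAlgType k := presAlg (@Hf_rel n d c).

Section Inclusion.
(* The homomorphism H_n^f -> H_{n+1}^f, a |-> a ⊗ 1, X_i |-> X_i, T_i |-> T_i,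
   along which induction and restriction are taken. *)
Variable n : nat.

Definition extend (V : Type) (v0 : V) (a : {ffun 'I_n -> V}) :
    {ffun 'I_n.+1 -> V} :=
  [ffun j => oapp a v0 (unlift ord_max j)].

Definition extT (i : 'I_n.-1) : 'I_n.+1.-1 := widen_ord (leq_pred n) i.

Definition incl_gen (g : gen A n) : Hf n.+1 :=
  cls _ match g with
        | GTens a => tens (extend 1 a)
        | GX i => tX (lift ord_max i)
        | GXinv i => tXinv (lift ord_max i)
        | GT i => tT (extT i)
        end.

Let ext_lift (V : Type) (v0 : V) a i : extend v0 a (lift ord_max i) = a i.
Proof. by rewrite ffunE liftK. Qed.
Let ext_max (V : Type) (v0 : V) a : extend v0 a ord_max = v0.
Proof. by rewrite ffunE unlift_none. Qed.
Let widen_lift (i : 'I_n) : widen_ord (leqnSn n) i = lift ord_max i.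
Proof. by apply: val_inj; rewrite /= /bump leqNgt ltn_ord. Qed.

Let ord_case (P : 'I_n.+1 -> Prop) :
  P ord_max -> (forall i, P (lift ord_max i)) -> forall j, P j.
Proof. by move=> P0 P1 j; case: (unliftP ord_max j) => [i|] ->. Qed.

Let ext_upd a i x : extend 1 (upd a i x) = upd (extend 1 a) (lift ord_max i) x.
Proof.
apply/ffunP; elim/ord_case=> [|j]; rewrite [RHS]ffunE.
  by rewrite !ext_max (negPf (neq_lift _ _)).
by rewrite !ext_lift ffunE (inj_eq lift_inj).
Qed.

Let ext_one : extend 1 [ffun=> 1] = [ffun=> 1] :> {ffun 'I_n.+1 -> A}.
Proof.
by apply/ffunP; elim/ord_case=> [|j]; rewrite ?ext_max ?ext_lift !ffunE.
Qed.

Let ext_homog (a : {ffun 'I_n -> A}) (p : {ffun 'I_n -> bool}) :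
  (forall i, homog (p i) (a i)) -> forall j, homog (extend false p j) (extend 1 a j).
Proof.
by move=> h; elim/ord_case=> [|j]; rewrite ?ext_max ?ext_lift //; exact: homog1.
Qed.

Let ext_parity p : tparity (extend false p) = tparity p.
Proof.
rewrite /tparity big_ord_recr /= ext_max addbF.
by apply: eq_bigr => i _; rewrite widen_lift ext_lift.
Qed.

Let ext_koszul p q : koszul (extend false p) (extend false q) = koszul p q.
Proof.
rewrite /koszul big_ord_recr /= [X in (_ + X)%N]big1 ?addn0; last first.
  by move=> j _; rewrite ext_max.
apply: eq_bigr => i _; rewrite widen_lift ext_lift.
rewrite big_mkcond big_ord_recr /= ext_max andbF if_same addn0 -big_mkcond.
apply: eq_big => [//|j _].
by rewrite widen_lift ext_lift.
Qed.

Let pos0_ext i : pos0 (extT i) = lift ord_max (pos0 i).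
Proof. by apply: ord_inj; rewrite lift_max. Qed.
Let pos1_ext i : pos1 (extT i) = lift ord_max (pos1 i).
Proof. by apply: ord_inj; rewrite lift_max. Qed.

Let swap_ext i j : swap_pos (extT i) (lift ord_max j) = lift ord_max (swap_pos i j).
Proof.
rewrite /swap_pos pos0_ext pos1_ext !(inj_eq lift_inj).
by case: ifP => // _; case: ifP.
Qed.
Let swap_max i : swap_pos (extT i) ord_max = ord_max.
Proof. by rewrite /swap_pos pos0_ext pos1_ext !(negPf (neq_lift _ _)). Qed.

Notation ev := (eval_term incl_gen).
Notation cl := (cls (@Hf_rel n.+1 d c)).

Let tens_eq s t : tens_rel s t -> cl s = cl t.
Proof. by move=> h; apply/clsE/c_rel; left; constructor. Qed.
Let hecke_eq s t : hecke_rel s t -> cl s = cl t.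
Proof. by move=> h; apply/clsE/c_rel; left; constructor. Qed.
Let affine_eq s t : affine_rel s t -> cl s = cl t.
Proof. by move=> h; apply/clsE/c_rel; left; constructor. Qed.

Let ev_at i x : ev (at_pos i x) = cls _ (at_pos (lift ord_max i) x).
Proof. by rewrite /at_pos -ext_one -ext_upd. Qed.

Let ev_tX i : ev (tX i) = cls _ (tX (lift ord_max i)). Proof. by []. Qed.

Let ev_exp (t : term k (gen A n)) (t' : term k (gen A n.+1)) m :
  ev t = cls _ t' -> ev (t ^+ m)%term = cls _ (t' ^+ m)%term.
Proof. by move=> h; elim: m => //= m ->; rewrite h clsM. Qed.

Let ev_sum (I : finType) (F : I -> term k (gen A n)) (F' : I -> term k (gen A n.+1)) :
  (forall i, ev (F i) = cls _ (F' i)) ->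
  ev (\sum_(i : I) F i)%term = cls _ (\sum_(i : I) F' i)%term.
Proof.
move=> h; rewrite !unlock; elim: (index_enum I) => //= i s IH.
by rewrite clsD -IH h.
Qed.

Let tens_ok s t : tens_rel s t -> ev s = ev t.
Proof.
case=> [a i e x y|a p h||a a' p q h h']; rewrite /= /incl_gen.
- rewrite !ext_upd (tens_eq (r_linear _ _ _ _ _)) clsD.
  by congr (_ + _); rewrite clsM.
- rewrite -ext_parity -cls_part; apply: tens_eq.
  by apply: r_parity; exact: ext_homog.
- by rewrite ext_one; apply: tens_eq; exact: r_one.
- have -> : extend 1 [ffun i => a i * a' i] = [ffun i => extend 1 a i * extend 1 a' i].
    apply/ffunP; elim/ord_case=> [|j]; rewrite [RHS]ffunE.
      by rewrite !ext_max mulr1.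
    by rewrite !ext_lift ffunE.
  rewrite -(ext_koszul p q).
  by have := tens_eq (r_mul (ext_homog h) (ext_homog h')); rewrite !clsM.
Qed.

Let hecke_ok s t : hecke_rel s t -> ev s = ev t.
Proof.
case=> [i|i j h|i j h|i|i a p h].
- by have := hecke_eq (r_Teven (extT i)); rewrite cls_part.
- by have := @hecke_eq _ _ (@r_Tcomm _ (extT i) (extT j) h); rewrite !clsM.
- by have := @hecke_eq _ _ (@r_braid _ (extT i) (extT j) h); rewrite !clsM.
- have := hecke_eq (r_quad (extT i)); rewrite clsM => e.
  rewrite -[LHS]/(cl _ * cl _) e clsD !clsM.
  congr (_ * (_ * _) + _); apply: esym.
  by apply: ev_sum => l; rewrite pos0_ext pos1_ext clsM -!ev_at.
- have -> : p (pos0 i) && p (pos1 i) =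
    extend false p (pos0 (extT i)) && extend false p (pos1 (extT i)).
    by rewrite pos0_ext pos1_ext !ext_lift.
  have := hecke_eq (r_Ttens (extT i) (ext_homog h)); rewrite !clsM => e.
  rewrite -[LHS]/(cl _ * cl _) e /= /incl_gen.
  congr (_ * (cl (tens _) * _)); apply/ffunP; elim/ord_case=> [|j]; rewrite [LHS]ffunE.
    by rewrite swap_max !ext_max.
  by rewrite swap_ext !ext_lift ffunE.
Qed.

Let affine_ok s t : affine_rel s t -> ev s = ev t.
Proof.
case=> [i|i|i|i|i j|i j h0 h1|i|i a].
- by have := affine_eq (r_Xeven (lift ord_max i)); rewrite cls_part.
- by have := affine_eq (r_Xinveven (lift ord_max i)); rewrite cls_part.
- by have := affine_eq (r_XXinv (lift ord_max i)); rewrite clsM.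
- by have := affine_eq (r_XinvX (lift ord_max i)); rewrite clsM.
- by have := affine_eq (r_Xcomm (lift ord_max i) (lift ord_max j)); rewrite !clsM.
- have h0' : lift ord_max j <> pos0 (extT i) by rewrite pos0_ext => /lift_inj.
  have h1' : lift ord_max j <> pos1 (extT i) by rewrite pos1_ext => /lift_inj.
  by have := affine_eq (r_TX h0' h1'); rewrite !clsM.
- by have := affine_eq (r_TXT (extT i)); rewrite pos0_ext pos1_ext !clsM.
- by have := affine_eq (r_Xtens (lift ord_max i) (extend 1 a)); rewrite !clsM.
Qed.

Let cyclotomic_ok s t : cyclotomic_rel c s t -> ev s = ev t.
Proof.
case=> i i0.
transitivity (cls (@Hf_rel n.+1 d c) (tX (lift ord_max i) ^+ d
  + \sum_(l < d) at_pos (lift ord_max i) (c l) * tX (lift ord_max i) ^+ l)%term).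
  rewrite clsD; congr (_ + _); first exact: ev_exp.
  apply: ev_sum => l; rewrite clsM -(ev_at i (c l)) -[LHS]/(_ * _).
  by congr (_ * _); exact: ev_exp.
apply/clsE/c_rel; right; apply: r_f.
by rewrite lift_max.
Qed.

Lemma incl_ok s t : @Hf_rel n d c s t -> ev s = ev t.
Proof.
by case=> [[/tens_ok|/hecke_ok|/affine_ok]|/cyclotomic_ok].
Qed.

Definition incl : superAlgHom (Hf n) (Hf n.+1) := lift_hom incl_ok.

End Inclusion.

Fixpoint aug (t : term k (gen A 0)) : k :=
  match t with
  | TVar _ => 1
  | TConst e => e
  | TAdd s t => aug s + aug t
  | TOpp s => - aug s
  | TMul s t => aug s * aug t
  | TPart p s => if p then 0 else aug s
  end.

Let aug_rel s t : @Hf_rel 0 d c s t -> aug s = aug t.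
Proof.
case=> [[h|h|h]|h]; try by case: h => -[].
case: h => [a []|a p _||a a' p q _ _] //=.
  by rewrite /tparity big_ord0.
by rewrite /koszul big_ord0.
Qed.

Let aug_cong s t : cong (@Hf_rel 0 d c) s t -> aug s = aug t.
Proof.
elim=> {s t}; first by move=> s t h; exact: aug_rel h.
all: move=> //=.
- by move=> s t u _ -> _ ->.
- by move=> s s' t t' _ -> _ ->.
- by move=> s s' _ ->.
- by move=> s s' t t' _ -> _ ->.
- by move=> p s s' _ ->.
- by move=> *; rewrite addrA.
- by move=> *; rewrite addrC.
- by move=> *; rewrite add0r.
- by move=> *; rewrite addNr.
- by move=> *; rewrite mulrA.
- by move=> *; rewrite mul1r.
- by move=> *; rewrite mulr1.
- by move=> *; rewrite mulrDl.
- by move=> *; rewrite mulrDr.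
- by move=> *; rewrite mulrC.
- by case=> s t; rewrite ?addr0.
- by move=> s; rewrite addr0.
- by case=> [] [] s.
- by case=> [] [] s t; rewrite ?mul0r ?mulr0.
Qed.

Lemma Hf0_ground : bijective (fun e : k => e%:K : Hf 0).
Proof.
exists (fun x : Hf 0 => aug (rep x)) => [e|].
  exact: (aug_cong (rep_cls _ e%:K%term)).
elim/clsP=> t; rewrite (aug_cong (rep_cls _ t)).
elim: t => [[a|[]|[]|[]]|e|s hs t ht|s hs|s hs t ht|p s hs] //=.
- rewrite inK1; have -> : a = [ffun=> 1] by apply/ffunP; case.
  by apply/esym/clsE/c_rel; left; constructor; exact: r_one.
- by rewrite clsD inKD hs ht.
- by rewrite clsN inKN hs.
- by rewrite clsM inKM hs ht.
- by rewrite cls_part -hs; case: p; rewrite ?inK0 ?(homogK (aug s)) //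
    (homog_neq (homogK (aug s))).
Qed.

Definition fInd (n : nat) : superFunctor (Hf n) (Hf n.+1) := indFunctor (incl n).
Definition fRes (n : nat) : superFunctor (Hf n.+1) (Hf n) := resFunctor (incl n).

End Hecke.

(* Main.v *)
(* The induced module of an H_N-module M has an explicit model W(M): a direct sum
   of copies of M indexed by b in B and by the cosets (j, r), j <= N, r < d, of
   G(d, 1, N) in G(d, 1, N + 1). The generators are made to act on W(M) by
   formulas, for which the defining relations are checked; the resulting maps
   between W(M) and the induced module are then mutually inverse, so that no basis
   theorem for H_{N+1} has to be known beforehand.

   In W(M) the cosets with j < N make up Ind Res M, embedded by
   h (x) m |-> h T_N (x) m. The remaining coset representatives E_{N,r} may be
   replaced by the powers X_{N+1}^r, because X_{N+1}^r = E_{N,r} modulo cosets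
   that come earlier in a suitable order. Since X_{N+1}^r and b_{N+1} supercommute
   with H_N, each of them contributes a copy of M, shifted by the parity of b; for
   odd b, the map m |-> (-1)^|m| m absorbs the sign. *)

(* The shape of the representatives keeps the formulas short. For r = 0 they are T_j ... T_{N-1},
   for r > 0 they are T_{j-1} ... T_0 X^r T_0 ... T_{N-1}. Each T_i either passes such an element as
   a generator of H_N, or exchanges the cosets i and i + 1 up to one teleporter term. Only X on a
   coset with j, r > 0 needs a longer correction, which comes from comparing X with T_0 X^r T_0. The
   obstacle is to check the relations on W(M) without a large case analysis. The defect of a
   relation commutes or skew-commutes with suitable generators, so that its kernel is stable under
   them; it then has to be shown to vanish only on a few cosets from which the others are reached.
   The exception is X T_0 X T_0 = T_0 X T_0 X on the coset (2, r): it is reached by T_1, which does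
   not commute with T_0, and has to be computed directly. The inverses of the X_i cost nothing: f
   has an invertible constant term, so that the inverse of X_1 is a polynomial in X_1 with
   coefficients from A. *)
From HB Require Import structures.
From mathcomp Require Import all_boot all_algebra zify.
From mathcomp Require Import boolp.
Require Import Defs.

Set Implicit Arguments.
Unset Strict Implicit.
Unset Printing Implicit Defensive.

Import GRing.Theory.
Local Open Scope ring_scope.

(* A reflexive decision procedure for equations in abelian groups: [ring] only
   handles commutative rings. *)
Inductive zexpr := ZVar of nat | ZZero | ZAdd of zexpr & zexpr | ZOpp of zexpr.

Section ZExpr.
Variable V : zmodType.

Fixpoint zeval (v : seq V) (e : zexpr) : V :=
  match e with
  | ZVar i => v`_i
  | ZZero => 0
  | ZAdd x y => zeval v x + zeval v y
  | ZOpp x => - zeval v x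
  end.

Fixpoint zcoef (e : zexpr) (i : nat) : int :=
  match e with
  | ZVar j => (i == j)%:Z
  | ZZero => 0
  | ZAdd x y => zcoef x i + zcoef y i
  | ZOpp x => - zcoef x i
  end.

Lemma zevalE v e : zeval v e = \sum_(i < size v) v`_i *~ zcoef e i.
Proof.
elim: e => [j||x IHx y IHy|x IHx] /=.
- case: (ltnP j (size v)) => [jv|vj].
    rewrite (bigD1 (Ordinal jv)) //= eqxx mulr1z big1 ?addr0 // => i /eqP ij.
    by case: eqP => // e; case: ij; apply: val_inj.
  rewrite nth_default // big1 // => i _; case: eqP => // e.
  by move: (ltn_ord i); rewrite e ltnNge vj.
- by rewrite big1 // => i _; rewrite mulr0z.
- by rewrite IHx IHy -big_split; apply: eq_bigr => i _; rewrite mulrzDr.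
- by rewrite IHx -sumrN; apply: eq_bigr => i _; rewrite mulrNz.
Qed.

Lemma zexpr_eq v x y :
  all (fun i => zcoef x i == zcoef y i) (iota 0 (size v)) ->
  zeval v x = zeval v y.
Proof.
move=> /allP h; rewrite !zevalE; apply: eq_bigr => i _; congr (_ *~ _).
by apply/eqP/h; rewrite mem_iota /=.
Qed.
End ZExpr.

(* Atoms are compared up to unification, since rewriting may present the same
   operation through different inheritance paths. *)
Ltac zindex x l :=
  match l with
  | x :: _ => constr:(0%N)
  | ?y :: _ => let _ := lazymatch goal with _ => unify x y end in constr:(0%N)
  | _ :: ?l' => let i := zindex x l' in constr:(S i)
  end.
Ltac zinsert x l :=
  match l with
  | _ => let _ := zindex x l in l
  | _ => constr:(x :: l)
  end.
Ltac zatoms e l :=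
  lazymatch e with
  | (?x + ?y)%R => let l' := zatoms x l in zatoms y l'
  | (- ?x)%R => zatoms x l
  | 0%R => l
  | _ => zinsert e l
  end.
Ltac zreify e l :=
  lazymatch e with
  | (?x + ?y)%R => let x' := zreify x l in let y' := zreify y l in
                   constr:(ZAdd x' y')
  | (- ?x)%R => let x' := zreify x l in constr:(ZOpp x')
  | 0%R => constr:(ZZero)
  | _ => let i := zindex e l in constr:(ZVar i)
  end.
Ltac zmod :=
  lazymatch goal with
  | |- @eq ?T ?x ?y =>
    let l0 := zatoms x (@nil T) in let l := zatoms y l0 in
    let x' := zreify x l in let y' := zreify y l in
    refine (@zexpr_eq _ l x' y' _); exact isT
  end.

(** * The superalgebra of k-linear endomorphisms of a supermodule *)

Section KEnd.
Variables (k : comNzRingType) (H : superAlgType k) (V : superModType H).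

(** The representation of the algebra on n + 1 strands takes its values here. The operators are
    k-linear but in general not H-linear; H only supplies the scalars. *)
Record kend : Type := KEnd {
  kfun :> V -> V;
  kendD : {morph kfun : x y / x + y};
  kendK : forall (c : k) x, kfun (c%:K *: x) = c%:K *: kfun x
}.

HB.instance Definition _ := gen_eqMixin kend.
HB.instance Definition _ := gen_choiceMixin kend.

Lemma kend_ext (f g : kend) : f =1 g -> f = g.
Proof.
case: f g => f fD fK [g gD gK] /= /funext fg; move: gD gK; rewrite -fg => gD gK.
by congr KEnd; apply: Prop_irrelevance.
Qed.

Lemma kend0 (f : kend) : f 0 = 0.
Proof. by apply: (addIr (f 0)); rewrite -kendD !add0r. Qed.
Lemma kendN (f : kend) x : f (- x) = - f x.
Proof. by apply: (addIr (f x)); rewrite -kendD !addNr kend0. Qed.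
Lemma kendB (f : kend) x y : f (x - y) = f x - f y.
Proof. by rewrite kendD kendN. Qed.
Lemma kend_sum (f : kend) I (r : seq I) P (F : I -> V) :
  f (\sum_(i <- r | P i) F i) = \sum_(i <- r | P i) f (F i).
Proof. by apply: (big_morph f (kendD f) (kend0 f)). Qed.

Lemma part_scaleK p (c : k) (x : V) : part p (c%:K *: x) = c%:K *: part p x.
Proof.
have h0 : homog false (c%:K : H) by exact: homogK.
by rewrite part_scale h0 (homog_neq h0) // scale0r addr0.
Qed.

Definition kend_add (f g : kend) : kend.
Proof.
refine (@KEnd (fun x => f x + g x) _ _) => [x y|c x].
  by rewrite !kendD addrACA.
by rewrite !kendK scalerDr.
Defined.
Definition kend_opp (f : kend) : kend.
Proof.
refine (@KEnd (fun x => - f x) _ _) => [x y|c x].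
  by rewrite kendD opprD.
by rewrite kendK scalerN.
Defined.
Definition kend_zero : kend.
Proof.
by refine (@KEnd (fun x => 0) _ _) => [x y|c x]; rewrite ?addr0 ?scaler0.
Defined.
Definition kend_mul (f g : kend) : kend.
Proof.
by refine (@KEnd (fun x => f (g x)) _ _) => [x y|c x]; rewrite ?kendD ?kendK.
Defined.
Definition kend_one : kend.
Proof. by refine (@KEnd (fun x => x) _ _). Defined.

Let addA : associative kend_add.
Proof. by move=> f g h; apply: kend_ext => x /=; rewrite addrA. Qed.
Let addC : commutative kend_add.
Proof. by move=> f g; apply: kend_ext => x /=; rewrite addrC. Qed.
Let add0 : left_id kend_zero kend_add.
Proof. by move=> f; apply: kend_ext => x /=; rewrite add0r. Qed.
Let addN : left_inverse kend_zero kend_opp kend_add.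
Proof. by move=> f; apply: kend_ext => x /=; rewrite addNr. Qed.
Let mulA : associative kend_mul.
Proof. by move=> f g h; apply: kend_ext. Qed.
Let mul1 : left_id kend_one kend_mul.
Proof. by move=> f; apply: kend_ext. Qed.
Let mulx1 : right_id kend_one kend_mul.
Proof. by move=> f; apply: kend_ext. Qed.
Let mulDl : left_distributive kend_mul kend_add.
Proof. by move=> f g h; apply: kend_ext. Qed.
Let mulDr : right_distributive kend_mul kend_add.
Proof. by move=> f g h; apply: kend_ext => x /=; rewrite kendD. Qed.

HB.instance Definition _ := GRing.isZmodule.Build kend addA addC add0 addN.
HB.instance Definition _ :=
  GRing.Zmodule_isPzRing.Build kend mulA mul1 mulx1 mulDl mulDr.

Lemma kend_addE (f g : kend) x : (f + g) x = f x + g x. Proof. by []. Qed.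
Lemma kend_oppE (f : kend) x : (- f) x = - f x. Proof. by []. Qed.
Lemma kend_zeroE x : (0 : kend) x = 0. Proof. by []. Qed.
Lemma kend_oneE x : (1 : kend) x = x. Proof. by []. Qed.
Lemma kend_mulE (f g : kend) x : (f * g) x = f (g x). Proof. by []. Qed.
Lemma kend_sumE I (r : seq I) P (F : I -> kend) x :
  (\sum_(i <- r | P i) F i) x = \sum_(i <- r | P i) F i x.
Proof. by apply: (big_morph (fun f : kend => f x)). Qed.

Definition kend_part (p : bool) (f : kend) : kend.
Proof.
refine (@KEnd (fun x => part p (f (part false x)) + part (~~ p) (f (part true x))) _ _).
- by move=> x y; rewrite !(partD, kendD) addrACA.
- by move=> c x; rewrite !(part_scaleK, kendK) scalerDr.
Defined.

Let cpartD p : {morph kend_part p : f g / f + g}.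
Proof.
by move=> f g; apply: kend_ext => x /=; rewrite /= !partD addrACA.
Qed.
Let cpart_sum f : kend_part false f + kend_part true f = f.
Proof.
apply: kend_ext => x /=; rewrite /= addrACA part_sum.
by rewrite [part true _ + _]addrC part_sum -kendD part_sum.
Qed.
Let cpart_part p q f :
  kend_part p (kend_part q f) = if p == q then kend_part q f else 0.
Proof.
apply: kend_ext => x.
by case: p q => [] [] /=; rewrite !(partD, kendD, part_part, part0, kend0) /=
  ?(addr0, add0r).
Qed.
HB.instance Definition _ :=
  Zmodule_isSuper.Build kend cpartD cpart_sum cpart_part.

Lemma homog_kendP p (f : kend) :
  homog p f <-> forall q x, homog q x -> homog (p (+) q) (f x).
Proof.
split=> [<- q x <-|h].
  rewrite /homog /=.
  by case: p q => [] [] /=; rewrite !(partD, kendD, part_part, part0, kend0) /=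
    ?(addr0, add0r).
apply: kend_ext => x; rewrite /part /=.
have := h false _ (homog_part false x); rewrite addbF => ->.
have := h true _ (homog_part true x); rewrite addbT => ->.
by rewrite -kendD part_sum.
Qed.

Definition kend_const (c : k) : kend.
Proof.
refine (@KEnd (fun x => c%:K *: x) (scalerDr _) _).
by move=> e x; rewrite !scalerA -!inKM mulrC.
Defined.

Let const1 : kend_const 1 = 1.
Proof. by apply: kend_ext => x /=; rewrite inK1 scale1r. Qed.
Let constD : {morph kend_const : c c' / c + c'}.
Proof. by move=> c c'; apply: kend_ext => x /=; rewrite inKD scalerDl. Qed.
Let constM : {morph kend_const : c c' / c * c'}.
Proof. by move=> c c'; apply: kend_ext => x /=; rewrite inKM scalerA. Qed.
Let constC c (f : kend) : kend_const c * f = f * kend_const c.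
Proof. by apply: kend_ext => x /=; rewrite kendK. Qed.
Let homog_const c : homog false (kend_const c).
Proof.
apply/homog_kendP => q x hx /=; apply: (@homog_scale k H V false q) => //.
exact: homogK.
Qed.
Let khomogM p q (f g : kend) : homog p f -> homog q g -> homog (p (+) q) (f * g).
Proof.
move=> /homog_kendP hf /homog_kendP hg; apply/homog_kendP => s x hx.
by rewrite -addbA; apply/hf/hg.
Qed.
HB.instance Definition _ := isSuperAlgebra.Build k kend
  const1 constD constM constC homog_const khomogM.

Lemma kend_constE (c : k) x : (c%:K : kend) x = c%:K *: x.
Proof. by []. Qed.

End KEnd.

Lemma homog_mul (k : comNzRingType) (A : superAlgType k) p q (x y : A) :
  homog p x -> homog q y -> homog (p (+) q) (x * y).
Proof. exact: homogM. Qed.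

Lemma homog_sum (V : superZmodType) p I (r : seq I) (P : pred I) (F : I -> V) :
  (forall i, P i -> homog p (F i)) -> homog p (\sum_(i <- r | P i) F i).
Proof.
move=> h; apply: (big_ind (homog p)) => //; first exact: part0.
exact: homogD.
Qed.

Lemma homog_exp (k : comNzRingType) (A : superAlgType k) (x : A) r :
  homog false x -> homog false (x ^+ r).
Proof.
move=> hx; elim: r => [|r IH]; first exact: homog1.
by rewrite exprS; have := homog_mul hx IH.
Qed.

Lemma even_central (k : comNzRingType) (A : superAlgType k) (x a : A) :
  homog false x /\ supercentral x -> x * a = a * x.
Proof.
case=> h cc; rewrite -[a]part_sum mulrDl mulrDr.
have := cc false _ _ (homog_part false a); have := cc false _ _ (homog_part true a).
by rewrite !h /= !mul1r => -> ->.
Qed.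

(** * Dual bases of a symmetric superalgebra *)

Section DualBases.
Variables (k : comNzRingType) (A : superAlgType k) (tr : A -> k).
Hypothesis tr_sym : symmetrizing tr.
Variables (B : finType) (b : B -> A) (par : B -> bool).
Hypothesis b_basis : homogeneous_basis b par.
Variable bd : B -> A.
Hypothesis bd_dual : dual_basis tr b bd.

(** The coefficient of [b e] in [a], by [bcoefE]. Reading it off by the trace makes its linearity
    immediate. *)
Definition bcoef (a : A) (e : B) : k := tr (bd e * a).

Lemma homog_b e : homog (par e) (b e). Proof. by case: b_basis. Qed.

Lemma trD x y : tr (x + y) = tr x + tr y.
Proof. by case: tr_sym => -[h _] _ _ _; exact: h. Qed.
Lemma trK e x : tr (e%:K * x) = e * tr x.
Proof. by case: tr_sym => -[_ h] _ _ _; exact: h. Qed.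
Lemma tr0 : tr 0 = 0.
Proof. by apply: (addIr (tr 0)); rewrite -trD !add0r. Qed.
Lemma tr_sum I (r : seq I) P (F : I -> A) :
  tr (\sum_(i <- r | P i) F i) = \sum_(i <- r | P i) tr (F i).
Proof. by apply: (big_morph tr trD tr0). Qed.
Lemma tr_odd x : homog true x -> tr x = 0.
Proof. by case: tr_sym => _ h _ _; exact: h. Qed.
Lemma tr_comm p q x y : homog p x -> homog q y ->
  tr (x * y) = (-1) ^+ (p && q) * tr (y * x).
Proof. by case: tr_sym => _ _ h _; exact: h. Qed.
Lemma tr_inj x y : (forall a, tr (x * a) = tr (y * a)) -> x = y.
Proof.
case: tr_sym => _ _ _ h exy.
have lin : k_linear (fun a => tr (y * a)).
  split=> [a a'|e a]; first by rewrite mulrDr trD.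
  by rewrite mulrA -inKC -mulrA trK.
have [u [_ uniq]] := h _ lin.
by rewrite -(uniq x) // -(uniq y).
Qed.

Lemma bcoefE a : a = \sum_e (bcoef a e)%:K * b e.
Proof.
have [_ /(_ a)[u [ea _]]] := b_basis.
rewrite {1}ea; apply: eq_bigr => i _; congr (_%:K * _).
rewrite /bcoef ea mulr_sumr tr_sum (bigD1 i) //= big1 ?addr0.
  by rewrite mulrA -inKC -mulrA trK bd_dual eqxx mulr1.
move=> j ji; rewrite mulrA -inKC -mulrA trK bd_dual.
by rewrite eq_sym (negPf ji) mulr0.
Qed.

Lemma bcoefD x y e : bcoef (x + y) e = bcoef x e + bcoef y e.
Proof. by rewrite /bcoef mulrDr trD. Qed.
Lemma bcoefK s x e : bcoef (s%:K * x) e = s * bcoef x e.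
Proof. by rewrite /bcoef mulrA -inKC -mulrA trK. Qed.

Lemma tr_part x y p : homog p y -> tr (x * y) = tr (part p x * y).
Proof.
move=> hy; rewrite -{1}[x]part_sum mulrDl trD.
have odd q : p != q -> tr (part q x * y) = 0.
  move=> pq; apply: tr_odd; have := homog_mul (homog_part q x) hy.
  by case: p q pq {hy} => [] [].
by case: p hy odd => hy odd; [rewrite (odd false) ?add0r | rewrite (odd true) ?addr0].
Qed.

(** Paired with a basis element [b i], the trace only sees the component of [bd e] that has the
    parity of [b i]. If this parity is not that of [b e], then i and e differ and the pairing is
    zero anyway. *)
Lemma homog_bd e : homog (par e) (bd e).
Proof.
apply: tr_inj => a; rewrite (bcoefE a) !mulr_sumr !tr_sum.
apply: eq_bigr => i _; rewrite !mulrA -!inKC -!mulrA !trK; congr (_ * _).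
case: (par e =P par i) => [ei|ei].
  by rewrite [RHS](tr_part _ (homog_b i)) ei.
rewrite bd_dual (tr_part _ (homog_b i)) part_part.
case: (e =P i) => [ei'|_]; first by case: ei; rewrite ei'.
by case: eqP => [/esym //|_]; rewrite mul0r tr0.
Qed.

Lemma bcoef_part p a e : bcoef (part p a) e = if par e == p then bcoef a e else 0.
Proof.
rewrite /bcoef; have h q : par e != q -> tr (bd e * part q a) = 0.
  move=> pq; apply: tr_odd; have := homog_mul (homog_bd e) (homog_part q a).
  by case: (par e) pq; case: q.
case: eqP => [<-|/eqP /h //].
rewrite -{2}[a]part_sum mulrDr trD.
by case E: (par e) h => h; [rewrite (h false) ?add0r | rewrite (h true) ?addr0].
Qed.

Lemma bcoef_b i j : bcoef (b i) j = (j == i)%:R.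
Proof. exact: bd_dual. Qed.

Lemma bcoef_bd x : x = \sum_e (tr (x * b e))%:K * bd e.
Proof.
apply: tr_inj => a; rewrite (bcoefE a) !mulr_sumr !tr_sum.
apply: eq_bigr => i _; rewrite !mulrA -!inKC -!mulrA !trK; congr (_ * _).
rewrite mulr_suml tr_sum (bigD1 i) //= big1 => [|j ji].
  by rewrite -mulrA trK bd_dual eqxx mulr1 addr0.
by rewrite -mulrA trK bd_dual (negPf ji) mulr0.
Qed.

Section Teleport.
Variables (V : zmodType) (F : A -> A -> V).
Hypothesis FDl : forall x x' y, F (x + x') y = F x y + F x' y.
Hypothesis FDr : forall x y y', F x (y + y') = F x y + F x y'.
Hypothesis FK : forall s x y, F (s%:K * x) y = F x (s%:K * y).

Let F0l y : F 0 y = 0.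
Proof. by apply: (addIr (F 0 y)); rewrite -FDl !add0r. Qed.
Let F0r y : F y 0 = 0.
Proof. by apply: (addIr (F y 0)); rewrite -FDr !add0r. Qed.
Let Fsuml I (r : seq I) (G : I -> A) y :
  F (\sum_(i <- r) G i) y = \sum_(i <- r) F (G i) y.
Proof. by apply: (big_morph (F^~ y)). Qed.
Let Fsumr I (r : seq I) (G : I -> A) y :
  F y (\sum_(i <- r) G i) = \sum_(i <- r) F y (G i).
Proof. by apply: (big_morph (F y)). Qed.

(** The Casimir identity of A ⊗ A, with the tensor product replaced by an arbitrary k-balanced
    biadditive F. Both sides have the coefficient [tr (bd f * a * b e)] at [b f] ⊗ [bd e]. *)
Lemma teleport a : \sum_e F (a * b e) (bd e) = \sum_e F (b e) (bd e * a).
Proof.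
transitivity (\sum_f \sum_e F (b f) ((tr (bd f * a * b e))%:K * bd e)).
  rewrite exchange_big /=; apply: eq_bigr => e _.
  rewrite {1}(bcoefE (a * b e)) Fsuml; apply: eq_bigr => f _.
  by rewrite FK /bcoef mulrA.
by apply: eq_bigr => f _; rewrite -Fsumr -bcoef_bd.
Qed.

(** Since tr is supersymmetric, the basis dual to the [bd e] consists of the [b e], up to a sign for
    odd e. *)
Lemma teleport_sym :
  \sum_e F (b e) (bd e) = \sum_e (if par e then - F (bd e) (b e) else F (bd e) (b e)).
Proof.
transitivity (\sum_f \sum_e F (bd f) ((tr (b e * b f))%:K * bd e)).
  rewrite exchange_big /=; apply: eq_bigr => e _.
  by rewrite {1}(bcoef_bd (b e)) Fsuml; apply: eq_bigr => f _; rewrite FK.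
apply: eq_bigr => f _; rewrite -Fsumr.
have -> : \sum_e (tr (b e * b f))%:K * bd e
    = if par f then - b f else b f.
  rewrite {2 3}(bcoef_bd (b f)); have [pf|pf] := boolP (par f).
    rewrite -sumrN; apply: eq_bigr => e _.
    rewrite (tr_comm (homog_b e) (homog_b f)) pf andbT.
    have [pe|pe] := boolP (par e).
      by rewrite expr1 mulN1r inKN mulNr.
    rewrite expr0 mul1r tr_odd ?inK0 ?mul0r ?oppr0 //.
    by have := homog_mul (homog_b f) (homog_b e); rewrite pf (negPf pe).
  apply: eq_bigr => e _; rewrite (tr_comm (homog_b e) (homog_b f)) (negPf pf).
  by rewrite andbF expr0 mul1r.
case: ifP => // _; apply: (addIr (F (bd f) (b f))).
by rewrite -FDr !addNr F0r.
Qed.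
End Teleport.
End DualBases.

(** * Reduced generators and relations, and their first consequences *)

Definition swp (i j : nat) : nat :=
  if j == i then i.+1 else if j == i.+1 then i else j.

Section HeckeData.
Variables (k : comNzRingType) (z : k) (A : superAlgType k).
Variables (B : finType) (b bd : B -> A) (d : nat) (c : 'I_d -> A).

(* Going through an opaque proof keeps unification from unfolding [tel]. *)
Fact tel_key : {t : forall S : superAlgType k, (nat -> A -> S) -> nat -> nat -> S
  | forall S al i j, t S al i j = z%:K * \sum_e al i (b e) * al j (bd e)}.
Proof.
by exists (fun S al i j => z%:K * \sum_e al i (b e) * al j (bd e)).
Qed.
Definition tel (S : superAlgType k) (al : nat -> A -> S) : nat -> nat -> S :=
  sval tel_key S al.
Lemma telE (S : superAlgType k) (al : nat -> A -> S) i j :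
  tel al i j = z%:K * \sum_e al i (b e) * al j (bd e).
Proof. exact: svalP tel_key S al i j. Qed.

(** Positions are natural numbers and not ordinals, so that the same indices serve for different
    numbers of strands. Unitality and supercommutation are only asked in range; out of range [al i]
    may be zero. *)
Record positions (S : superAlgType k) (n : nat) (al : nat -> A -> S) : Prop :=
    Positions {
  alD : forall i x y, al i (x + y) = al i x + al i y;
  alM : forall i x y, al i (x * y) = al i x * al i y;
  al_homog : forall i p x, homog p x -> homog p (al i x);
  alK : forall i (s : k), (i < n)%N -> al i s%:K = s%:K;
  al_comm : forall i j p q x y, (i < n)%N -> (j < n)%N -> i <> j ->
    homog p x -> homog q y ->
    al i x * al j y = (-1) ^+ (p && q) * (al j y * al i x)
}.

(* A reduced presentation of the cyclotomic algebra on n strands: [al i a] is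
   a in position i, and the generators X_i with i > 0 are eliminated through
   X_{i+1} = T_i X_i T_i. *)
Record hecke (S : superAlgType k) (n : nat) (al : nat -> A -> S)
    (T : nat -> S) (X : S) : Prop := Hecke {
  hecke_al : positions n al;
  T_even : forall i, (i.+1 < n)%N -> homog false (T i);
  T_al : forall i j x, (i.+1 < n)%N -> (j < n)%N ->
    T i * al j x = al (swp i j) x * T i;
  T_quad : forall i, (i.+1 < n)%N -> T i * T i = tel al i i.+1 * T i + 1;
  T_braid : forall i, (i.+2 < n)%N ->
    T i * T i.+1 * T i = T i.+1 * T i * T i.+1;
  T_far : forall i j, (i.+1 < j)%N -> (j.+1 < n)%N -> T i * T j = T j * T i;
  X_even : homog false X;
  X_al : forall i x, (i < n)%N -> X * al i x = al i x * X;
  X_T : forall i, (0 < i)%N -> (i.+1 < n)%N -> X * T i = T i * X;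
  X_typeB : (1 < n)%N -> X * T 0 * X * T 0 = T 0 * X * T 0 * X;
  X_f : (0 < n)%N -> X ^+ d + \sum_(l < d) al 0 (c l) * X ^+ l = 0
}.

Section Consequences.
Variable tr : A -> k.
Hypothesis tr_sym : symmetrizing tr.
Variable par : B -> bool.
Hypothesis b_basis : homogeneous_basis b par.
Hypothesis bd_dual : dual_basis tr b bd.

Variables (S : superAlgType k) (n : nat) (al : nat -> A -> S).
Hypothesis HH : positions n al.

Let hb := homog_b b_basis.
Let hbd := homog_bd tr_sym b_basis bd_dual.
Notation zt := (tel al).

Lemma al0 i : al i 0 = 0.
Proof. by apply: (addIr (al i 0)); rewrite -(alD HH) !add0r. Qed.
Lemma al1 i : (i < n)%N -> al i 1 = 1.
Proof. by move=> ln; rewrite -(@inK1 k) (alK HH) // inK1. Qed.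
Lemma al_sum i I (r : seq I) P (F : I -> A) :
  al i (\sum_(j <- r | P j) F j) = \sum_(j <- r | P j) al i (F j).
Proof. by apply: (big_morph (al i) (alD HH i) (al0 i)). Qed.
Lemma al_part i p x : al i (part p x) = part p (al i x).
Proof.
rewrite -[in RHS](part_sum x) (alD HH) partD.
have h q : homog q (al i (part q x)) by apply: (al_homog HH); exact: homog_part.
by case: p; rewrite [X in _ = _ + X](h true, homog_neq (h true)) //
  [X in _ = X + _](h false, homog_neq (h false)) // ?add0r ?addr0.
Qed.

Lemma al_far i j x y : (i < n)%N -> (j < n)%N -> i <> j -> homog false x ->
  al i x * al j y = al j y * al i x.
Proof.
move=> ln jn ij hx; rewrite -[y]part_sum (alD HH) mulrDr mulrDl.
congr (_ + _); rewrite (al_comm HH ln jn ij hx (homog_part _ _)) //;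
  by rewrite andFb expr0 mul1r.
Qed.

Let FK i j (s : k) x y : (i < n)%N -> (j < n)%N ->
  al i (s%:K * x) * al j y = al i x * al j (s%:K * y).
Proof.
by move=> ln jn; rewrite !(alM HH) !(alK HH) // inKC -!mulrA.
Qed.

(** The sign in [teleport_sym] cancels the one from exchanging the two positions. *)
Lemma tel_sym i j : (i < n)%N -> (j < n)%N -> i <> j -> zt i j = zt j i.
Proof.
move=> ln jn ij; rewrite !telE; congr (_ * _).
rewrite (teleport_sym tr_sym b_basis bd_dual
  (F := fun x y => al i x * al j y)) /=.
- apply: eq_bigr => e _; rewrite (al_comm HH ln jn ij (hbd e) (hb e)) andbb.
  by case: (par e); rewrite ?mulN1r ?opprK ?mul1r.
- by move=> x x' y; rewrite (alD HH) mulrDl.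
- by move=> x x' y; rewrite (alD HH) mulrDr.
- by move=> s x y; exact: FK.
Qed.

Lemma al_tel_l i j x : (i < n)%N -> (j < n)%N -> al i x * zt i j = zt i j * al j x.
Proof.
move=> ln jn; rewrite !telE mulrA -inKC -!mulrA mulr_sumr mulr_suml; congr (_ * _).
have := teleport tr_sym b_basis bd_dual (F := fun x y => al i x * al j y) _ _ _ x.
move=> h; rewrite (eq_bigr (fun e => al i (x * b e) * al j (bd e))) ?h.
- by apply: eq_bigr => e _; rewrite (alM HH) mulrA.
- by move=> u u' y; rewrite (alD HH) mulrDl.
- by move=> u y y'; rewrite (alD HH) mulrDr.
- by move=> s u y; exact: FK.
- by move=> e _; rewrite (alM HH) mulrA.
Qed.

Lemma al_tel_r i j x : (i < n)%N -> (j < n)%N -> i <> j ->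
  al j x * zt i j = zt i j * al i x.
Proof. by move=> ln jn ij; rewrite tel_sym // al_tel_l. Qed.

(** An odd x may meet a sign at [b e] and then meets the same sign at [bd e], as the two have equal
    parity. *)
Lemma al_tel_far l i j x : (i < n)%N -> (j < n)%N -> (l < n)%N ->
  l <> i -> l <> j -> al l x * zt i j = zt i j * al l x.
Proof.
move=> ln jn hl li lj; rewrite !telE mulrA -inKC -!mulrA mulr_sumr mulr_suml.
congr (_ * _); apply: eq_bigr => e _.
rewrite -[x]part_sum (alD HH) mulrDl !mulrDr; congr (_ + _).
  have hx := homog_part false x.
  by rewrite mulrA (al_far _ hl ln li hx) -!mulrA (al_far _ hl jn lj hx).
rewrite mulrA (al_comm HH hl ln li (homog_part _ _) (hb e)).
rewrite -!mulrA (al_comm HH hl jn lj (homog_part _ _) (hbd e)) /=.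
by case: (par e); rewrite ?mulN1r ?mulrN ?opprK ?mul1r.
Qed.

(** Serves for every u that permutes positions: for the T_i, and for the X_i, which fix them. *)
Lemma conj_tel (u : S) i j i' j' :
  (forall x, u * al i x = al i' x * u) -> (forall x, u * al j x = al j' x * u) ->
  u * zt i j = zt i' j' * u.
Proof.
move=> ui uj; rewrite !telE mulrA -inKC -!mulrA mulr_sumr mulr_suml.
by congr (_ * _); apply: eq_bigr => e _; rewrite mulrA ui -mulrA uj mulrA.
Qed.

Lemma tel_even i j : homog false (zt i j).
Proof.
have -> : false = false (+) false by []; rewrite telE.
apply: homog_mul; first exact: homogK.
apply: homog_sum => e _; rewrite -(addbb (par e)).
by apply: homog_mul; apply: (al_homog HH).
Qed.

(** The other teleporter is carried through [zt i j], which exchanges the positions i and j and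
    fixes l. *)
Lemma tel_tel i j l : (i < n)%N -> (j < n)%N -> (l < n)%N ->
  i <> j -> i <> l -> j <> l -> zt i j * zt i l = zt j l * zt i j.
Proof.
move=> ln jn hl ij il jl.
have tl x : al j x * zt i j = zt i j * al i x by rewrite al_tel_r.
have tf x : al l x * zt i j = zt i j * al l x by rewrite al_tel_far // => /esym.
move: (zt i j) tl tf => t tl tf.
rewrite !telE mulrA -inKC -!mulrA mulr_sumr mulr_suml; congr (_ * _).
by apply: eq_bigr => e _; rewrite mulrA -tl -!mulrA tf.
Qed.

End Consequences.

Section Elements.
Variable tr : A -> k.
Hypothesis tr_sym : symmetrizing tr.
Variable par : B -> bool.
Hypothesis b_basis : homogeneous_basis b par.
Hypothesis bd_dual : dual_basis tr b bd.

Variables (S : superAlgType k) (n : nat) (al : nat -> A -> S) (T : nat -> S).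
Variable X : S.
Hypothesis HH : hecke n al T X.
Notation zt := (tel al).
Let HA := hecke_al HH.

Lemma T_tel l i j : (i < n)%N -> (j < n)%N -> (l.+1 < n)%N ->
  T l * zt i j = zt (swp l i) (swp l j) * T l.
Proof. by move=> ln jn hl; apply: conj_tel => x; rewrite (T_al HH). Qed.

Lemma X_tel i j : (i < n)%N -> (j < n)%N -> X * zt i j = zt i j * X.
Proof. by move=> ln jn; apply: conj_tel => x; rewrite (X_al HH). Qed.

Lemma T_tel_same i : (i.+1 < n)%N -> T i * zt i i.+1 = zt i i.+1 * T i.
Proof.
move=> ln; rewrite T_tel //; last lia.
rewrite /swp !eqxx; case: eqP => [|_]; first lia.
by rewrite (tel_sym tr_sym b_basis bd_dual HA) //; lia.
Qed.

Definition Tinv i := T i - zt i i.+1.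

Lemma T_Tinv i : (i.+1 < n)%N -> T i * Tinv i = 1.
Proof.
by move=> ln; rewrite /Tinv mulrBr (T_quad HH) // T_tel_same // addrC addKr.
Qed.
Lemma Tinv_T i : (i.+1 < n)%N -> Tinv i * T i = 1.
Proof. by move=> ln; rewrite /Tinv mulrBl (T_quad HH) // addrC addKr. Qed.

Lemma swpK i : involutive (swp i).
Proof. by move=> j; rewrite /swp; do !case: eqP => //; lia. Qed.
Lemma swp_lt i j : (i.+1 < n)%N -> (j < n)%N -> (swp i j < n)%N.
Proof. by move=> ln jn; rewrite /swp; do !case: eqP => //; lia. Qed.

Lemma al_T i j x : (i.+1 < n)%N -> (j < n)%N ->
  al j x * T i = T i * al (swp i j) x.
Proof. by move=> ln jn; rewrite (T_al HH) ?swp_lt // swpK. Qed.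

(* [Td j] is T_{j-1} ... T_0 and [Tu j m] is T_j ... T_{j+m-1}. *)
Fixpoint Td (j : nat) : S := if j is j'.+1 then T j' * Td j' else 1.
Fixpoint Tu (j m : nat) : S := if m is m'.+1 then T j * Tu j.+1 m' else 1.

Lemma T_Td_far i j : (j < i)%N -> (i.+1 < n)%N -> T i * Td j = Td j * T i.
Proof.
move=> ji ln; elim: j ji => [|j IH] ji /=; first by rewrite mulr1 mul1r.
by rewrite mulrA -(T_far HH) // -mulrA IH ?mulrA //; lia.
Qed.

Lemma T_Td_near i j : (i.+1 < j)%N -> (j < n)%N -> T i * Td j = Td j * T i.+1.
Proof.
elim: j => [//|j IH] ij jn /=; case: (eqVneq i.+1 j) => [<-|ne] /=.
  by rewrite !mulrA (T_braid HH) -?mulrA ?T_Td_far //; lia.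
rewrite mulrA (T_far HH) //; last lia.
by rewrite -mulrA IH ?mulrA //; lia.
Qed.

Lemma al_Td i j x : (i < n)%N -> (j < n)%N ->
  al i x * Td j = Td j * al (if i == j then 0 else if (i < j)%N then i.+1 else i) x.
Proof.
elim: j i => [|j IH] i ln jn /=.
  by rewrite mulr1 mul1r; case: eqP => [->|].
rewrite mulrA al_T // -mulrA IH ?swp_lt //; last lia.
by rewrite mulrA /swp; congr (_ * al _ _); do !case: ifP; lia.
Qed.

Lemma Td_even j : (j < n)%N -> homog false (Td j).
Proof.
elim: j => [|j IH] jn /=; first exact: homog1.
by have := homog_mul (T_even HH jn) (IH (ltnW jn)).
Qed.

(** For P = X^r this measures how far X is from commuting with T_0 X^r T_0; the correction term in
    the operator [XW] originates here. With Y = T_0 X T_0 one has X T_0 = T_0^{-1} Y, and P moves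
    past Y. The terms in t = [zt 0 1] come from Y T_0 = t Y + T_0 X and from T_0^{-1} = T_0 - t. *)
Lemma typeB_comm (P : S) : (1 < n)%N ->
  P * (T 0 * X * T 0) = T 0 * X * T 0 * P -> P * zt 0 1 = zt 0 1 * P ->
  X * T 0 * P * T 0 = T 0 * P * T 0 * X + zt 0 1 * (X * T 0 * P - P * T 0 * X).
Proof.
set Y := T 0 * X * T 0; set t := zt 0 1 => n1 PY Pt.
have XT : X * T 0 = Tinv 0 * Y by rewrite /Y !mulrA Tinv_T // mul1r.
have tc : T 0 * X * t = t * (T 0 * X).
  have Xt : X * t = t * X by apply: X_tel; lia.
  have Tt : T 0 * t = t * T 0 by apply: T_tel_same; lia.
  by rewrite -mulrA Xt mulrA Tt mulrA.
have YT : Y * T 0 = t * Y + T 0 * X.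
  by rewrite /Y -[LHS]mulrA (T_quad HH) // mulrDr mulr1 mulrA tc !mulrA.
have Tit : Tinv 0 * t = t * Tinv 0.
  by rewrite /Tinv mulrBl mulrBr T_tel_same.
have e1 : X * T 0 * P = Tinv 0 * P * Y by rewrite XT -[LHS]mulrA -PY mulrA.
have e2 : t * (X * T 0 * P) = Tinv 0 * P * (t * Y).
  by rewrite e1 [in RHS]mulrA -[_ * P * t]mulrA Pt [in RHS]mulrA Tit !mulrA.
rewrite mulrBr e2 e1 -[_ * Y * T 0]mulrA YT mulrDr addrCA; congr (_ + _).
by rewrite /Tinv !mulrBl !mulrA.
Qed.
End Elements.
End HeckeData.

(** * The induced module in coordinates *)

(* The coordinate of [w] at [(j, r, i)] is the coefficient of [b i] in position j
   times the coset representative (j, r), tensored with an element of [M]; the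
   parity of [b i] therefore shifts that of the coordinate. *)
Definition wmod (B : finType) (par : B -> bool) (n d : nat) (M : Type) : Type :=
  {ffun 'I_n.+1 * 'I_d * B -> M}.

Lemma homog_scaleM (k : comNzRingType) (H : superAlgType k) (M : superModType H)
  p q (h : H) (m : M) : homog p h -> homog q m -> homog (p (+) q) (h *: m).
Proof. exact: homog_scale. Qed.

Section WSuper.
Variables (k : comNzRingType) (H : superAlgType k) (B : finType) (par : B -> bool).
Variables (n d : nat) (M : superModType H).
Notation W := (wmod par n d M).
HB.instance Definition _ := GRing.Lmodule.on W.
Let wpart p (w : W) : W := [ffun y => part (p (+) par y.2) (w y)].
Let wpartD p : {morph wpart p : x y / x + y}.
Proof. by move=> x y; apply/ffunP => i; rewrite !ffunE partD. Qed.
Let wpart_sum x : wpart false x + wpart true x = x.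
Proof.
apply/ffunP => i; rewrite !ffunE; case: (par i.2); last exact: part_sum.
by rewrite addrC; exact: part_sum.
Qed.
Let wpart_part p q x : wpart p (wpart q x) = if p == q then wpart q x else 0.
Proof.
apply/ffunP => i; rewrite !ffunE part_part.
by case: p q => [] []; case E: (par i.2) => /=; rewrite ?ffunE ?E.
Qed.
HB.instance Definition _ := Zmodule_isSuper.Build W wpartD wpart_sum wpart_part.

Lemma wpartE p (w : W) y : part p w y = part (p (+) par y.2) (w y).
Proof. by rewrite [LHS]ffunE. Qed.

Let whomog_scale p q (h : H) (m : W) :
  homog p h -> homog q m -> homog (p (+) q) (h *: m : W).
Proof.
move=> hh hm; apply/ffunP => i; rewrite wpartE -addbA.
rewrite [(h *: m) i]ffunE; apply: homog_scaleM => //.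
by rewrite /homog -{2}hm wpartE.
Qed.
HB.instance Definition _ := isSuperModule.Build k H W whomog_scale.
End WSuper.

Section WOps.
Variables (k : comNzRingType) (z : k) (A : superAlgType k).
Variables (B : finType) (b bd : B -> A) (d : nat) (c : 'I_d -> A).
Variable tr : A -> k.
Hypothesis tr_sym : symmetrizing tr.
Variable par : B -> bool.
Hypothesis b_basis : homogeneous_basis b par.
Hypothesis bd_dual : dual_basis tr b bd.
Variables (H : superAlgType k) (n : nat) (M : superModType H).
Notation W := (wmod par n d M).

(** The coset representative (j, r), with an arbitrary a in position j, tensored with m. These
    elements are k-balanced in a and m ([eK]), which frees the formulas below from the basis [b].
    The value is zero if j or r is out of range. *)
Definition wpure (j r : nat) (a : A) (m : M) : W :=
  [ffun y : 'I_n.+1 * 'I_d * B => if (y.1.1 == j :> nat) && (y.1.2 == r :> nat)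
             then (bcoef tr bd a y.2)%:K *: m else 0].
Notation e := wpure.

Lemma eDl j r a a' m : e j r (a + a') m = e j r a m + e j r a' m.
Proof.
apply/ffunP => y; rewrite !ffunE; case: ifP => _; last by rewrite addr0.
by rewrite (bcoefD tr_sym) inKD scalerDl.
Qed.
Lemma eDr j r a m m' : e j r a (m + m') = e j r a m + e j r a m'.
Proof.
by apply/ffunP => y; rewrite !ffunE; case: ifP => _; rewrite ?addr0 ?scalerDr.
Qed.
Lemma eK j r s a m : e j r (s%:K * a) m = e j r a (s%:K *: m).
Proof.
apply/ffunP => y; rewrite !ffunE; case: ifP => _ //.
by rewrite (bcoefK tr_sym) inKM scalerA inKC.
Qed.
Lemma eZ j r s a m : e j r a (s%:K *: m) = s%:K *: e j r a m.
Proof.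
apply/ffunP => y; rewrite !ffunE; case: ifP => _; last by rewrite scaler0.
by rewrite !scalerA inKC.
Qed.
Lemma e0l j r m : e j r 0 m = 0.
Proof. by apply: (addIr (e j r 0 m)); rewrite -eDl !add0r. Qed.
Lemma e0r j r a : e j r a 0 = 0.
Proof. by apply: (addIr (e j r a 0)); rewrite -eDr !add0r. Qed.
Lemma eNl j r a m : e j r (- a) m = - e j r a m.
Proof. by apply: (addIr (e j r a m)); rewrite -eDl !addNr e0l. Qed.
Lemma eNr j r a m : e j r a (- m) = - e j r a m.
Proof. by apply: (addIr (e j r a m)); rewrite -eDr !addNr e0r. Qed.
Lemma e_sumr j r a I (s : seq I) P (F : I -> M) :
  e j r a (\sum_(i <- s | P i) F i) = \sum_(i <- s | P i) e j r a (F i).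
Proof.
by apply: (big_morph (fun m => e j r a m)) => [x y|]; rewrite ?eDr ?e0r.
Qed.

Lemma e_homog p q j r a m :
  homog p a -> homog q m -> homog (p (+) q) (e j r a m).
Proof.
move=> ha hm; apply/ffunP => y; rewrite wpartE !ffunE.
case: ifP => _; last exact: part0.
rewrite part_scaleK -ha (bcoef_part tr_sym b_basis bd_dual).
case: eqP => [->|_]; last by rewrite inK0 !scale0r.
by rewrite addbAC addbb addFb hm.
Qed.

Lemma w_dec (w : W) : w = \sum_(y : 'I_n.+1 * 'I_d * B) e y.1.1 y.1.2 (b y.2) (w y).
Proof.
apply/ffunP => x; rewrite sum_ffunE (bigD1 x) //= big1 ?addr0 => [|y yx].
  by rewrite ffunE !eqxx bcoef_b // eqxx inK1 scale1r.
rewrite ffunE; case: ifP => // /andP[/eqP/val_inj e1 /eqP/val_inj e2].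
rewrite bcoef_b //; case: eqP => [e3|]; last by rewrite inK0 scale0r.
case/eqP: yx; case: x y e1 e2 e3 => [[x1 x2] x3] [[y1 y2] y3] /=.
by move=> -> -> ->.
Qed.

(** The map G factors through a k-linear map on A ⊗ M; an operator on W may be prescribed by such a
    map on each coset. *)
Definition good (G : A -> M -> W) : Prop :=
  [/\ forall a a' m, G (a + a') m = G a m + G a' m,
      forall a m m', G a (m + m') = G a m + G a m',
      forall s a m, G (s%:K * a) m = G a (s%:K *: m)
    & forall s a m, G a (s%:K *: m) = s%:K *: G a m].

Lemma good_e j r (f : A -> A) (h : H) :
  {morph f : x y / x + y} -> (forall s x, f (s%:K * x) = s%:K * f x) ->
  good (fun a m => e j r (f a) (h *: m)).
Proof.
move=> fD fK; split=> *.
- by rewrite fD eDl.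
- by rewrite scalerDr eDr.
- by rewrite fK eK !scalerA inKC.
- by rewrite -eZ !scalerA inKC.
Qed.
Lemma goodD G G' : good G -> good G' -> good (fun a m => G a m + G' a m).
Proof.
case=> g1 g2 g3 g4 [h1 h2 h3 h4]; split=> *.
- by rewrite g1 h1 addrACA.
- by rewrite g2 h2 addrACA.
- by rewrite g3 h3.
- by rewrite g4 h4 scalerDr.
Qed.
Lemma good_kend G (f : kend W) : good G -> good (fun a m => f (G a m)).
Proof.
case=> g1 g2 g3 g4; split=> *.
- by rewrite g1 kendD.
- by rewrite g2 kendD.
- by rewrite g3.
- by rewrite g4 kendK.
Qed.
Lemma good_ext G G' : (forall a m, G a m = G' a m) -> good G -> good G'.
Proof.
move=> h [g1 g2 g3 g4]; split=> *; rewrite -!h.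
- exact: g1.
- exact: g2.
- exact: g3.
- exact: g4.
Qed.
Lemma goodN G : good G -> good (fun a m => - G a m).
Proof. by move/(@good_kend _ (- 1)). Qed.
Lemma good0 : good (fun a m => 0).
Proof. by split=> *; rewrite ?addr0 ?scaler0. Qed.
Lemma good_sum I (r : seq I) (G : I -> A -> M -> W) :
  (forall i, good (G i)) -> good (fun a m => \sum_(i <- r) G i a m).
Proof.
move=> h; elim: r => [|i r IH].
  by apply: (@good_ext _ _ _ good0) => a m; rewrite big_nil.
by apply: (@good_ext _ _ _ (goodD (h i) IH)) => a m; rewrite big_cons.
Qed.
Lemma good_em j r h : good (fun a m => e j r a (h *: m)).
Proof. exact: (@good_e j r id). Qed.
Lemma good_e1 j r : good (e j r).
Proof.
by apply: (@good_ext _ _ _ (good_em j r 1)) => a m; rewrite scale1r.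
Qed.
Lemma good_ex j r x : good (fun a m => e j r (x * a) m).
Proof.
apply: (@good_ext (fun a m => e j r (x * a) (1 *: m))).
  by move=> a m; rewrite scale1r.
apply: (@good_e j r (fun a => x * a)) => [u v|s u]; first by rewrite mulrDr.
by rewrite !mulrA inKC.
Qed.

Definition op (F : nat -> nat -> A -> M -> W) (gF : forall j r, good (F j r)) :
  kend W.
Proof.
refine (@KEnd k H W (fun w => \sum_(y : 'I_n.+1 * 'I_d * B) F y.1.1 y.1.2 (b y.2) (w y)) _ _).
- move=> v w; rewrite -big_split; apply: eq_bigr => y _ /=; rewrite ffunE.
  by have [_ ->] := gF y.1.1 y.1.2.
- move=> s w; rewrite scaler_sumr; apply: eq_bigr => y _ /=; rewrite ffunE.
  by have [_ _ _ ->] := gF y.1.1 y.1.2.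
Defined.
Arguments op : simpl never.

(** The operator is defined through the [b i]; balancedness extends the prescribed formula from them
    to every a. *)
Lemma opE F gF j r a m : (j <= n)%N -> (r < d)%N ->
  @op F gF (e j r a m) = F j r a m.
Proof.
rewrite -ltnS => jn rd; rewrite /op /=; set j' := Ordinal jn; set r' := Ordinal rd.
have [gl gr gb _] := gF j r.
have F0l m' : F j r 0 m' = 0.
  by apply: (addIr (F j r 0 m')); rewrite -gl !add0r.
have F0r j0 r0 a' : F j0 r0 a' 0 = 0.
  have [_ g _ _] := gF j0 r0.
  by apply: (addIr (F j0 r0 a' 0)); rewrite -g !add0r.
rewrite {2}(bcoefE tr_sym b_basis bd_dual a).
rewrite (big_morph (fun a => F j r a m) (fun x y => gl x y m) (F0l m)).
transitivity (\sum_(x : 'I_n.+1 * 'I_d) \sum_(i : B)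
    F x.1 x.2 (b i) (e j r a m (x, i))).
  by rewrite pair_bigA; apply: eq_bigr => -[].
rewrite (bigD1 (j', r')) //= [X in _ + X]big1 ?addr0.
  by apply: eq_bigr => i _; rewrite ffunE /= !eqxx gb.
move=> [y1 y2] y12; apply: big1 => i _; rewrite ffunE /=.
case: ifP => [/andP[/eqP e1 /eqP e2]|_]; last by rewrite F0r.
case/eqP: y12; congr (_, _); exact: val_inj.
Qed.

Lemma w_ext (f g : kend W) :
  (forall j r p q a m, (j <= n)%N -> (r < d)%N -> homog p a -> homog q m ->
     f (e j r a m) = g (e j r a m)) -> f = g.
Proof.
move=> fg; apply: kend_ext => w; rewrite (w_dec w) !kend_sum.
apply: eq_bigr => -[[j r] i] _ /=; rewrite -[w _]part_sum eDr !kendD.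
by congr (_ + _); apply: fg (ltn_ord j) (ltn_ord r) (homog_b b_basis i)
  (homog_part _ _).
Qed.

Lemma homog_wP p (f : kend W) :
  (forall j r q s a m, (j <= n)%N -> (r < d)%N -> homog q a -> homog s m ->
     homog (p (+) (q (+) s)) (f (e j r a m))) -> homog p f.
Proof.
move=> h; apply/homog_kendP => s w hw; rewrite (w_dec w) kend_sum.
apply: homog_sum => -[[j r] i] _ /=.
have hm : homog (s (+) par i) (w (j, r, i)).
  by rewrite /homog -{2}hw wpartE.
have := h j r _ _ _ _ (ltn_ord j) (ltn_ord r) (homog_b b_basis i) hm.
by rewrite [par i (+) _]addbC -addbA addbb addbF.
Qed.

End WOps.

(** The increasing relabelling of the positions other than j. On a coset (j, r), position j belongs
    to the free factor in A, and position i acts on M as position [unb j i]. *)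
Definition unb (j i : nat) : nat := if (j < i)%N then i.-1 else i.
Definition sgn (k : comNzRingType) (A : superAlgType k) (a : A) : A :=
  part false a - part true a.

Section Sgn.
Variables (k : comNzRingType) (A : superAlgType k).
Implicit Types a : A.
Lemma sgnD : {morph @sgn k A : a a' / a + a'}.
Proof. by move=> a a'; rewrite /sgn !partD opprD addrACA. Qed.
Lemma part_constM p (s : k) a : part p (s%:K * a) = s%:K * part p a.
Proof.
have h0 : homog false (s%:K : A) by exact: homogK.
by rewrite partM h0 (homog_neq h0) // mul0r addr0.
Qed.
Lemma sgnK (s : k) a : sgn (s%:K * a) = s%:K * sgn a.
Proof. by rewrite /sgn !part_constM mulrBr. Qed.
Lemma sgn_homog p a : homog p a -> sgn a = if p then - a else a.
Proof.
move=> ha; rewrite /sgn; case: p ha => ha; rewrite ha (homog_neq ha) ?sub0r //.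
by rewrite subr0.
Qed.
Lemma sgn_sgn a : sgn (sgn a) = a.
Proof.
rewrite /sgn !partD !partN !part_part /= subr0 sub0r opprK.
by rewrite part_sum.
Qed.
End Sgn.

(** * The generators as operators on coordinates, and their relations *)

Section WAction.
Variables (k : comNzRingType) (z : k) (A : superAlgType k).
Variables (B : finType) (b bd : B -> A) (d : nat) (c : 'I_d -> A).
Variable tr : A -> k.
Hypothesis tr_sym : symmetrizing tr.
Variable par : B -> bool.
Hypothesis b_basis : homogeneous_basis b par.
Hypothesis bd_dual : dual_basis tr b bd.
Hypothesis c_central : forall l, homog false (c l) /\ supercentral (c l).
Hypothesis d_gt0 : (0 < d)%N.
Variables (H : superAlgType k) (n : nat).
Variables (al : nat -> A -> H) (T : nat -> H) (X : H).
Hypothesis HH : hecke z b bd c n al T X.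
Variable (M : superModType H).
Notation W := (wmod par n d M).
Notation e := (@wpure k A B bd d tr par H n M).
Notation good := (@good k A B d par H n M).
Notation op := (@op k A B b d par H n M).
Let HA := hecke_al HH.
Let hb := homog_b b_basis.
Let hbd := homog_bd tr_sym b_basis bd_dual.
Let eDl := @eDl k A B bd d tr tr_sym par H n M.
Let eDr := @eDr k A B bd d tr par H n M.
Let good_ex := @good_ex k A B bd d tr tr_sym par H n M.
Let good_em := @good_em k A B bd d tr tr_sym par H n M.
Let good_e := @good_e k A B bd d tr tr_sym par H n M.
Let good_e1 := @good_e1 k A B bd d tr tr_sym par H n M.
Let opE := @opE k A B b bd d tr tr_sym par b_basis bd_dual H n M.
Let eNl := @eNl k A B bd d tr tr_sym par H n M.
Let eK := @eK k A B bd d tr tr_sym par H n M.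
Let e_homog := @e_homog k A B b bd d tr tr_sym par b_basis bd_dual H n M.
Let ext := w_ext (d := d) b_basis bd_dual (n := n) (M := M).

Lemma c_comm l a : c l * a = a * c l.
Proof. exact: even_central. Qed.

(** For i different from j, the element x first passes a in position j, whence [sgn a] for its odd
    part, and then the coset representative, which moves it to position [unb j i]. *)
Lemma aF_good i x j r : good (fun a m =>
  if i == j then e j r (x * a) m
  else e j r a (al (unb j i) (part false x) *: m)
       + e j r (sgn a) (al (unb j i) (part true x) *: m)).
Proof.
case: (i == j); first exact: good_ex.
apply: goodD; first exact: good_em.
by apply: good_e => //; [exact: sgnD | exact: sgnK].
Qed.
(* Going through an opaque proof keeps unification from unfolding the operator;
   the same device is used for [TW] and [XW] below. *)
Fact aW_key : {f : nat -> A -> kend W | forall i x, f i x = op (aF_good i x)}.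
Proof. by exists (fun i x => op (aF_good i x)). Qed.
Definition aW : nat -> A -> kend W := sval aW_key.
Lemma aWE i x : aW i x = op (aF_good i x). Proof. exact: svalP aW_key i x. Qed.

Lemma aW_same i x r a m : (i <= n)%N -> (r < d)%N ->
  aW i x (e i r a m) = e i r (x * a) m.
Proof. by move=> ? ?; rewrite aWE opE // eqxx. Qed.
Lemma aW_diff i x j r a m : (j <= n)%N -> (r < d)%N -> i <> j ->
  aW i x (e j r a m) = e j r a (al (unb j i) (part false x) *: m)
       + e j r (sgn a) (al (unb j i) (part true x) *: m).
Proof. by move=> ? ? /eqP/negPf ij; rewrite aWE opE // ij. Qed.
Lemma aW_homog i x p j r q a m : (j <= n)%N -> (r < d)%N -> i <> j ->
  homog p x -> homog q a ->
  aW i x (e j r a m) = (-1) ^+ (p && q) *: e j r a (al (unb j i) x *: m).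
Proof.
move=> jn rd ij hp hq; rewrite aW_diff // (sgn_homog hq) scaler_sign.
case: p hp => hp; rewrite hp (homog_neq hp) // (al0 HA) scale0r e0r.
  by rewrite add0r; case: q {hq}; rewrite ?eNl.
by rewrite addr0.
Qed.

Lemma kend_sign (f : kend W) (p : bool) w : f ((-1) ^+ p *: w) = (-1) ^+ p *: f w.
Proof. by rewrite !scaler_sign; case: p; rewrite ?kendN. Qed.
Lemma sign_kend (f : kend W) (p : bool) w :
  ((-1) ^+ p * f) w = (-1) ^+ p *: f w.
Proof. by rewrite scaler_sign; case: p; rewrite ?expr1 ?mulN1r ?mul1r. Qed.
Lemma e_sign j r a (p : bool) m : e j r a ((-1) ^+ p *: m) = (-1) ^+ p *: e j r a m.
Proof. by rewrite !scaler_sign; case: p; rewrite ?eNr. Qed.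

Lemma unb_lt i j : (i <= n)%N -> (j <= n)%N -> i <> j -> (unb j i < n)%N.
Proof. by rewrite /unb; case: ifP; lia. Qed.

Lemma aW_positions : positions n.+1 aW.
Proof.
split.
- move=> i x y; apply: ext => j r p q a m jn rd ha hm.
  rewrite kend_addE; case: (eqVneq i j) => [->|/eqP ij].
    by rewrite !aW_same // mulrDl eDl.
  by rewrite !aW_diff // !partD !(alD HA) !scalerDl !eDr addrACA.
- move=> i x y; apply: ext => j r p q a m jn rd ha hm.
  rewrite kend_mulE; case: (eqVneq i j) => [->|/eqP ij].
    by rewrite !aW_same // mulrA.
  rewrite !aW_diff // kendD !aW_diff // !scalerA -!(alM HA) sgn_sgn.
  rewrite !partM /= !(alD HA) !scalerDl !eDr.
  by rewrite -!addrA; congr (_ + _); rewrite addrC -!addrA addrCA.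
- move=> i p x hx; apply: (homog_wP b_basis bd_dual) => j r q s a m jn rd ha hm.
  case: (eqVneq i j) => [->|/eqP ij].
    rewrite aW_same // addbA; apply: e_homog => //.
    exact: homog_mul.
  rewrite (aW_homog _ jn rd ij hx ha).
  have h : homog (p (+) (q (+) s)) (e j r a (al (unb j i) x *: m)).
    rewrite addbCA; apply: e_homog => //; apply: homog_scaleM => //.
    exact: (al_homog HA).
  by rewrite scaler_sign; case: (p && q); rewrite // /homog partN h.
- move=> i s ln; apply: ext => j r p q a m jn rd ha hm.
  rewrite kend_constE; case: (eqVneq i j) => [->|/eqP ij].
    by rewrite aW_same // eK eZ.
  rewrite aW_diff // (homogK s) (homog_neq (homogK s)) //.
  by rewrite (al0 HA) scale0r e0r addr0 (alK HA) ?unb_lt // eZ.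
- move=> i i' p q x y ln ln' ii' hx hy; apply: ext => j r s u a m jn rd ha hm.
  rewrite sign_kend !kend_mulE.
  case: (eqVneq i j) ii' ln => [->|/eqP ij] ii' ln.
    have /nesym ji := ii'.
    rewrite (aW_homog _ jn rd ji hy ha) kend_sign !aW_same //.
    rewrite (aW_homog _ jn rd ji hy (homog_mul hx ha)).
    rewrite !scalerA -!signr_addb; congr ((-1) ^+ nat_of_bool _ *: _).
    by case: p q s {hx hy ha} => [] [] [].
  case: (eqVneq i' j) ii' ln' => [->|/eqP ij'] ii' ln'.
    rewrite (aW_homog _ jn rd ij hx ha) kend_sign !aW_same //.
    rewrite (aW_homog _ jn rd ij hx (homog_mul hy ha)).
    rewrite !scalerA -!signr_addb; congr ((-1) ^+ nat_of_bool _ *: _).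
    by case: p q s {hx hy ha} => [] [] [].
  rewrite (aW_homog _ jn rd ij hx ha) (aW_homog _ jn rd ij' hy ha) !kend_sign.
  rewrite (aW_homog _ jn rd ij hx ha) (aW_homog _ jn rd ij' hy ha) !scalerA.
  rewrite (al_comm HA (unb_lt ln jn ij) (unb_lt ln' jn ij') _ hx hy).
    rewrite -[(_ * (al _ _ * al _ _)) *: m]scalerA e_sign !scalerA -!signr_addb.
    congr ((-1) ^+ nat_of_bool _ *: _).
    by case: p q s {hx hy ha} => [] [] [].
  by rewrite /unb; do !case: ifP; lia.
Qed.
Notation zt := (tel z b bd aW).
Notation zh := (tel z b bd al).
Let WA := aW_positions.

Lemma aW_homogl i x p j r a m : (j <= n)%N -> (r < d)%N -> i <> j ->
  homog p x ->
  aW i x (e j r a m) = e j r (if p then sgn a else a) (al (unb j i) x *: m).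
Proof.
move=> jn rd ij hp; rewrite aW_diff //.
case: p hp => hp; rewrite hp (homog_neq hp) // (al0 HA) scale0r e0r.
  by rewrite add0r.
by rewrite addr0.
Qed.

(** Both factors of each summand of the teleporter pass a, and their signs cancel because [b f] and
    [bd f] have the same parity. *)
Lemma zt_e i j l r a m : (l <= n)%N -> (r < d)%N -> i <> l -> j <> l ->
  zt i j (e l r a m) = e l r a (zh (unb l i) (unb l j) *: m).
Proof.
move=> ln rd il jl; rewrite !telE kend_mulE kend_constE kend_sumE.
rewrite -scalerA eZ scaler_suml e_sumr; congr (_ *: _); apply: eq_bigr => f _.
rewrite kend_mulE (aW_homogl _ _ ln rd jl (hbd f)).
rewrite (aW_homogl _ _ ln rd il (hb f)) scalerA.
by case: (par f); rewrite ?sgn_sgn.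
Qed.

(** Left multiplication by T_i on T_j ... T_{n-1} for r = 0 and on T_{j-1} ... T_0 X^r T_0 ...
    T_{n-1} for r > 0. It lengthens the product when it leads from i + 1 to i for r = 0, or from i
    to i + 1 for r > 0. In the opposite direction the quadratic relation adds a teleporter term,
    whence the test [(j == i) == (r == 0%N)]. *)
Lemma TF_good i j r : good (fun a m =>
  if (j < i)%N then e j r a (T i.-1 *: m)
  else if (i.+1 < j)%N then e j r a (T i *: m)
  else e (swp i j) r a m
       + (if (j == i) == (r == 0%N) then zt i i.+1 (e j r a m) else 0)).
Proof.
case: (j < i)%N; first exact: good_em.
case: (i.+1 < j)%N; first exact: good_em.
apply: goodD; first exact: good_e1.
case: (_ == _); last exact: good0.
by apply: good_kend; exact: good_e1.
Qed.
Fact TW_key : {f : nat -> kend W | forall i, f i = op (TF_good i)}.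
Proof. by exists (fun i => op (TF_good i)). Qed.
Definition TW : nat -> kend W := sval TW_key.
Lemma TWE i : TW i = op (TF_good i). Proof. exact: svalP TW_key i. Qed.

Lemma TW_lt i j r a m : (j <= n)%N -> (r < d)%N -> (j < i)%N ->
  TW i (e j r a m) = e j r a (T i.-1 *: m).
Proof. by move=> jn rd ji; rewrite TWE opE // ji. Qed.
Lemma TW_gt i j r a m : (j <= n)%N -> (r < d)%N -> (i.+1 < j)%N ->
  TW i (e j r a m) = e j r a (T i *: m).
Proof.
move=> jn rd ij; rewrite TWE opE // ij ifF //; apply/negbTE; lia.
Qed.
Lemma TW_in i j r a m : (i < n)%N -> (r < d)%N -> (j == i) || (j == i.+1) ->
  TW i (e j r a m) = e (swp i j) r a m
       + (if (j == i) == (r == 0%N) then zt i i.+1 (e j r a m) else 0).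
Proof.
by move=> ln rd ij; rewrite TWE opE //; first (do 2?[rewrite ifF //; last lia]); lia.
Qed.
Lemma TW_up i r a m : (i < n)%N -> (r < d)%N -> (0 < r)%N ->
  TW i (e i r a m) = e i.+1 r a m.
Proof.
move=> ln rd r0; rewrite TW_in ?eqxx // /swp eqxx ifF ?addr0 //.
by case: r r0 {rd}.
Qed.
Lemma TW_up0 i a m : (i < n)%N -> TW i (e i.+1 0 a m) = e i 0 a m.
Proof.
have ni : (i.+1 == i) = false by lia.
by move=> ln; rewrite TW_in ?eqxx ?orbT // /swp !eqxx ni addr0.
Qed.

Lemma TW_dn i r a m : (i < n)%N -> (r < d)%N -> (0 < r)%N ->
  TW i (e i.+1 r a m) = e i r a m + zt i i.+1 (e i.+1 r a m).
Proof.
have ni : (i.+1 == i) = false by lia.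
by move=> ln rd; rewrite lt0n => /negbTE r0; rewrite TW_in ?eqxx ?orbT // /swp ni r0 !eqxx.
Qed.
Lemma TW_dn0 i a m : (i < n)%N ->
  TW i (e i 0 a m) = e i.+1 0 a m + zt i i.+1 (e i 0 a m).
Proof. by move=> ln; rewrite TW_in ?eqxx // /swp eqxx. Qed.

Lemma TW_even i : (i < n)%N -> homog false (TW i).
Proof.
move=> ln; apply: (homog_wP b_basis bd_dual) => j r q s a m jn rd ha hm.
rewrite addFb; case: (ltnP j i) => ji.
  rewrite TW_lt //; apply: e_homog => //; rewrite -[s]addFb.
  by apply: homog_scaleM => //; apply: (T_even HH); lia.
case: (ltnP i.+1 j) => ij.
  rewrite TW_gt //; apply: e_homog => //; rewrite -[s]addFb.
  by apply: homog_scaleM => //; apply: (T_even HH); lia.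
rewrite TW_in //; last lia.
apply: homogD; first exact: e_homog.
case: ifP => _; last exact: part0.
have /homog_kendP h := tel_even z tr_sym b_basis bd_dual WA i i.+1.
by have := h _ _ (e_homog j r ha hm); rewrite addFb.
Qed.

Lemma TW_aW i l x : (i < n)%N -> (l <= n)%N ->
  TW i * aW l x = aW (swp i l) x * TW i.
Proof.
move=> ln hl; apply: ext => j r q s a m jn rd ha hm.
rewrite !kend_mulE; case: (ltnP j i) => ji.
  have Tl y : l <> j ->
      T i.-1 * al (unb j l) y = al (unb j (swp i l)) y * T i.-1.
    move=> lj; rewrite (T_al HH); [|lia|by apply: unb_lt].
    by congr (al _ _ * _); rewrite /unb /swp; do !case: ifP; lia.
  rewrite (TW_lt _ _ jn rd ji); case: (eqVneq l j) => [->|/eqP lj].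
    have -> : swp i j = j by rewrite /swp; do !case: ifP; lia.
    by rewrite !aW_same // TW_lt.
  have lj' : swp i l <> j by rewrite /swp; do !case: ifP; lia.
  rewrite !aW_diff // kendD !(TW_lt _ _ jn rd ji) !scalerA.
  by rewrite !Tl.
case: (ltnP i.+1 j) => ij.
  have Tl y : l <> j ->
      T i * al (unb j l) y = al (unb j (swp i l)) y * T i.
    move=> lj; rewrite (T_al HH); [|lia|by apply: unb_lt].
    by congr (al _ _ * _); rewrite /unb /swp; do !case: ifP; lia.
  rewrite (TW_gt _ _ jn rd ij); case: (eqVneq l j) => [->|/eqP lj].
    have -> : swp i j = j by rewrite /swp; do !case: ifP; lia.
    by rewrite !aW_same // TW_gt.
  have lj' : swp i l <> j by rewrite /swp; do !case: ifP; lia.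
  rewrite !aW_diff // kendD !(TW_gt _ _ jn rd ij) !scalerA.
  by rewrite !Tl.
have hj : (j == i) || (j == i.+1) by lia.
have sn : (swp i j <= n)%N by rewrite /swp; do !case: ifP; lia.
(* The correction term intertwines positions just as T_i does, because the teleporter also exchanges
   i and i + 1. *)
have za : zt i i.+1 * aW l x = aW (swp i l) x * zt i i.+1.
  rewrite /swp; case: eqP => [->|li].
    by rewrite (al_tel_r z tr_sym b_basis bd_dual WA) //; lia.
  case: eqP => [->|li1]; first by rewrite (al_tel_l z tr_sym b_basis bd_dual WA) //; lia.
  by rewrite (al_tel_far z tr_sym b_basis bd_dual WA) //; lia.
set D := fun w : W => if (j == i) == (r == 0%N) then zt i i.+1 w else 0.
have DD u v : D (u + v) = D u + D v.
  by rewrite /D; case: ifP; rewrite ?kendD ?addr0.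
have Da w : D (aW l x w) = aW (swp i l) x (D w).
  by rewrite /D; case: ifP => _; rewrite ?kend0 // -!kend_mulE za.
have TD a' m' : TW i (e j r a' m') = e (swp i j) r a' m' + D (e j r a' m').
  by rewrite TW_in.
rewrite (TD a m) kendD -Da; case: (eqVneq l j) => [->|/eqP lj].
  by rewrite !aW_same // TD.
have lj' : swp i l <> swp i j by move/(congr1 (swp i)); rewrite !swpK.
rewrite !aW_diff // kendD !TD DD.
have -> : unb (swp i j) (swp i l) = unb j l.
  by move: lj hj; rewrite /unb /swp; do !case: ifP; lia.
by rewrite addrACA.
Qed.

Lemma TW_zt l i j : (l < n)%N -> (i <= n)%N -> (j <= n)%N ->
  TW l * zt i j = zt (swp l i) (swp l j) * TW l.
Proof. by move=> ln hi hj; apply: conj_tel => x; rewrite TW_aW. Qed.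

Lemma TW_zt_same i : (i < n)%N -> TW i * zt i i.+1 = zt i i.+1 * TW i.
Proof.
have ni : (i.+1 == i) = false by lia.
move=> ln; rewrite (TW_zt ln (ltnW ln) ln).
by rewrite /swp !eqxx ni (tel_sym z tr_sym b_basis bd_dual WA) //; lia.
Qed.

Lemma TW_quad i : (i < n)%N -> TW i * TW i = zt i i.+1 * TW i + 1.
Proof.
move=> ln; apply: ext => j r q s a m jn rd ha hm.
rewrite kend_addE kend_oneE !kend_mulE; case: (ltnP j i) => ji.
  rewrite !TW_lt // zt_e //; try lia.
  rewrite !scalerA (T_quad HH); last lia.
  rewrite scalerDl scale1r eDr; congr (e j r a (_ *: m) + _).
  by rewrite /unb !ifT; try lia; rewrite prednK //; lia.
case: (ltnP i.+1 j) => ij.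
  rewrite !TW_gt // zt_e //; try lia.
  rewrite !scalerA (T_quad HH); last lia.
  rewrite scalerDl scale1r eDr; congr (e j r a (_ *: m) + _).
  by rewrite /unb !ifF //; lia.
have hj : (j == i) || (j == i.+1) by lia.
have hs : (swp i j == i) || (swp i j == i.+1).
  by rewrite /swp; do !case: ifP; lia.
have sw : (swp i j == i) = (j != i) by rewrite /swp; do !case: ifP; lia.
have TD w : TW i (zt i i.+1 w) = zt i i.+1 (TW i w).
  by rewrite -!kend_mulE TW_zt_same.
(* Of the two cosets exchanged by T_i, exactly one carries the correction term. *)
have sw' : ((swp i j == i) == (r == 0%N)) = ~~ ((j == i) == (r == 0%N)).
  by rewrite sw; case: (j == i); case: (r == 0%N).
rewrite (TW_in _ _ ln rd hj) kendD (TW_in _ _ ln rd hs) swpK sw' if_neg.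
case E: (_ == _); rewrite ?kend0 ?TD ?(TW_in _ _ ln rd hj) ?E ?addr0.
  zmod.
zmod.
Qed.

Lemma kend_comm (f g : kend W) w : f * g = g * f -> f (g w) = g (f w).
Proof. by move=> fg; rewrite -!kend_mulE fg. Qed.

Lemma TW_far i l : (i.+1 < l)%N -> (l < n)%N -> TW i * TW l = TW l * TW i.
Proof.
move=> il ln; apply: ext => j r q s a m jn rd ha hm; rewrite !kend_mulE.
have Tz w : TW l (zt i i.+1 w) = zt i i.+1 (TW l w).
  apply: kend_comm; rewrite TW_zt //; try lia.
  by rewrite /swp !ifF //; lia.
have Tz' w : TW i (zt l l.+1 w) = zt l l.+1 (TW i w).
  apply: kend_comm; rewrite TW_zt //; try lia.
  by rewrite /swp !ifF //; lia.
case: (ltnP j i) => ji.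
  rewrite !TW_lt //; try lia.
  by rewrite !scalerA (T_far HH) //; lia.
case: (ltnP i.+1 j) => ij; last first.
  have hj : (j == i) || (j == i.+1) by lia.
  have hs : (swp i j <= n)%N && (swp i j < l)%N.
    by rewrite /swp; do !case: ifP; lia.
  have {hs} [hs1 hs2] := andP hs; have i_n : (i < n)%N by lia.
  have jl : (j < l)%N by lia.
  rewrite (TW_lt _ _ jn rd jl) !(TW_in _ _ i_n rd hj) kendD TW_lt //.
  by case: ifP; rewrite ?kend0 // Tz TW_lt.
case: (ltnP j l) => jl.
  rewrite (TW_gt _ _ jn rd ij) !(TW_lt _ _ jn rd jl) (TW_gt _ _ jn rd ij).
  by rewrite !scalerA (T_far HH) //; lia.
case: (ltnP l.+1 j) => lj.
  rewrite !(TW_gt _ _ jn rd ij) !(TW_gt _ _ jn rd lj) (TW_gt _ _ jn rd ij).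
  by rewrite !scalerA (T_far HH) //; lia.
have hj : (j == l) || (j == l.+1) by lia.
have hs : (swp l j <= n)%N && (i.+1 < swp l j)%N.
  by rewrite /swp; do !case: ifP; lia.
have {hs} [hs1 hs2] := andP hs.
rewrite (TW_gt _ _ jn rd ij) !(TW_in _ _ ln rd hj) kendD (TW_gt _ _ hs1 rd hs2).
by case: ifP; rewrite ?kend0 // Tz' TW_gt.
Qed.

(* The braid defect of u, v skew-commutes with them, so its kernel is stable
   under both; this leaves few cosets on which it has to be computed. *)
Lemma braid_defect (R : pzRingType) (u v s t : R) :
  u * u = s * u + 1 -> v * v = t * v + 1 -> u * v * s = t * (u * v) ->
  (u * v * u - v * u * v) * u = (t - v) * (u * v * u - v * u * v).
Proof.
move=> uu vv uvs; rewrite !mulrBl !mulrBr.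
have -> : u * v * u * u = t * (u * v * u) + u * v.
  by rewrite -[LHS]mulrA uu mulrDr mulr1 mulrA uvs !mulrA.
have -> : v * (v * u * v) = t * (v * u * v) + u * v.
  by rewrite !mulrA vv !mulrDl mul1r.
rewrite !mulrA; zmod.
Qed.

Lemma TW_braid i : (i.+1 < n)%N ->
  TW i * TW i.+1 * TW i = TW i.+1 * TW i * TW i.+1.
Proof.
move=> ln; have ln' := ltnW ln.
have q1 := TW_quad ln'; have q2 := TW_quad ln.
have z1 : TW i * TW i.+1 * zt i i.+1 = zt i.+1 i.+2 * (TW i * TW i.+1).
  have e1 : TW i.+1 * zt i i.+1 = zt i i.+2 * TW i.+1.
    rewrite TW_zt; try lia; congr (zt _ _ * _); rewrite /swp; do !case: ifP; lia.
  have e2 : TW i * zt i i.+2 = zt i.+1 i.+2 * TW i.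
    rewrite TW_zt; try lia; congr (zt _ _ * _); rewrite /swp; do !case: ifP; lia.
  by rewrite -mulrA e1 mulrA e2 !mulrA.
have z2 : TW i.+1 * TW i * zt i.+1 i.+2 = zt i i.+1 * (TW i.+1 * TW i).
  have e1 : TW i * zt i.+1 i.+2 = zt i i.+2 * TW i.
    rewrite TW_zt; try lia; congr (zt _ _ * _); rewrite /swp; do !case: ifP; lia.
  have e2 : TW i.+1 * zt i i.+2 = zt i i.+1 * TW i.+1.
    rewrite TW_zt; try lia; congr (zt _ _ * _); rewrite /swp; do !case: ifP; lia.
  by rewrite -mulrA e1 mulrA e2 !mulrA.
have d1 := braid_defect q1 q2 z1; have d2 := braid_defect q2 q1 z2.
set D := _ - _ in d1; have D' : TW i.+1 * TW i * TW i.+1 - TW i * TW i.+1 * TW i = - D.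
  by rewrite /D opprB.
rewrite D' in d2.
have kT w : D w = 0 -> D (TW i w) = 0.
  by move=> Dw; rewrite -kend_mulE d1 kend_mulE Dw kend0.
have kT1 w : D w = 0 -> D (TW i.+1 w) = 0.
  move=> Dw; apply: oppr_inj; rewrite -kend_oppE -(kend_mulE (- D)) d2.
  by rewrite kend_mulE kend_oppE Dw oppr0 kend0.
apply/eqP; rewrite -subr_eq0 -/D; apply/eqP.
apply: ext => j r q s a m jn rd ha hm; rewrite kend_zeroE.
have DE w : D w = TW i (TW i.+1 (TW i w)) - TW i.+1 (TW i (TW i.+1 w)).
  by [].
case: (ltnP j i) => ji.
  apply/eqP; rewrite DE subr_eq0 !TW_lt // ?(ltn_trans ji) // !scalerA.
  by case: i ji ln {ln' q1 q2 z1 z2 d1 D D' d2 kT kT1 DE} => // i ji ln /=;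
    rewrite (T_braid HH).
case: (ltnP i.+2 j) => ij.
  have ij' := ltnW ij; apply/eqP; rewrite DE subr_eq0 !TW_gt // !scalerA.
  by rewrite (T_braid HH) //; lia.
(* The cosets i, i + 1, i + 2 are linked by T_i and T_{i+1} without correction, downwards for r = 0
   and upwards for r > 0. Hence the defect is computed only on coset i + 2, respectively i. *)
case: (posnP r) rd => [->|r0] rd.
  have k2 a' m' : D (e i.+2 0 a' m') = 0.
    rewrite DE TW_up0 // (TW_gt _ _ ln rd (ltnSn _)) TW_up0 // TW_up0 //.
    by rewrite TW_up0 // TW_lt // ?subrr // ltnW.
  case: (eqVneq j i.+2) => [->//|j2].
  case: (eqVneq j i.+1) => [->|j1]; first by rewrite -TW_up0 // kT1.
  have -> : j = i by lia.
  by rewrite -TW_up0 // kT // -TW_up0 // kT1.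
have k0 a' m' : D (e i r a' m') = 0.
  rewrite DE TW_up // TW_up // (TW_gt _ _ ln rd) //.
  by rewrite (TW_lt _ _ (ltnW ln') rd (ltnSn i)) TW_up // TW_up // subrr.
case: (eqVneq j i) => [->//|j0].
case: (eqVneq j i.+1) => [->|j1]; first by rewrite -TW_up // kT.
have -> : j = i.+2 by lia.
by rewrite -TW_up // kT1 // -TW_up // kT.
Qed.

Notation Td := (Td T).

(** On the cosets (0, r), X raises r and wraps around by f = 0. For j > 0 it commutes with T_j ...
    T_{n-1}, which settles r = 0. For j, r > 0 the correction of [typeB_comm] appears, expressed
    through the cosets (0, 1) and (0, r); [X_Ejr] is the corresponding identity in the algebra. *)
Lemma XF_good j r : good (fun a m =>
  if j == 0%N then
    (if (r.+1 < d)%N then e 0 r.+1 a m else - \sum_(l < d) e 0 l (c l * a) m)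
  else if r == 0%N then e j 0 a (X *: m)
  else e j r a (X *: m) + zt 0 j (e 0 1 a ((Td j.-1 * X ^+ r) *: m)
                                  - e 0 r a ((Td j.-1 * X) *: m))).
Proof.
case: (j == 0%N).
  case: (r.+1 < d)%N; first exact: good_e1.
  by apply: goodN; apply: good_sum => l; exact: good_ex.
case: (r == 0%N); first exact: good_em.
apply: goodD; first exact: good_em.
apply: good_kend; apply: goodD; first exact: good_em.
by apply: goodN; exact: good_em.
Qed.
Fact XW_key : {f : kend W | f = op XF_good}.
Proof. by exists (op XF_good). Qed.
Definition XW : kend W := sval XW_key.
Lemma XWE : XW = op XF_good. Proof. exact: svalP XW_key. Qed.

Lemma XW_0 r a m : (r.+1 < d)%N -> XW (e 0 r a m) = e 0 r.+1 a m.
Proof. by move=> rd; rewrite XWE opE ?rd // ltnW. Qed.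
Lemma XW_top r a m : r.+1 = d ->
  XW (e 0 r a m) = - \sum_(l < d) e 0 l (c l * a) m.
Proof. by move=> rd; rewrite XWE opE ?rd ?ltnn // -rd. Qed.
Lemma XW_j0 j a m : (j <= n)%N -> (0 < j)%N -> XW (e j 0 a m) = e j 0 a (X *: m).
Proof. by case: j => // j jn _; rewrite XWE opE. Qed.
Lemma XW_jr j r a m : (j < n)%N -> (r < d)%N -> (0 < r)%N ->
  XW (e j.+1 r a m) = e j.+1 r a (X *: m)
    + zt 0 j.+1 (e 0 1 a ((Td j * X ^+ r) *: m) - e 0 r a ((Td j * X) *: m)).
Proof. by case: r => // r jn rd _; rewrite XWE opE. Qed.

Lemma XW_even : homog false XW.
Proof.
apply: (homog_wP b_basis bd_dual) => j r q s a m jn rd ha hm; rewrite addFb.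
have hX : homog s (X *: m).
  by have := homog_scaleM (X_even HH) hm; rewrite addFb.
case: j jn => [|j] jn.
  case: (ltnP r.+1 d) => rd'; first by rewrite XW_0 //; exact: e_homog.
  have -> : XW (e 0 r a m) = - \sum_(l < d) e 0 l (c l * a) m.
    by apply: XW_top; lia.
  rewrite /homog partN; congr (- _); apply: homog_sum => l _.
  apply: e_homog => //; have [hc _] := c_central l.
  by have := homog_mul hc ha.
case: (posnP r) rd => [->|r0] rd; first by rewrite XW_j0 //; exact: e_homog.
rewrite XW_jr //; apply: homogD; first exact: e_homog.
have /homog_kendP h := tel_even z tr_sym b_basis bd_dual WA 0 j.+1.
rewrite -[_ (+) _]addFb; apply: h.
have hT := Td_even HH jn.
have h1 : homog s ((Td j * X ^+ r) *: m).
  have := homog_scaleM (homog_mul hT (homog_exp r (X_even HH))) hm.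
  by rewrite !addFb.
have h2 : homog s ((Td j * X) *: m).
  by have := homog_scaleM (homog_mul hT (X_even HH)) hm; rewrite !addFb.
apply: homogD; first exact: e_homog.
by rewrite /homog partN; congr (- _); exact: e_homog.
Qed.

Lemma part_cM q l a : part q (c l * a) = c l * part q a.
Proof.
have [hc _] := c_central l.
by rewrite partM hc (homog_neq hc) // mul0r addr0.
Qed.

Lemma X_exp_al r i x : (i < n)%N -> X ^+ r * al i x = al i x * X ^+ r.
Proof.
by move=> ln; apply: commr_sym; apply: commrX; apply: commr_sym;
   exact: (X_al HH).
Qed.

Lemma XW_aW l x : (l <= n)%N -> XW * aW l x = aW l x * XW.
Proof.
move=> hl; suff h p y : homog p y -> XW * aW l y = aW l y * XW.
  rewrite -[x]part_sum (alD WA) mulrDr mulrDl.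
  by congr (_ + _); apply: h; exact: homog_part.
move=> {x} hy; set g : A -> A := fun a => if p then sgn a else a.
have gc l' a : g (c l' * a) = c l' * g a.
  by rewrite /g; case: (p); rewrite // /sgn !part_cM mulrBr.
have ae j r a m : (j <= n)%N -> (r < d)%N -> l <> j ->
    aW l y (e j r a m) = e j r (g a) (al (unb j l) y *: m).
  by move=> jn rd lj; rewrite (aW_homogl _ _ jn rd lj hy).
apply: ext => j r q s a m jn rd ha hm; rewrite !kend_mulE.
case: j jn => [|j] jn.
  case: (ltnP r.+1 d) => rd'.
    rewrite (XW_0 _ _ rd'); case: (eqVneq l 0%N) => [->|/eqP l0].
      by rewrite !aW_same // XW_0.
    by rewrite !ae // XW_0.
  have hr : r.+1 = d by lia.
  rewrite (XW_top _ _ hr) kendN kend_sum; case: (eqVneq l 0%N) => [->|/eqP l0].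
    rewrite !aW_same // XW_top //; congr (- _); apply: eq_bigr => i _.
    by rewrite aW_same // !mulrA c_comm.
  rewrite !ae // XW_top //; congr (- _); apply: eq_bigr => i _.
  by rewrite ae // gc.
case: (posnP r) rd => [->|r0] rd.
  rewrite (XW_j0 _ _ jn) //; case: (eqVneq l j.+1) => [->|/eqP lj].
    by rewrite !aW_same // XW_j0.
  by rewrite !ae // XW_j0 // !scalerA (X_al HH) // unb_lt.
have rd1 : (1 < d)%N := leq_ltn_trans r0 rd.
rewrite (XW_jr _ _ jn rd r0) kendD; case: (eqVneq l j.+1) => [->|/eqP lj].
  rewrite !aW_same // XW_jr //; congr (_ + _).
  have h w : aW j.+1 y (zt 0 j.+1 w) = zt 0 j.+1 (aW 0 y w).
    by rewrite -!kend_mulE (al_tel_r z tr_sym b_basis bd_dual WA).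
  by rewrite h; congr (zt _ _ _); rewrite kendD kendN !aW_same.
(* The position that l becomes to the right of [zt 0 j.+1]. Here l is not j + 1, which would become
   0. *)
pose l' := if l == 0%N then j.+1 else l.
have h w : aW l y (zt 0 j.+1 w) = zt 0 j.+1 (aW l' y w).
  rewrite -!kend_mulE /l'; case: eqP => [->|l0].
    by rewrite (al_tel_l z tr_sym b_basis bd_dual WA).
  by rewrite (al_tel_far z tr_sym b_basis bd_dual WA).
have l'0 : l' <> 0%N by rewrite /l'; case: eqP.
have l'n : (l' <= n)%N by rewrite /l'; case: eqP.
have ae' s' a' m' : (s' < d)%N ->
    aW l' y (e 0 s' a' m') = e 0 s' (g a') (al l'.-1 y *: m').
  move=> sd; rewrite (aW_homogl _ _ (leq0n n) sd l'0 hy); congr (e 0 s' _ (al _ _ *: _)).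
  by rewrite /unb; case: ltnP; lia.
rewrite h !ae // [aW l' y _]kendD kendN !ae' // XW_jr // !scalerA.
have un := unb_lt hl jn lj.
have hT : al l'.-1 y * Td j = Td j * al (unb j.+1 l) y.
  rewrite (al_Td HH); try lia; congr (_ * al _ _).
  by rewrite /l' /unb; case: (eqVneq l 0%N); do !case: ifP; lia.
congr (_ + zt _ _ (_ - _)).
- by rewrite (X_al HH).
- by rewrite mulrA hT -!mulrA (X_exp_al _ _ un).
- by rewrite mulrA hT -!mulrA (X_al HH).
Qed.

Lemma XW_zt i j : (i <= n)%N -> (j <= n)%N -> XW * zt i j = zt i j * XW.
Proof. by move=> hi hj; apply: conj_tel => x; rewrite XW_aW. Qed.

(** Makes the kernel of the commutator of x and u stable under u, so that of two cosets exchanged by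
    u only one has to be checked. *)
Lemma quad_skew (R : pzRingType) (x u s : R) :
  u * u = s * u + 1 -> x * s = s * x ->
  (x * u - u * x) * u = (s - u) * (x * u - u * x).
Proof.
move=> uu xs; rewrite !mulrBl !mulrBr.
have -> : x * u * u = s * (x * u) + x.
  by rewrite -mulrA uu mulrDr mulr1 mulrA xs mulrA.
have -> : u * (u * x) = s * (u * x) + x by rewrite mulrA uu mulrDl mul1r mulrA.
rewrite !mulrA; zmod.
Qed.

Lemma XW_TW i : (0 < i)%N -> (i < n)%N -> XW * TW i = TW i * XW.
Proof.
move=> i0 ln; have e1 : XW * zt i i.+1 = zt i i.+1 * XW by rewrite XW_zt // ltnW.
have d1 := quad_skew (TW_quad ln) e1.
set D := _ - _ in d1; have DE w : D w = XW (TW i w) - TW i (XW w) by [].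
have kT w : D w = 0 -> D (TW i w) = 0.
  by move=> Dw; rewrite -kend_mulE d1 kend_mulE Dw kend0.
apply/eqP; rewrite -subr_eq0 -/D; apply/eqP.
apply: ext => j r q s a m jn rd ha hm; rewrite kend_zeroE.
case: j jn => [|j] jn.
  apply/eqP; rewrite DE subr_eq0; apply/eqP; rewrite TW_lt //.
  case: (ltnP r.+1 d) => rd'; first by rewrite !XW_0 // TW_lt.
  have hr : r.+1 = d by lia.
  rewrite !XW_top // kendN kend_sum; congr (- _); apply: eq_bigr => l _.
  by rewrite TW_lt.
case: (posnP r) rd => [->|r0] rd.
  apply/eqP; rewrite DE subr_eq0; apply/eqP; rewrite (XW_j0 _ _ jn) //.
  case: (ltnP j.+1 i) => ji.
    by rewrite !TW_lt // XW_j0 // !scalerA (X_T HH) //; lia.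
  case: (ltnP i.+1 j.+1) => ij.
    by rewrite !TW_gt // XW_j0 // !scalerA (X_T HH) //; lia.
  have hj : (j.+1 == i) || (j.+1 == i.+1) by lia.
  rewrite !(TW_in _ _ ln rd hj) kendD XW_j0.
  - by case: ifP; rewrite ?kend0 // -(kend_mulE XW) XW_zt ?kend_mulE ?XW_j0 // ltnW.
  - by rewrite /swp; do !case: ifP; lia.
  - by rewrite /swp; do !case: ifP; lia.
have rd1 : (1 < d)%N := leq_ltn_trans r0 rd.
have z0 l w : (l <= n)%N -> l <> 0%N ->
    TW i (zt 0 l w) = zt 0 (swp i l) (TW i w).
  move=> hl l0; rewrite -!kend_mulE TW_zt //; congr ((zt _ _ * _) w).
  by rewrite /swp; do !case: ifP; lia.
have Tl s' a' m' : (s' < d)%N -> TW i (e 0 s' a' m') = e 0 s' a' (T i.-1 *: m').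
  by move=> sd; rewrite TW_lt.
case: (ltnP j.+1 i) => ji.
  apply/eqP; rewrite DE subr_eq0; apply/eqP.
  rewrite TW_lt // !XW_jr // [TW i _]kendD TW_lt // z0 // [TW i _]kendD kendN !Tl // !scalerA.
  have -> : swp i j.+1 = j.+1 by rewrite /swp; do !case: ifP; lia.
  have hT : T i.-1 * Td j = Td j * T i.-1 by rewrite (T_Td_far HH) //; lia.
  have hX : X * T i.-1 = T i.-1 * X by rewrite (X_T HH) //; lia.
  have hXr : X ^+ r * T i.-1 = T i.-1 * X ^+ r.
    by apply: commr_sym; apply: commrX; exact: commr_sym.
  by rewrite !mulrA hT -!mulrA hX hXr.
case: (ltnP i.+1 j.+1) => ij.
  apply/eqP; rewrite DE subr_eq0; apply/eqP.
  rewrite TW_gt // !XW_jr // [TW i _]kendD TW_gt // z0 // [TW i _]kendD kendN !Tl // !scalerA.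
  have -> : swp i j.+1 = j.+1 by rewrite /swp; do !case: ifP; lia.
  have hT : T i.-1 * Td j = Td j * T i.
    by rewrite (T_Td_near HH) ?prednK //; lia.
  have hX : X * T i = T i * X by rewrite (X_T HH) //; lia.
  have hXr : X ^+ r * T i = T i * X ^+ r.
    by apply: commr_sym; apply: commrX; exact: commr_sym.
  by rewrite !mulrA hT -!mulrA hX hXr.
(* Only coset i is computed; T_i leads from it to coset i + 1. *)
have k0 a' m' : D (e i r a' m') = 0.
  case: i i0 ln {e1 d1 kT ji ij} D DE z0 Tl => // i _ ln D DE z0 Tl.
  rewrite DE TW_up // !XW_jr //; last exact: ltnW.
  rewrite [TW i.+1 _]kendD TW_up // z0 //; last exact: ltnW.
  have -> : swp i.+1 i.+1 = i.+2 by rewrite /swp eqxx.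
  by rewrite [TW i.+1 _]kendD kendN !Tl // !scalerA !mulrA subrr.
case: (eqVneq j.+1 i) => [->//|j0].
have -> : j.+1 = i.+1 by lia.
by rewrite -TW_up // kT.
Qed.

Lemma kend_comm0 (f g f' g' : kend W) w : f * g = g' * f' -> f (g w) = g' (f' w).
Proof. by move=> fg; rewrite -!kend_mulE fg. Qed.

(** The value of f at the operator X, to be shown zero. It vanishes on the coset (0, 0) because X
    was defined to wrap around by f, and it commutes with X, with T_0 X T_0 and with the T_i for i >
    0. *)
Let Z := XW ^+ d + \sum_(l < d) aW 0 (c l) * XW ^+ l.
Let Xr_e r a m : (r < d)%N -> (XW ^+ r) (e 0 0 a m) = e 0 r a m.
Proof.
elim: r => [|r IH] rd; first by rewrite expr0.
by rewrite exprS kend_mulE IH ?XW_0 // ltnW.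
Qed.
Let Z_comm (f : kend W) : f * XW = XW * f ->
  (forall l, f * aW 0 (c l) = aW 0 (c l) * f) -> f * Z = Z * f.
Proof.
move=> fX fc; have fXr r : f * XW ^+ r = XW ^+ r * f.
  by apply: commrX; exact: fX.
rewrite /Z mulrDr mulrDl fXr mulr_sumr mulr_suml; congr (_ + _).
by apply: eq_bigr => l _; rewrite mulrA fc -!mulrA fXr.
Qed.
Let Z_e00 a m : Z (e 0 0 a m) = 0.
Proof.
have [r hr] : exists r, r.+1 = d by exists d.-1; exact: prednK.
have Xd : XW ^+ d = XW * XW ^+ r by rewrite -exprS hr.
rewrite /Z kend_addE kend_sumE Xd kend_mulE Xr_e ?XW_top -?hr //.
rewrite addrC; apply/eqP; rewrite subr_eq0; apply/eqP.
by apply: eq_bigr => l _; rewrite kend_mulE Xr_e // aW_same.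
Qed.
Let ZX w : Z (XW w) = XW (Z w).
Proof. by apply/kend_comm/esym/Z_comm => // l; rewrite XW_aW. Qed.
Let Z_e0 r a m : (r < d)%N -> Z (e 0 r a m) = 0.
Proof.
elim: r => [|r IH] rd; first exact: Z_e00.
by rewrite -XW_0 // ZX IH ?kend0 // ltnW.
Qed.

(** * The relation between X and T_0, and the cyclotomic relation *)

Section TypeB.
Hypothesis n0 : (0 < n)%N.
Let rd0 r : (r.+1 < d)%N -> (r < d)%N := @ltnW _ _.
(** For d > 1 this is [e 1 1 a m]. The present form also makes sense for d = 1, where there is no
    coset (1, 1). *)
Let e11 a m := TW 0 (XW (e 0 0 a m)).

Let T0z w : TW 0 (zt 0 1 w) = zt 0 1 (TW 0 w).
Proof. by apply: kend_comm; rewrite TW_zt_same. Qed.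
Let Xz w : XW (zt 0 1 w) = zt 0 1 (XW w).
Proof. by apply: kend_comm; rewrite XW_zt. Qed.
Let T0T0 w : TW 0 (TW 0 w) = zt 0 1 (TW 0 w) + w.
Proof. by rewrite -kend_mulE TW_quad // kend_addE kend_mulE kend_oneE. Qed.
(** As [c l] is even and central, in position 1 it commutes with the teleporter; carried through it
    as any element of A, it comes out in position 0. *)
Let zc l w : zt 0 1 (aW 0 (c l) w) = zt 0 1 (aW 1 (c l) w).
Proof.
have [hc _] := c_central l.
have c1 x : aW 1 (c l) * aW 1 x = aW 1 x * aW 1 (c l).
  by rewrite -!(alM WA) c_comm.
have c0 x : aW 1 (c l) * aW 0 x = aW 0 x * aW 1 (c l).
  by rewrite (al_far WA).
rewrite -!kend_mulE -(conj_tel _ _ _ c0 c1).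
by rewrite (al_tel_r z tr_sym b_basis bd_dual WA).
Qed.

Let e11r a m m' : e11 a (m + m') = e11 a m + e11 a m'.
Proof. by rewrite /e11 eDr !kendD. Qed.
Let e110 a : e11 a 0 = 0.
Proof. by rewrite /e11 e0r !kend0. Qed.
Let e11_sumr a I (s : seq I) P (F : I -> M) :
  e11 a (\sum_(i <- s | P i) F i) = \sum_(i <- s | P i) e11 a (F i).
Proof. by apply: (big_morph (e11 a) (e11r a) (e110 a)). Qed.
Let e11N a m : e11 a (- m) = - e11 a m.
Proof. by apply: (addIr (e11 a m)); rewrite -e11r !addNr e110. Qed.

Let aW1c l r a m : (r < d)%N -> aW 1 (c l) (e 0 r a m) = e 0 r a (al 0 (c l) *: m).
Proof.
by move=> rd; have [hc _] := c_central l; rewrite (aW_homogl _ _ _ rd _ hc).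
Qed.
Let e11cr l a m : e11 a (al 0 (c l) *: m) = aW 0 (c l) (e11 a m).
Proof.
rewrite /e11 -aW1c // -(kend_mulE XW) XW_aW // kend_mulE.
by rewrite -(kend_mulE (TW 0)) TW_aW.
Qed.
Let e11cl l a m : e11 (c l * a) m = aW 1 (c l) (e11 a m).
Proof.
rewrite /e11 -aW_same // -(kend_mulE XW) XW_aW // kend_mulE.
by rewrite -(kend_mulE (TW 0)) TW_aW.
Qed.

Let Xf_m (m : M) : X ^+ d *: m = - \sum_(l < d) al 0 (c l) *: (X ^+ l *: m).
Proof.
have := congr1 (fun h : H => h *: m) (X_f HH n0).
rewrite scalerDl scale0r => /eqP; rewrite addr_eq0 => /eqP ->; congr (- _).
by rewrite scaler_suml; apply: eq_bigr => l _; rewrite scalerA.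
Qed.

Let T0_00 a m : TW 0 (e 0 0 a m) = e 1 0 a m + zt 0 1 (e 0 0 a m).
Proof. exact: TW_dn0. Qed.

(** For r > 0, the negative part of the correction in [XW] cancels the teleporter term that T_0
    produces on coset 1, so that a single correction survives. *)
Let Y_e0 r a m : (r < d)%N ->
  TW 0 (XW (TW 0 (e 0 r a m))) = e 0 r a (X *: m) + zt 0 1 (e11 a (X ^+ r *: m)).
Proof.
case: (posnP r) => [-> _|r0 rd].
  by rewrite T0_00 !kendD XW_j0 // TW_up0 // Xz T0z expr0 scale1r.
have rd1 : (1 < d)%N := leq_ltn_trans r0 rd.
rewrite TW_up // XW_jr // [TW 0 _]kendD T0z [TW 0 (_ - _)]kendD kendN !TW_up //.
rewrite /e11 XW_0 // TW_up // TW_dn // /= !mul1r kendD kendN; zmod.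
Qed.

Let X_e11 a m : XW (e11 a m) = e11 a (X *: m).
Proof.
case: (ltnP 1 d) => d1.
  rewrite /e11 !XW_0 // !TW_up // XW_jr //= expr1 subrr kend0 addr0 //.
(* Now f = X + c_0. X is thus multiplication by -c_0, on coset 0 as well as on M, and [zc] moves c_0
   across the teleporter. *)
have d1' : d = 1%N by lia.
have Xt a' m' : XW (e 0 0 a' m') = - \sum_(l < d) e 0 l (c l * a') m'.
  by apply: XW_top; lia.
have sum1 (F : nat -> A -> W) : \sum_(l < d) F l (c l) = F 0%N (c (Ordinal d_gt0)).
  rewrite (bigD1 (Ordinal d_gt0)) //= big1 ?addr0 // => l; case/eqP.
  by apply: val_inj => /=; have := ltn_ord l; lia.
have Xt0 a' m' : XW (e 0 0 a' m') = - e 0 0 (c (Ordinal d_gt0) * a') m'.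
  by rewrite Xt (sum1 (fun l x => e 0 l (x * a') m')).
have Xm : X *: m = - (al 0 (c (Ordinal d_gt0)) *: m).
  have := Xf_m m; rewrite {1}d1' expr1 => ->; congr (- _).
  rewrite (bigD1 (Ordinal d_gt0)) //= expr0 scale1r big1 ?addr0 // => l; case/eqP.
  by apply: val_inj => /=; have := ltn_ord l; lia.
rewrite /e11 !Xt0 !kendN !T0_00 !kendD XW_j0 // Xz Xt0; congr (- (_ + _)).
rewrite Xm eNr -aW1c // -aW_same // kendN kendN zc //.
Qed.

Let C := XW * TW 0 * XW * TW 0 - TW 0 * XW * TW 0 * XW.
Let CE w : C w = XW (TW 0 (XW (TW 0 w))) - TW 0 (XW (TW 0 (XW w))).
Proof. by []. Qed.
Let C_e0 r a m : (r < d)%N -> C (e 0 r a m) = 0.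
Proof.
move=> rd; apply/eqP; rewrite CE subr_eq0; apply/eqP.
rewrite Y_e0 // kendD Xz X_e11.
case: (ltnP r.+1 d) => rd'.
  by rewrite !XW_0 // Y_e0 // exprS scalerA.
(* At the top power X wraps around by f on both sides, but in the teleporter terms the coefficients
   sit in position 0 on one side and in position 1 on the other; [zc] identifies the two. *)
have hr : r.+1 = d by lia.
rewrite !XW_top // !kendN !kend_sum scalerA -exprS hr Xf_m e11N e11_sumr.
rewrite kendN kend_sum -opprD -big_split; congr (- _); apply: eq_bigr => l _ /=.
by rewrite Y_e0 // e11cl -zc e11cr.
Qed.
(** C is the commutator of X T_0 X with T_0, and X T_0 X commutes with [zt 0 1], so that [quad_skew]
    applies. *)
Let C_T0 w : C w = 0 -> C (TW 0 w) = 0.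
Proof.
have e1 : XW * TW 0 * XW * zt 0 1 = zt 0 1 * (XW * TW 0 * XW).
  rewrite -!mulrA XW_zt // [TW 0 * _]mulrA TW_zt_same // !mulrA.
  by rewrite XW_zt.
have := quad_skew (TW_quad n0) e1.
have -> : XW * TW 0 * XW * TW 0 - TW 0 * (XW * TW 0 * XW) = C.
  by rewrite /C !mulrA.
by move=> e2 Cw; rewrite -kend_mulE e2 kend_mulE Cw kend0.
Qed.
Let Cz w : C (zt 0 1 w) = zt 0 1 (C w).
Proof. by rewrite !CE !(T0z, Xz) kendD kendN. Qed.
Let C_e1 r a m : (r < d)%N -> C (e 1 r a m) = 0.
Proof.
move=> rd; case: (posnP r) rd => [->|r0] rd; last by rewrite -TW_up // C_T0 ?C_e0.
have : C (TW 0 (e 0 0 a m)) = 0 by rewrite C_T0 ?C_e0.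
by rewrite T0_00 kendD Cz C_e0 // kend0 addr0.
Qed.
Let C_T i w : (1 < i)%N -> (i < n)%N -> C (TW i w) = TW i (C w).
Proof.
move=> i1 ln; have TX v : XW (TW i v) = TW i (XW v).
  by apply: kend_comm; rewrite XW_TW //; lia.
have TT v : TW 0 (TW i v) = TW i (TW 0 v).
  by apply: kend_comm; rewrite TW_far.
by rewrite !CE !(TX, TT) kendD kendN.
Qed.
(** The coset 2 is reached from coset 1 by T_1, under which the kernel of C is not known to be
    stable. Both sides are therefore expanded completely. *)
Let C_e2 r a m : (1 < n)%N -> (r < d)%N -> C (e 2 r a m) = 0.
Proof.
move=> n1; case: (posnP r) => [-> _|r0 rd].
  apply/eqP; rewrite CE subr_eq0 TW_gt // XW_j0 // TW_gt // !XW_j0 // TW_gt //.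
  by rewrite XW_j0 // TW_gt // !scalerA (X_typeB HH).
have rd1 : (1 < d)%N := leq_ltn_trans r0 rd.
have X2 h : XW (e 2 r a (h *: m)) = e 2 r a ((X * h) *: m)
    + zt 0 2 (e 0 1 a ((T 0 * X ^+ r * h) *: m) - e 0 r a ((T 0 * X * h) *: m)).
  by rewrite XW_jr // !scalerA /= mulr1.
have X1 h : XW (e 1 r a (h *: m)) = e 1 r a ((X * h) *: m)
    + zt 0 1 (e 0 1 a ((X ^+ r * h) *: m) - e 0 r a ((X * h) *: m)).
  by rewrite XW_jr // !scalerA /= !mul1r.
have X11 h : XW (e 1 1 a (h *: m)) = e 1 1 a ((X * h) *: m).
  by rewrite XW_jr // expr1 subrr kend0 addr0 scalerA.
have T2 h : TW 0 (e 2 r a (h *: m)) = e 2 r a ((T 0 * h) *: m).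
  by rewrite TW_gt // scalerA.
have Tz02 w : TW 0 (zt 0 2 w) = zt 1 2 (TW 0 w) by apply: kend_comm0; rewrite TW_zt.
have Tz12 w : TW 0 (zt 1 2 w) = zt 0 2 (TW 0 w) by apply: kend_comm0; rewrite TW_zt.
have Xz12 w : XW (zt 1 2 w) = zt 1 2 (XW w) by apply: kend_comm; rewrite XW_zt.
have Xz02 w : XW (zt 0 2 w) = zt 0 2 (XW w) by apply: kend_comm; rewrite XW_zt.
(* With the next one, this rule brings products of two teleporters on the two sides to a common
   form. *)
have tt1 w : zt 1 2 (zt 0 1 w) = zt 0 2 (zt 1 2 w).
  rewrite -!kend_mulE; congr (_ w).
  rewrite (tel_sym z tr_sym b_basis bd_dual WA (i := 0) (j := 1)) //.
  rewrite (tel_sym z tr_sym b_basis bd_dual WA (i := 0) (j := 2)) //.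
  by rewrite (tel_tel z tr_sym b_basis bd_dual WA).
have tt2 w : zt 0 2 (zt 0 1 w) = zt 1 2 (zt 0 2 w).
  rewrite -!kend_mulE; congr (_ w).
  rewrite (tel_sym z tr_sym b_basis bd_dual WA (i := 1) (j := 2)) //.
  by rewrite (tel_tel z tr_sym b_basis bd_dual WA).
have ze1 h : e 1 1 a ((zh 0 1 * h) *: m) = zt 0 2 (e 1 1 a (h *: m)).
  by rewrite zt_e // scalerA.
have ze0 s h : (s < d)%N -> e 0 s a ((zh 0 1 * h) *: m) = zt 1 2 (e 0 s a (h *: m)).
  by move=> sd; rewrite zt_e // scalerA.
set t0 := T 0; set zz := zh 0 1; set P := X ^+ r.
have q : t0 * t0 = zz * t0 + 1 by exact: (T_quad HH).
(* The type B relation of H and its consequences [y2] to [y4] match the words in T_0, X and P = X^r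
   that the expansion leaves to act on m. *)
have y1 : X * t0 * X * t0 = t0 * X * t0 * X by exact: (X_typeB HH).
have PX : P * X = X * P by apply: commr_sym; exact: commrX.
have Xzz : X * zz = zz * X by apply: (X_tel HH) => //; exact: ltnW.
have Pzz : P * zz = zz * P by apply: commr_sym; apply: commrX.
have tzz : t0 * zz = zz * t0 by exact: (T_tel_same tr_sym b_basis bd_dual HH).
have PY : P * (t0 * X * t0) = t0 * X * t0 * P.
  apply: commr_sym; apply: commrX; rewrite /GRing.comm -y1 !mulrA //.
have y2 : t0 * X * t0 * X * t0 = zz * (X * t0 * X * t0) + X * t0 * X.
  rewrite -y1 -[LHS]mulrA q mulrDr mulr1; congr (_ + _).
  rewrite mulrA -[X * t0 * X * zz]mulrA Xzz mulrA -[X * t0 * zz]mulrA tzz.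
  by rewrite mulrA Xzz !mulrA.
have y3 : t0 * P * t0 * X * t0 = zz * (P * t0 * X * t0) + X * t0 * P.
  have -> : t0 * P * t0 * X * t0 = t0 * (P * (t0 * X * t0)) by rewrite !mulrA.
  rewrite -[P * t0 * X * t0]mulrA -[P * t0 * _]mulrA [t0 * (X * t0)]mulrA PY.
  by rewrite !mulrA q !mulrDl mul1r.
have y4 : X * t0 * P * t0 = t0 * P * t0 * X + zz * (X * t0 * P - P * t0 * X).
  exact: (typeB_comm tr_sym b_basis bd_dual HH).
have TWr h : TW 0 (e 0 r a (h *: m)) = e 1 r a (h *: m) by rewrite TW_up.
have TW1 h : TW 0 (e 0 1 a (h *: m)) = e 1 1 a (h *: m) by rewrite TW_up.
have TWdr h : TW 0 (e 1 r a (h *: m)) =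
    e 0 r a (h *: m) + zt 0 1 (e 1 r a (h *: m)) by rewrite TW_dn.
have TWd1 h : TW 0 (e 1 1 a (h *: m)) =
    e 0 1 a (h *: m) + zt 0 1 (e 1 1 a (h *: m)) by rewrite TW_dn.
(* The factor 1 gives every term the shape [h *: m] that the rewriting rules expect. *)
rewrite -(scale1r m) CE !(T2, X2, X1, X11, TWr, TW1, TWdr, TWd1, Tz02, Tz12, T0z,
  Xz12, Xz02, Xz, kendN, kendD).
rewrite !mulr1 !mulrA -/t0 -/P y2 y1 y3 y4 !scalerDl mulrBr scalerBl.
have z1 := ze0 1%N _ rd1; have zr := ze0 r _ rd.
rewrite !(eDr, eNr, kendD, kendN) !(z1, zr, ze1) !(tt1, tt2); zmod.
Qed.

Lemma XW_typeB : XW * TW 0 * XW * TW 0 = TW 0 * XW * TW 0 * XW.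
Proof.
apply/eqP; rewrite -subr_eq0 -/C; apply/eqP.
apply: ext => j r q s a m jn rd ha hm; rewrite kend_zeroE.
elim: j jn => [|[|[|j]] IH] jn; [exact: C_e0 | exact: C_e1 | exact: C_e2 |].
case: (posnP r) rd => [->|r0] rd.
  apply/eqP; rewrite CE subr_eq0 TW_gt // XW_j0 // TW_gt // !XW_j0 // TW_gt //.
  rewrite XW_j0 // TW_gt // !scalerA (X_typeB HH) //; lia.
by rewrite -TW_up // C_T // IH ?kend0 // ltnW.
Qed.

Let Z_j0 j a m : (j < n)%N -> Z (e j.+1 0 a m) = 0.
Proof.
move=> jn; have Xj r : (XW ^+ r) (e j.+1 0 a m) = e j.+1 0 a (X ^+ r *: m).
  elim: r => [|r IH]; first by rewrite !expr0 scale1r.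
  by rewrite !exprS kend_mulE IH XW_j0 // scalerA.
rewrite /Z kend_addE kend_sumE Xj Xf_m eNr e_sumr addrC.
apply/eqP; rewrite subr_eq0; apply/eqP; apply: eq_bigr => l _.
have [hc _] := c_central l.
by rewrite kend_mulE Xj (aW_homogl _ _ jn d_gt0 _ hc).
Qed.
Let Zz w : Z (zt 0 1 w) = zt 0 1 (Z w).
Proof.
apply: kend_comm; apply/esym/Z_comm; first by rewrite XW_zt.
move=> l; have [hc _] := c_central l; apply/esym/conj_tel => x.
  by rewrite -!(alM WA) c_comm.
by rewrite (al_far WA).
Qed.
Let ZY w : Z (TW 0 (XW (TW 0 w))) = TW 0 (XW (TW 0 (Z w))).
Proof.
have h : Z * (TW 0 * XW * TW 0) = TW 0 * XW * TW 0 * Z.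
  apply/esym/Z_comm; first by rewrite -XW_typeB !mulrA.
  move=> l; rewrite -!mulrA TW_aW // [XW * _]mulrA XW_aW //.
  by rewrite -mulrA mulrA TW_aW // !mulrA.
by have := congr1 (fun f : kend W => f w) h.
Qed.
(** With Y = T_0 X T_0 and t = [zt 0 1], the quadratic relation gives T_0 X v = Y T_0 v - Y t v. As
    Z commutes with Y and t, the claim passes from v to X v. *)
Let Z_T0Xr r a m : Z (TW 0 ((XW ^+ r) (e 0 0 a m))) = 0.
Proof.
elim: r => [|r IH].
  by rewrite expr0 kend_oneE T0_00 kendD Z_j0 // Zz Z_e00 kend0 addr0.
set v := (XW ^+ r) (e 0 0 a m) in IH *.
have Zv : Z v = 0.
  rewrite /v; elim: (r) => [|r' IH']; first by rewrite expr0 Z_e00.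
  by rewrite exprS kend_mulE ZX IH' kend0.
have e1 : TW 0 (XW v) = TW 0 (XW (TW 0 (TW 0 v))) - TW 0 (XW (TW 0 (zt 0 1 v))).
  by rewrite T0T0 T0z -!kendB addrC addKr.
by rewrite exprS kend_mulE -/v e1 kendB !ZY IH Zz Zv !kend0 subrr.
Qed.
Lemma XW_f_pos : XW ^+ d + \sum_(l < d) aW 0 (c l) * XW ^+ l = 0.
Proof.
rewrite -/Z; apply: ext => j r q s a m jn rd ha hm; rewrite kend_zeroE.
elim: j jn => [|[|j] IH] jn; first exact: Z_e0.
  case: (posnP r) rd => [->|r0] rd; first by rewrite Z_j0.
  by rewrite -TW_up // -Xr_e // Z_T0Xr.
case: (posnP r) rd => [->|r0] rd; first by rewrite Z_j0.
rewrite -TW_up //; have TZ : TW j.+1 * Z = Z * TW j.+1.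
  by apply: Z_comm => [|l]; rewrite ?XW_TW ?TW_aW.
by rewrite -(kend_mulE Z) -TZ kend_mulE IH ?kend0 // ltnW.
Qed.
End TypeB.

(** For n = 0 there is only the coset j = 0, where f = 0 holds by construction; for n > 0 the
    relation f = 0 of H takes care of the cosets (j, 0) with j > 0. *)
Lemma XW_f : XW ^+ d + \sum_(l < d) aW 0 (c l) * XW ^+ l = 0.
Proof.
case: (posnP n) => [n0|]; last exact: XW_f_pos.
rewrite -/Z; apply: ext => j r q s a m jn rd ha hm; rewrite kend_zeroE.
by have -> : j = 0%N by [lia]; rewrite Z_e0.
Qed.

Theorem W_hecke : hecke z b bd c n.+1 aW TW XW.
Proof.
split.
- exact: aW_positions.
- exact: TW_even.
- by move=> i j x hi hj; exact: TW_aW.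
- exact: TW_quad.
- exact: TW_braid.
- exact: TW_far.
- exact: XW_even.
- by move=> i x hi; exact: XW_aW.
- exact: XW_TW.
- exact: XW_typeB.
- by move=> _; exact: XW_f.
Qed.
End WAction.

Lemma inK_sign (k : comNzRingType) (S : superAlgType k) m :
  ((-1) ^+ m : k)%:K = (-1) ^+ m :> S.
Proof.
elim: m => [|m IH]; first by rewrite !expr0 inK1.
by rewrite !exprS inKM IH inKN inK1.
Qed.

Lemma mulr_signC (R : pzRingType) m (x y : R) :
  x * ((-1) ^+ m * y) = (-1) ^+ m * (x * y).
Proof. by rewrite -signr_odd !mulr_sign; case: odd; rewrite ?mulrN. Qed.

(** * The presentation of the cyclotomic algebra *)

Section Lift.
Variables (k : comNzRingType) (z : k) (A : superAlgType k).
Variables (B : finType) (b bd : B -> A) (d : nat) (c : 'I_d -> A).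
Variable tr : A -> k.
Hypothesis tr_sym : symmetrizing tr.
Variable par : B -> bool.
Hypothesis b_basis : homogeneous_basis b par.
Hypothesis bd_dual : dual_basis tr b bd.
Hypothesis c_central : forall l, homog false (c l) /\ supercentral (c l).
Hypothesis d_gt0 : (0 < d)%N.
Variable u : A.
Hypothesis uc : u * c (Ordinal d_gt0) = 1.
Hypothesis cu : c (Ordinal d_gt0) * u = 1.
Variables (S : superAlgType k) (n : nat).
Variables (al : nat -> A -> S) (T : nat -> S) (X : S).
Hypothesis HH : hecke z b bd c n al T X.
Let HA := hecke_al HH.
Notation Tinv := (Tinv z b bd al T).

Fixpoint Xs (i : nat) : S := if i is i'.+1 then T i' * Xs i' * T i' else X.

(* Since f(X) = 0 and its constant term is invertible, X is invertible. *)
Definition X0inv : S :=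
  - (al 0 u * (X ^+ d.-1 + \sum_(l < d | (0 < l)%N) al 0 (c l) * X ^+ l.-1)).
Fixpoint Xis (i : nat) : S :=
  if i is i'.+1 then Tinv i' * Xis i' * Tinv i' else X0inv.

Let c0 := c (Ordinal d_gt0).
(** The even element c_0 annihilates the odd part of its inverse u, and c_0 can be cancelled. *)
Lemma u_even : homog false u.
Proof.
have [hc _] := c_central (Ordinal d_gt0).
have : c0 * part true u = 0.
  have := congr1 (part true) cu; rewrite partM hc (homog_neq hc) // mul0r addr0.
  by move=> ->; rewrite (homog_neq (@homog1 k A)).
move/(congr1 (fun v => u * v)); rewrite mulr0 mulrA uc mul1r => u1.
by rewrite /homog -[RHS]part_sum u1 addr0.
Qed.

Lemma X_X0inv : (0 < n)%N -> X * X0inv = 1 /\ X0inv * X = 1.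
Proof.
move=> n0; set Q := X ^+ d.-1 + \sum_(l < d | (0 < l)%N) al 0 (c l) * X ^+ l.-1.
(* This is f(X) = 0 with the constant term on the right. *)
have QX : Q * X = - al 0 c0.
  rewrite /Q mulrDl -exprSr prednK // mulr_suml.
  rewrite (eq_bigr (fun l : 'I_d => al 0 (c l) * X ^+ l)); last first.
    by move=> l l0; rewrite -mulrA -exprSr prednK.
  have := X_f HH n0; rewrite (bigID (fun l : 'I_d => (0 < l)%N)) /=.
  rewrite [X in _ + (_ + X)](big_pred1 (Ordinal d_gt0)); last first.
    by move=> l; rewrite -leqNgt leqn0.
  by rewrite expr0 mulr1 addrA => /eqP; rewrite addr_eq0 => /eqP.
have XQ : X * Q = Q * X.
  rewrite /Q mulrDr mulrDl mulr_sumr mulr_suml -exprS -exprSr; congr (_ + _).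
  apply: eq_bigr => l _; rewrite mulrA (X_al HH) // -!mulrA.
  by rewrite -exprS -exprSr.
rewrite /X0inv -/Q; split.
  rewrite mulrN mulrA (X_al HH) // -mulrA XQ QX mulrN opprK.
  by rewrite -(alM HA) uc (al1 HA).
by rewrite mulNr -mulrA QX mulrN opprK -(alM HA) uc (al1 HA).
Qed.

Lemma X0inv_even : homog false X0inv.
Proof.
rewrite /homog /X0inv partN; congr (- _).
have h : homog (false (+) false) (al 0 u * (X ^+ d.-1
    + \sum_(l < d | (0 < l)%N) al 0 (c l) * X ^+ l.-1)); last exact: h.
apply: homog_mul; first by apply: (al_homog HA); exact: u_even.
apply: homogD; first exact: homog_exp (X_even HH).
apply: homog_sum => l _; have [hc _] := c_central l.
have := homog_mul (al_homog HA 0 hc) (homog_exp l.-1 (X_even HH)); exact.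
Qed.

Lemma Xs_even i : (i < n)%N -> homog false (Xs i).
Proof.
elim: i => [|i IH] ln /=; first exact: (X_even HH).
have hT := T_even HH ln.
by have := homog_mul (homog_mul hT (IH (ltnW ln))) hT.
Qed.

Lemma Tinv_even i : (i.+1 < n)%N -> homog false (Tinv i).
Proof.
move=> ln; rewrite /Tinv; apply: homogD; first exact: (T_even HH).
by rewrite /homog partN (tel_even z tr_sym b_basis bd_dual HA).
Qed.

Lemma Xis_even i : (i < n)%N -> homog false (Xis i).
Proof.
elim: i => [|i IH] ln /=; first exact: X0inv_even.
have hT := Tinv_even ln.
by have := homog_mul (homog_mul hT (IH (ltnW ln))) hT.
Qed.

Lemma Xs_Xis i : (i < n)%N -> Xs i * Xis i = 1 /\ Xis i * Xs i = 1.
Proof.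
elim: i => [|i IH] ln /=; first exact: X_X0inv.
have [e1 e2] := IH (ltnW ln).
have t1 := T_Tinv tr_sym b_basis bd_dual HH ln.
have t2 := Tinv_T HH ln; split.
  rewrite -!mulrA [T i * (Tinv i * _)]mulrA t1 mul1r.
  by rewrite [Xs i * _]mulrA e1 mul1r.
rewrite -!mulrA [Tinv i * (T i * _)]mulrA t2 mul1r.
by rewrite [Xis i * _]mulrA e2 mul1r.
Qed.

Lemma Xs_al i j x : (i < n)%N -> (j < n)%N -> Xs i * al j x = al j x * Xs i.
Proof.
elim: i j => [|i IH] j ln jn /=; first exact: (X_al HH).
rewrite -mulrA (T_al HH) // mulrA -[T i * Xs i * _]mulrA IH ?swp_lt //; last exact: ltnW.
rewrite mulrA (T_al HH) ?swp_lt // swpK !mulrA //.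
Qed.

Lemma T_Xs_lt i j : (j < i)%N -> (i.+1 < n)%N -> T i * Xs j = Xs j * T i.
Proof.
elim: j => [|j IH] ji ln /=; first by rewrite (X_T HH).
have f : T j * T i = T i * T j by rewrite (T_far HH).
rewrite !mulrA -f -[T j * T i * _]mulrA (IH (ltnW ji) ln) mulrA.
by rewrite -[_ * T i * T j]mulrA -f mulrA.
Qed.

(** Induction down to j = i + 2, where X_j = T_{i+1} T_i X_i T_i T_{i+1} and two braid relations
    carry T_i through. *)
Lemma T_Xs_gt i j : (i.+1 < j)%N -> (j < n)%N -> T i * Xs j = Xs j * T i.
Proof.
elim: j => [//|j IH] ij jn /=; case: (ltnP i.+1 j) => ij'.
  have f : T i * T j = T j * T i by rewrite (T_far HH).
  rewrite !mulrA f -[T j * T i * _]mulrA (IH ij' (ltnW jn)) mulrA.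
  by rewrite -[_ * T i * T j]mulrA f mulrA.
have -> : j = i.+1 by lia.
have br : T i * T i.+1 * T i = T i.+1 * T i * T i.+1 by rewrite (T_braid HH) //; lia.
have TX : T i.+1 * Xs i = Xs i * T i.+1 by rewrite T_Xs_lt //; lia.
rewrite /= !mulrA br -[_ * T i.+1 * Xs i]mulrA TX !mulrA.
by rewrite -[_ * T i.+1 * T i * _]mulrA -[_ * T i.+1 * _]mulrA mulrA -!mulrA
  [T i.+1 * (T i * T i.+1)]mulrA -br !mulrA.
Qed.

(** For j = 1 this is the type B relation; the further factors T_1, T_2, ... of X_j commute with
    X. *)
Lemma X_Xs j : (j < n)%N -> X * Xs j = Xs j * X.
Proof.
elim: j => [//|[|j] IH] jn; first by rewrite /= !mulrA (X_typeB HH).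
have f : X * T j.+1 = T j.+1 * X by rewrite (X_T HH).
have := IH (ltnW jn); change (Xs j.+2) with (T j.+1 * Xs j.+1 * T j.+1); move: (Xs j.+1) => Y IH'.
rewrite !mulrA f -[_ * X * Y]mulrA IH' mulrA.
by rewrite -[_ * X * T _]mulrA f mulrA.
Qed.

Lemma Xs_comm_lt i j : (i < j)%N -> (j < n)%N -> Xs i * Xs j = Xs j * Xs i.
Proof.
elim: i => [|i IH] ij jn; first exact: X_Xs.
have f : T i * Xs j = Xs j * T i by rewrite T_Xs_gt.
rewrite /= -mulrA f -!mulrA [Xs i * (_ * _)]mulrA IH //; last exact: ltnW.
by rewrite -mulrA [T i * (Xs j * _)]mulrA f -!mulrA.
Qed.

Lemma Xs_comm i j : (i < n)%N -> (j < n)%N -> Xs i * Xs j = Xs j * Xs i.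
Proof.
by move=> ln jn; case: (ltngtP i j) => [ij|ji|->//]; [|apply/esym]; exact: Xs_comm_lt.
Qed.

Definition apply_tens (a : {ffun 'I_n -> A}) : S := \prod_(i < n) al i (a i).

Definition gen_val (g : gen A n) : S :=
  match g with
  | GTens a => apply_tens a
  | GX i => Xs i
  | GXinv i => Xis i
  | GT i => T i
  end.

Lemma prod_split (G : nat -> S) i : (i < n)%N ->
  \prod_(0 <= j < n) G j
  = \prod_(0 <= j < i) G j * G i * \prod_(i.+1 <= j < n) G j.
Proof.
by move=> ln; rewrite (big_cat_nat (n := i)) //= 1?ltnW // [X in _ * X]big_ltn // mulrA.
Qed.

(** Families indexed by natural numbers allow products to be split into ranges; the default v is
    only taken out of range. *)
Definition ffun_nat (V : Type) (v : V) (a : {ffun 'I_n -> V}) (i : nat) : V :=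
  oapp a v (insub i).
Lemma ffun_natE V v (a : {ffun 'I_n -> V}) (i : 'I_n) : ffun_nat v a i = a i.
Proof. by rewrite /ffun_nat valK. Qed.
Lemma ffun_nat_ltn V v (a : {ffun 'I_n -> V}) i (ln : (i < n)%N) :
  ffun_nat v a i = a (Ordinal ln).
Proof. by rewrite -[i]/(val (Ordinal ln)) ffun_natE. Qed.

Lemma apply_tensE a :
  apply_tens a = \prod_(0 <= i < n) al i (ffun_nat 0 a i).
Proof.
by rewrite big_mkord /apply_tens; apply: eq_bigr => i _; rewrite ffun_natE.
Qed.

Lemma apply_tens_upd a (i : 'I_n) : exists L R : S,
  forall x, apply_tens (upd a i x) = L * al i x * R.
Proof.
exists (\prod_(0 <= j < i) al j (ffun_nat 0 a j)).
exists (\prod_(i.+1 <= j < n) al j (ffun_nat 0 a j)) => x.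
have out j : j != i :> nat -> ffun_nat 0 (upd a i x) j = ffun_nat 0 a j.
  move=> ji; rewrite /ffun_nat; case: insubP => //= o _ oj.
  by rewrite ffunE -val_eqE /= oj (negPf ji).
rewrite apply_tensE (prod_split _ (ltn_ord i)) ffun_natE ffunE eqxx.
congr (_ * _ * _); apply: eq_big_nat => j jn; rewrite out //; lia.
Qed.

Lemma apply_tens1 : apply_tens [ffun=> 1] = 1.
Proof. by apply: big1 => i _; rewrite ffunE (al1 HA). Qed.

Lemma apply_at (i : 'I_n) x : apply_tens (upd [ffun=> 1] i x) = al i x.
Proof.
rewrite apply_tensE (prod_split _ (ltn_ord i)) ffun_natE ffunE eqxx.
rewrite big_nat_cond big1 ?mul1r; last first.
  move=> j /andP[/andP[_ ji] _]; have jn := ltn_trans ji (ltn_ord i).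
  by rewrite (ffun_nat_ltn _ _ jn) !ffunE -val_eqE ltn_eqF //= (al1 HA).
rewrite big_nat_cond big1 ?mulr1 // => j /andP[/andP[ji jn] _].
by rewrite (ffun_nat_ltn _ _ jn) !ffunE -val_eqE gtn_eqF //= (al1 HA).
Qed.

Lemma apply_tens_homog (a : {ffun 'I_n -> A}) (p : {ffun 'I_n -> bool}) :
  (forall i, homog (p i) (a i)) -> homog (tparity p) (apply_tens a).
Proof.
move=> h; apply: (big_rec2 (fun q v => homog q v)); first exact: homog1.
by move=> i q v _ hv; apply: homog_mul => //; apply: (al_homog HA).
Qed.

Lemma al_prod_comm m (q : bool) x (g : nat -> A) (p : nat -> bool) (i : nat) :
  (i <= m)%N -> (m < n)%N -> homog q x -> (forall j, (j < i)%N -> homog (p j) (g j)) ->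
  al m x * \prod_(0 <= j < i) al j (g j)
  = (-1) ^+ (\sum_(0 <= j < i) (q && p j)) * (\prod_(0 <= j < i) al j (g j) * al m x).
Proof.
move=> im mn hx; elim: i im => [|i IH] im hg.
  by rewrite !big_geq // mulr1 !mul1r.
rewrite !big_nat_recr //= mulrA IH //; [|exact: ltnW|by move=> j ji; apply/hg/ltnW].
rewrite -!mulrA (al_comm HA mn (ltn_trans im mn) _ hx (hg i (ltnSn i))); last lia.
by rewrite exprD mulr_signC -!mulrA.
Qed.

Lemma apply_tensM (a a' : {ffun 'I_n -> A}) (p q : {ffun 'I_n -> bool}) :
  (forall i, homog (p i) (a i)) -> (forall i, homog (q i) (a' i)) ->
  apply_tens a * apply_tens a'
  = (-1) ^+ koszul p q * apply_tens [ffun i => a i * a' i].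
Proof.
move=> hp hq; have -> : koszul p q = (\sum_(0 <= i < n) \sum_(0 <= j < i)
    (ffun_nat false p i && ffun_nat false q j))%N.
  rewrite /koszul big_mkord; apply: eq_bigr => i _; rewrite ffun_natE.
  rewrite (big_nat_widen _ _ n) ?(ltnW (ltn_ord i)) // big_mkord.
  by apply: eq_bigr => j _; rewrite ffun_natE.
(* Out of range, the default 0 is homogeneous of any parity, so the extended families remain
   homogeneous. *)
have hN (r : {ffun 'I_n -> bool}) (g : {ffun 'I_n -> A}) :
    (forall i, homog (r i) (g i)) -> forall i, homog (ffun_nat false r i) (ffun_nat 0 g i).
  move=> h i; rewrite /ffun_nat; case: insubP => //= _; exact: part0.
rewrite !apply_tensE.
have -> : \prod_(0 <= i < n) al i (ffun_nat 0 [ffun i => a i * a' i] i)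
  = \prod_(0 <= i < n) al i (ffun_nat 0 a i * ffun_nat 0 a' i).
  apply: eq_big_nat => i /andP[_ ln].
  by rewrite !(ffun_nat_ltn _ _ ln) ffunE.
move: (hN _ _ hp) (hN _ _ hq); move: (ffun_nat 0 a) (ffun_nat 0 a').
move: (ffun_nat false p) (ffun_nat false q) => p' q' g g' hg hg'.
(* The induction is on the length m of an initial segment, while n stays as the bound on
   positions. *)
have : (n <= n)%N by []; move: {-2}n => m; elim: m => [|m IH] mn.
  by rewrite !big_geq // mulr1 expr0 mul1r.
rewrite !big_nat_recr //= -mulrA [al m _ * (_ * _)]mulrA.
rewrite (al_prod_comm (leqnn m) mn (hg m) (fun j _ => hg' j)).
rewrite -!mulrA mulr_signC -(alM HA).
rewrite [\prod_(_ <= _ < _) _ * (\prod_(_ <= _ < _) _ * _)]mulrA IH; last exact: ltnW.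
by rewrite mulrA mulrA -exprD addnC mulrA.
Qed.

(** The factors in positions i and i + 1 are split off: T_i passes all others unchanged, and putting
    these two back in order gives the sign. *)
Lemma T_apply_tens (i : 'I_n.-1) (a : {ffun 'I_n -> A}) (p : {ffun 'I_n -> bool}) :
  (forall j, homog (p j) (a j)) ->
  T i * apply_tens a
  = (-1) ^+ (p (pos0 i) && p (pos1 i))
    * (apply_tens [ffun j => a (swap_pos i j)] * T i).
Proof.
move=> hp; have ln := pos1_subproof i.
rewrite !apply_tensE.
have h0 (a' : {ffun 'I_n -> A}) : ffun_nat 0 a' i = a' (pos0 i) by exact: ffun_natE _ _ (pos0 i).
have h1 (a' : {ffun 'I_n -> A}) : ffun_nat 0 a' i.+1 = a' (pos1 i) by exact: ffun_natE _ _ (pos1 i).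
have i1 := ltnW ln.
have sp (G : nat -> S) :
    \prod_(0 <= j < n) G j = \prod_(0 <= j < i) G j * (G i * (G i.+1 * \prod_(i.+2 <= j < n) G j)).
  by rewrite (prod_split _ i1) (big_ltn ln) !mulrA.
rewrite !sp !h0 !h1 !ffunE.
have s0 : swap_pos i (pos0 i) = pos1 i by rewrite /swap_pos eqxx.
have s1 : swap_pos i (pos1 i) = pos0 i.
  rewrite /swap_pos eqxx ifF //; apply/eqP => /(congr1 val) /=; lia.
rewrite s0 s1.
have out j : j != i :> nat -> j != i.+1 ->
   ffun_nat 0 [ffun j => a (swap_pos i j)] j = ffun_nat 0 a j.
  move=> ji ji1; rewrite /ffun_nat; case: insubP => //= o _ oj.
  by rewrite ffunE /swap_pos -!val_eqE /= oj (negPf ji) (negPf ji1).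
have TP (r : seq nat) : all (fun j => [&& (j < n)%N, j != i & j != i.+1]) r ->
    T i * \prod_(j <- r) al j (ffun_nat 0 a j)
    = \prod_(j <- r) al j (ffun_nat 0 [ffun j => a (swap_pos i j)] j) * T i.
  elim: r => [|j r IH]; first by rewrite !big_nil mul1r mulr1.
  case/andP=> /and3P[jn ji ji1] hr; rewrite !big_cons mulrA (T_al HH) //.
  rewrite /swp (negPf ji) (negPf ji1) -!mulrA IH // out //.
have TPl : all (fun j => [&& (j < n)%N, j != i & j != i.+1]) (index_iota 0 i).
  by apply/allP => j; rewrite mem_index_iota; lia.
have TPr : all (fun j => [&& (j < n)%N, j != i & j != i.+1]) (index_iota i.+2 n).
  by apply/allP => j; rewrite mem_index_iota; lia.
rewrite mulrA (TP _ TPl) -!mulrA -mulr_signC; congr (_ * _).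
rewrite mulrA (T_al HH) // -mulrA [T i * _]mulrA (T_al HH) // -!mulrA (TP _ TPr).
have -> : swp i i = i.+1 by rewrite /swp eqxx.
have -> : swp i i.+1 = i by rewrite /swp eqxx ifF //; lia.
rewrite mulrA (al_comm HA ln i1 _ (hp _) (hp _)); last lia.
by rewrite -!mulrA.
Qed.

Notation ev := (eval_term gen_val).

Lemma eval_sum (I : finType) (F : I -> term k (gen A n)) (F' : I -> S) :
  (forall i, ev (F i) = F' i) -> ev (\sum_(i : I) F i)%term = \sum_i F' i.
Proof.
move=> h; rewrite !unlock; elim: (index_enum I) => [|i s IH] /=; first exact: inK0.
by rewrite IH h.
Qed.
Lemma eval_exp (t : term k (gen A n)) m : ev (t ^+ m)%term = ev t ^+ m.
Proof. by elim: m => [|m IH] /=; rewrite ?inK1 // IH exprS. Qed.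
Lemma eval_at i x : ev (at_pos i x) = al i x.
Proof. exact: apply_at. Qed.

(** The reduced data do not contain the commutation of the X_i with each other and of T_i with the
    X_j away from i; both were derived above from the relations for the first X. *)
Lemma hecke_Hf_rel s t : @Hf_rel k z A B b bd n d c s t -> ev s = ev t.
Proof.
case=> [[] []|[]] /=.
- move=> a i e x y; have [L [R h]] := apply_tens_upd a i.
  rewrite !h (alD HA) (alM HA) (alK HA) // mulrDr mulrDl.
  by rewrite !mulrA inKC.
- by move=> a p h; apply: apply_tens_homog.
- by rewrite apply_tens1 inK1.
- by move=> a a' p q hp hq; rewrite (apply_tensM hp hq) inK_sign.
- by move=> i; apply: (T_even HH); exact: pos1_subproof.
- move=> i j ij; have := pos1_subproof i; have := pos1_subproof j.
  by case/orP: ij => ij hj hi; [rewrite (T_far HH ij hj) | rewrite -(T_far HH ij hi)].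
- move=> i j ij; have := pos1_subproof j; rewrite ij => hj.
  by rewrite (T_braid HH).
- move=> i; rewrite (T_quad HH); last exact: pos1_subproof.
  rewrite telE inK1 -mulrA; congr (_ * (_ * _) + _); apply/esym.
  by apply: eval_sum => e /=; rewrite !apply_at.
- by move=> i a p hp; rewrite (T_apply_tens i hp) inK_sign.
- by move=> i; exact: Xs_even.
- by move=> i; exact: Xis_even.
- by move=> i; rewrite inK1; case: (Xs_Xis (ltn_ord i)).
- by move=> i; rewrite inK1; case: (Xs_Xis (ltn_ord i)).
- by move=> i j; exact: Xs_comm.
- move=> i j j0 j1; have hi := pos1_subproof i.
  case: (ltngtP j i) => ji; first by rewrite T_Xs_lt.
    rewrite T_Xs_gt //; have : j != i.+1 :> nat; last by lia.
    by apply/eqP => e; apply: j1; apply: val_inj.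
  by case: j0; apply: val_inj.
- by [].
- move=> i a; rewrite /apply_tens; apply: (big_ind (fun v => Xs i * v = v * Xs i)).
  + by rewrite mulr1 mul1r.
  + by move=> v w hv hw; rewrite mulrA hv -mulrA hw mulrA.
  + by move=> j _; exact: Xs_al.
- move=> i i0; rewrite inK0 eval_exp /= i0.
  have n0 : (0 < n)%N by have := ltn_ord i; rewrite i0.
  rewrite -(X_f HH n0); congr (_ + _); apply: eval_sum => l.
  rewrite -[LHS]/(ev (at_pos i (c l)) * ev (tX A i ^+ l)%term).
  by rewrite eval_at eval_exp /= i0.
Qed.

Definition Hf_lift : superAlgHom (Hf z b bd c n) S := lift_hom hecke_Hf_rel.
Lemma Hf_liftE t : Hf_lift (cls _ t) = ev t.
Proof. exact: (lift_cls hecke_Hf_rel t). Qed.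
End Lift.

(** * The cyclotomic algebra satisfies the reduced relations *)

Section HfHecke.
Variables (k : comNzRingType) (z : k) (A : superAlgType k).
Variables (B : finType) (b bd : B -> A) (d : nat) (c : 'I_d -> A).
Variable n : nat.
Notation R := (@Hf_rel k z A B b bd n d c).
Notation S := (Hf z b bd c n).
Notation cl := (cls R).
Implicit Types (a : {ffun 'I_n -> A}) (p q : bool).

Let tens_eq s t : tens_rel s t -> cl s = cl t.
Proof. by move=> h; apply/clsE/c_rel; left; constructor. Qed.
Let hecke_eq s t : hecke_rel z b bd s t -> cl s = cl t.
Proof. by move=> h; apply/clsE/c_rel; left; constructor. Qed.
Let affine_eq s t : affine_rel s t -> cl s = cl t.
Proof. by move=> h; apply/clsE/c_rel; left; constructor. Qed.

Definition tensH a : S := cl (tens a).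
Definition alH (i : nat) (x : A) : S :=
  if insub i is Some i' then tensH (upd [ffun=> 1] i' x) else 0.
Definition TH (i : nat) : S := if insub i is Some i' then cl (tT A i') else 0.
Definition XH : S := if insub 0%N is Some i then cl (tX A i) else 0.

Lemma alHE (i : 'I_n) x : alH i x = tensH (upd [ffun=> 1] i x).
Proof. by rewrite /alH valK. Qed.
Lemma THE (i : 'I_n.-1) : TH i = cl (tT A i).
Proof. by rewrite /TH valK. Qed.
Lemma XHE (i : 'I_n) : i = 0%N :> nat -> XH = cl (tX A i).
Proof. by move=> i0; rewrite /XH -i0 valK. Qed.

Lemma tensH_lin a i (s : k) x y :
  tensH (upd a i (s%:K * x + y)) = s%:K * tensH (upd a i x) + tensH (upd a i y).
Proof. by rewrite /tensH (tens_eq (r_linear _ _ _ _ _)) clsD clsM. Qed.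
Lemma tensHD a i x y :
  tensH (upd a i (x + y)) = tensH (upd a i x) + tensH (upd a i y).
Proof. by have := tensH_lin a i 1 x y; rewrite !inK1 !mul1r. Qed.
Lemma tensH0 a i : tensH (upd a i 0) = 0.
Proof.
by apply: (addIr (tensH (upd a i 0))); rewrite -tensHD !add0r.
Qed.
Lemma tensHZ a i (s : k) x :
  tensH (upd a i (s%:K * x)) = s%:K * tensH (upd a i x).
Proof. by have := tensH_lin a i s x 0; rewrite tensH0 !addr0. Qed.
Lemma tensH_homog a (p : {ffun 'I_n -> bool}) : (forall i, homog (p i) (a i)) ->
  homog (tparity p) (tensH a).
Proof. by move=> h; rewrite /homog -cls_part; apply: tens_eq; exact: r_parity. Qed.
Lemma tensH1 : tensH [ffun=> 1] = 1.
Proof. by rewrite /tensH (tens_eq (r_one _ _)). Qed.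
Lemma tensHM a a' (p q : {ffun 'I_n -> bool}) :
  (forall i, homog (p i) (a i)) -> (forall i, homog (q i) (a' i)) ->
  tensH a * tensH a' = (-1) ^+ koszul p q * tensH [ffun i => a i * a' i].
Proof.
move=> hp hq; rewrite -clsM (tens_eq (r_mul hp hq)) clsM; congr (_ * _).
exact: (inK_sign S).
Qed.

Let delta (i : 'I_n) (p : bool) : {ffun 'I_n -> bool} :=
  [ffun j => if j == i then p else false].
Let upd_homog i p (x : A) : homog p x ->
  forall j, homog (delta i p j) (upd [ffun=> 1] i x j).
Proof. by move=> h j; rewrite !ffunE; case: eqP => // _; exact: homog1. Qed.
Let koszul_delta i j p q :
  koszul (delta i p) (delta j q) = ((j < i)%N && p && q : bool) :> nat.
Proof.
rewrite /koszul (bigD1 i) //= [X in (_ + X)%N]big1 ?addn0 => [|i' /negPf i'i].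
  have -> : delta i p i = p by rewrite ffunE eqxx.
  case ji: (j < i)%N.
    rewrite (bigD1 j) //= [X in (_ + X)%N]big1 ?addn0 => [|j' /andP[_ /negPf j'j]].
      by rewrite !ffunE eqxx.
    by rewrite !ffunE j'j andbF.
  apply: big1 => j' j'i; rewrite !ffunE; case: eqP => [e|]; rewrite ?andbF //.
  by move: ji; rewrite -e j'i.
by apply: big1 => j' _; rewrite !ffunE i'i.
Qed.
Let tparity_delta i p : tparity (delta i p) = p.
Proof.
rewrite /tparity (bigD1 i) //= big1 ?addbF ?ffunE ?eqxx // => j /negPf ji.
by rewrite ffunE ji.
Qed.

Let alHD i x y : alH i (x + y) = alH i x + alH i y.
Proof.
by rewrite /alH; case: insubP => [j _ _|_]; rewrite ?addr0 ?tensHD.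
Qed.
Let alH_homog i p x : homog p x -> homog p (alH i x).
Proof.
move=> hx; rewrite /alH; case: insubP => [j _ _|_]; last exact: part0.
by rewrite -{1}(tparity_delta j p); apply/tensH_homog/upd_homog.
Qed.
Let bi_homog (V : zmodType) (F G : A -> A -> V) :
  (forall x x' y, F (x + x') y = F x y + F x' y) ->
  (forall x y y', F x (y + y') = F x y + F x y') ->
  (forall x x' y, G (x + x') y = G x y + G x' y) ->
  (forall x y y', G x (y + y') = G x y + G x y') ->
  (forall p q x y, homog p x -> homog q y -> F x y = G x y) ->
  forall x y, F x y = G x y.
Proof.
move=> F1 F2 G1 G2 h x y; rewrite -[x]part_sum -[y]part_sum !(F1, F2, G1, G2).
by congr (_ + _ + (_ + _)); apply: h; exact: homog_part.
Qed.
Let alHM i x y : alH i (x * y) = alH i x * alH i y.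
Proof.
move: x y; apply: bi_homog => [x x' y|x y y'|x x' y|x y y'|p q x y hx hy].
- by rewrite mulrDl alHD.
- by rewrite mulrDr alHD.
- by rewrite alHD mulrDl.
- by rewrite alHD mulrDr.
rewrite /alH; case: insubP => [j _ _|_]; last by rewrite mulr0.
rewrite (tensHM (upd_homog _ hx) (upd_homog _ hy)) koszul_delta ltnn expr0 mul1r.
by congr tensH; apply/ffunP => l; rewrite !ffunE; case: eqP => // _; rewrite mulr1.
Qed.
Let alH_comm (i j : 'I_n) p q x y : i <> j -> homog p x -> homog q y ->
  alH i x * alH j y = (-1) ^+ (p && q) * (alH j y * alH i x).
Proof.
move=> ij hx hy; rewrite !alHE.
rewrite (tensHM (upd_homog _ hx) (upd_homog _ hy)) (tensHM (upd_homog _ hy) (upd_homog _ hx)).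
rewrite !koszul_delta mulrA -signr_addb.
have -> : [ffun l => upd [ffun=> 1] i x l * upd [ffun=> 1] j y l]
        = [ffun l => upd [ffun=> 1] j y l * upd [ffun=> 1] i x l].
  apply/ffunP => l; rewrite !ffunE; case: (l =P i) => [->|_].
    by case: eqP => // _; rewrite mulr1 mul1r.
  by case: eqP => // _; rewrite mulr1 mul1r.
congr ((-1) ^+ nat_of_bool _ * _).
have : i != j :> nat by apply/eqP => e; apply: ij; exact: val_inj.
by case: (ltngtP i j) => //= _ _; case: p q {hx hy} => [] [].
Qed.

Lemma alH_positions : positions n alH.
Proof.
split => //.
- move=> i s ln; rewrite -[i]/(val (Ordinal ln)) alHE -[s%:K]mulr1 tensHZ.
  have -> : upd [ffun=> 1] (Ordinal ln) 1 = [ffun=> 1] :> {ffun 'I_n -> A}.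
    by apply/ffunP => j; rewrite !ffunE if_same.
  by rewrite tensH1 mulr1.
- move=> i j p q x y ln jn ij.
  have ij' : Ordinal ln <> Ordinal jn by move/(congr1 val).
  exact: (alH_comm ij').
Qed.

Let T_alH (i : 'I_n.-1) (j : 'I_n) x :
  TH i * alH j x = alH (swp i j) x * TH i.
Proof.
suff h p y : homog p y -> TH i * alH j y = alH (swp i j) y * TH i.
  rewrite -[x]part_sum !alHD mulrDl mulrDr.
  by congr (_ + _); apply: h; exact: homog_part.
move=> hy; have sw (l : 'I_n) : swp i l = swap_pos i l :> nat.
  by rewrite /swp /swap_pos -!val_eqE /=; do !case: ifP.
rewrite !sw !alHE THE /tensH -clsM (hecke_eq (r_Ttens z b bd i (upd_homog _ hy))).
rewrite clsM clsM !ffunE.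
have -> : (if pos0 i == j then p else false) && (if pos1 i == j then p else false) = false.
  case: eqP => // <-; case: eqP => //; rewrite ?andbF // => /(congr1 val) /= e; lia.
rewrite expr0 -[cls _ 1%:K%term]/(1 : S) mul1r; congr (cl (tens _) * _).
apply/ffunP => l; rewrite !ffunE; congr (if _ then _ else _).
by rewrite -!val_eqE /= -!sw; apply/eqP/eqP => [<-|->]; rewrite swpK.
Qed.

Lemma eval_cls_exp (t : term k (gen A n)) m : cl (t ^+ m)%term = cl t ^+ m.
Proof. by elim: m => //= m IH; rewrite clsM IH exprS. Qed.
Lemma eval_cls_sum (I : finType) (F : I -> term k (gen A n)) :
  cl (\sum_(i : I) F i)%term = \sum_i cl (F i).
Proof. by rewrite !unlock; elim: (index_enum I) => //= i s IH; rewrite clsD IH. Qed.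

Let ordT i : (i.+1 < n)%N -> exists i' : 'I_n.-1, i = i' :> nat.
Proof.
move=> ln; have h : (i < n.-1)%N by case: (n) ln.
by exists (Ordinal h).
Qed.

Lemma Hf_hecke : hecke z b bd c n alH TH XH.
Proof.
split.
- exact: alH_positions.
- move=> i /ordT[i' ->]; rewrite THE.
  by have := hecke_eq (r_Teven z b bd i'); rewrite cls_part.
- by move=> i j x /ordT[i' ->] jn; exact: (T_alH i' (Ordinal jn)).
- move=> i /ordT[i' ->]; rewrite THE -clsM (hecke_eq (r_quad z b bd i')).
  rewrite clsD clsM clsM telE eval_cls_sum mulrA; congr (_ * _ * _ + _).
  apply: eq_bigr => e _; rewrite clsM.
  rewrite (alHE (pos0 i') (b e) : alH i' (b e) = _).
  by rewrite (alHE (pos1 i') (bd e) : alH i'.+1 (bd e) = _).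
- move=> i ln; have /ordT[i' ii'] := ltnW ln; have /ordT[j' jj'] := ln.
  have e : j' = i'.+1 :> nat by rewrite -ii' -jj'.
  by rewrite jj' ii' !THE; have := hecke_eq (r_braid z b bd e); rewrite !clsM.
- move=> i j ij jn; have /ordT[i' ii'] : (i.+1 < n)%N by lia.
  have /ordT[j' jj'] := jn; have h : (i'.+1 < j')%N || (j'.+1 < i')%N by lia.
  by rewrite jj' ii' !THE; have := hecke_eq (r_Tcomm z b bd h); rewrite !clsM.
- rewrite /XH; case: insubP => [i _ _|_]; last exact: part0.
  by have := affine_eq (r_Xeven A i); rewrite cls_part.
- move=> i x ln; have n0 : (0 < n)%N by lia.
  rewrite (XHE (i := Ordinal n0)) // -[i]/(val (Ordinal ln)) alHE /tensH.
  by have := affine_eq (r_Xtens (Ordinal n0) (upd [ffun=> 1] (Ordinal ln) x)); rewrite !clsM.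
- move=> i i0 ln; have n0 : (0 < n)%N by lia.
  have /ordT[i' ii'] := ln; rewrite (XHE (i := Ordinal n0)) // ii' THE.
  have h0 : Ordinal n0 <> pos0 i' by move/(congr1 val) => /= e; lia.
  have h1 : Ordinal n0 <> pos1 i' by move/(congr1 val).
  by have := affine_eq (r_TX A h0 h1); rewrite !clsM.
- move=> n1; have n0 : (0 < n)%N by lia.
  have /ordT[i' ii'] := n1.
  have -> : TH 0 = cl (tT A i') by rewrite -THE -ii'.
  have e0 : pos0 i' = 0%N :> nat by [].
  (* As T_0 X_1 T_0 = X_2, the type B relation is the commutation of X_1 and X_2. *)
  rewrite (XHE e0); have := affine_eq (r_TXT A i'); rewrite !clsM => e1.
  rewrite -!mulrA [cl (tT A i') * (cl _ * cl _)]mulrA e1.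
  have := affine_eq (r_Xcomm A (pos0 i') (pos1 i')); rewrite !clsM => ->.
  by rewrite -e1 !mulrA.
- move=> n0; rewrite (XHE (i := Ordinal n0)) //.
  have h : cyclotomic_rel c (tX A (Ordinal n0) ^+ d + \sum_(l < d)
    at_pos (Ordinal n0) (c l) * tX A (Ordinal n0) ^+ l)%term 0%term by apply: r_f.
  have : R _ _ := or_intror h; move/c_rel/clsE => e.
  apply: etrans e; rewrite clsD eval_cls_exp eval_cls_sum; congr (_ + _).
  apply: eq_bigr => l _; rewrite clsM eval_cls_exp.
  by rewrite (alHE (Ordinal n0) (c l) : alH 0 (c l) = _).
Qed.
End HfHecke.

(** * Generation of the cyclotomic algebra by the reduced generators *)

Section HfGenerated.
Variables (k : comNzRingType) (z : k) (A : superAlgType k).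
Variables (B : finType) (b bd : B -> A) (d : nat) (c : 'I_d -> A).
Variable tr : A -> k.
Hypothesis tr_sym : symmetrizing tr.
Variable par : B -> bool.
Hypothesis b_basis : homogeneous_basis b par.
Hypothesis bd_dual : dual_basis tr b bd.
Hypothesis c_central : forall l, homog false (c l) /\ supercentral (c l).
Hypothesis d_gt0 : (0 < d)%N.
Variable u : A.
Hypothesis uc : u * c (Ordinal d_gt0) = 1.
Hypothesis cu : c (Ordinal d_gt0) * u = 1.

Section Generation.
Variable n : nat.
Notation R := (@Hf_rel k z A B b bd n d c).
Notation S := (Hf z b bd c n).
Notation cl := (cls R).
Notation al := (@alH k z A B b bd d c n).
Notation T := (@TH k z A B b bd d c n).
Notation X := (@XH k z A B b bd d c n).
Notation tensH := (@tensH k z A B b bd d c n).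
Let HH : hecke z b bd c n al T X := Hf_hecke z b bd c n.
Let HA := hecke_al HH.

Let tens_prod_homog (a : {ffun 'I_n -> A}) (p : {ffun 'I_n -> bool}) :
  (forall i, homog (p i) (a i)) -> tensH a = apply_tens al a.
Proof.
move=> hp.
pose am m : {ffun 'I_n -> A} := [ffun j : 'I_n => if (j < m)%N then a j else 1].
pose pm m : {ffun 'I_n -> bool} := [ffun j : 'I_n => if (j < m)%N then p j else false].
have hm m i : homog (pm m i) (am m i).
  by rewrite !ffunE; case: ifP => // _; exact: homog1.
suff h m : (m <= n)%N -> tensH (am m) = \prod_(0 <= i < m) al i (ffun_nat 0 a i).
  rewrite apply_tensE -h //; congr tensH; apply/ffunP => j.
  by rewrite ffunE ltn_ord.
elim: m => [|m IH] mn.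
  have -> : am 0%N = [ffun=> 1] by apply/ffunP => j; rewrite !ffunE.
  by rewrite big_geq // tensH1.
rewrite big_nat_recr //= -IH; last exact: ltnW.
set o := Ordinal mn; rewrite (ffun_nat_ltn _ _ mn).
rewrite -[m in al m]/(val o) alHE.
pose q : {ffun 'I_n -> bool} := [ffun j => if j == o then p o else false].
have hq i : homog (q i) (upd [ffun=> 1] o (a o) i).
  by rewrite !ffunE; case: eqP => // _; exact: homog1.
rewrite (tensHM _ _ _ _ (hm m) hq).
(* All factors of the initial segment stand before position m, so that nothing is exchanged. *)
have -> : koszul (pm m) q = 0%N.
  apply: big1 => i _; apply: big1 => j ji; rewrite !ffunE.
  case: eqP => [e|_]; rewrite ?andbF //; move: ji; rewrite e /=.
  by case: ltngtP.
rewrite expr0 mul1r; congr tensH; apply/ffunP => j; rewrite !ffunE -val_eqE /=.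
rewrite ltnS leq_eqVlt; case: eqP => [e|_] /=; last by rewrite mulr1.
by rewrite e ltnn mul1r; congr (a _); exact: val_inj.
Qed.

(** The multiplication rule for pure tensors is only given for homogeneous factors. By additivity
    the factors are split into their components one position at a time; in the induction, those
    below m are not yet homogeneous. *)
Lemma tens_prod (a : {ffun 'I_n -> A}) : tensH a = apply_tens al a.
Proof.
suff h m (p : {ffun 'I_n -> bool}) (a' : {ffun 'I_n -> A}) :
    (forall i : 'I_n, (m <= i)%N -> homog (p i) (a' i)) -> tensH a' = apply_tens al a'.
  by apply: (h n [ffun=> false]) => i; rewrite leqNgt ltn_ord.
elim: m p a' => [|m IH] p a' hp; first by apply: tens_prod_homog => i; exact: hp.
case: (ltnP m n) => mn; last first.
  by apply: (IH p) => i mi; apply: hp; have := ltn_ord i; lia.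
set o := Ordinal mn.
have ea : a' = upd a' o (part false (a' o) + part true (a' o)).
  by apply/ffunP => j; rewrite ffunE part_sum; case: eqP => [->|].
have [L [Rr eLR]] := apply_tens_upd d_gt0 al a' o.
rewrite {1 2}ea tensHD eLR (alD HA) mulrDr mulrDl -!eLR.
have h q : tensH (upd a' o (part q (a' o))) = apply_tens al (upd a' o (part q (a' o))).
  apply: (IH [ffun i => if i == o then q else p i]) => i mi; rewrite !ffunE.
  case: eqP => [_|ne]; first exact: homog_part.
  by apply: hp; rewrite ltn_neqAle mi andbT; apply/eqP => e; apply/ne/val_inj.
by rewrite !h.
Qed.

Lemma cls_tX (i : 'I_n) : cl (tX A i) = Xs T X i.
Proof.
case: i => i; elim: i => [|i IH] ln; first by rewrite /= -(XHE _ _ _ _ (i := Ordinal ln)).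
have hi : (i < n.-1)%N by case: (n) ln.
have /clsE := c_rel (R := R) (or_introl (Or33 _ _ (r_TXT A (Ordinal hi)))).
rewrite !clsM; have -> : pos1 (Ordinal hi) = Ordinal ln by exact: val_inj.
have -> : pos0 (Ordinal hi) = Ordinal (ltnW ln) by exact: val_inj.
by move=> <-; rewrite IH -THE.
Qed.

Lemma cls_tXinv (i : 'I_n) : cl (tXinv A i) = Xis z b bd c u al T X i.
Proof.
have [_ e1] := Xs_Xis tr_sym b_basis bd_dual uc HH (ltn_ord i).
have /clsE := c_rel (R := R) (or_introl (Or33 _ _ (r_XXinv A i))).
rewrite clsM cls_tX => e2.
by rewrite -[LHS]mul1r -e1 -mulrA e2 mulr1.
Qed.

(** Pure tensors, the other X_i and the inverses of all X_i are noncommutative polynomials in the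
    reduced generators, and so need no clause of their own. *)
Lemma Hf_ind (P : S -> Prop) :
  (forall s, P s%:K) -> (forall x y, P x -> P y -> P (x + y)) ->
  (forall x y, P x -> P y -> P (x * y)) ->
  (forall i x, (i < n)%N -> P (al i x)) ->
  (forall i, (i.+1 < n)%N -> P (T i)) -> ((0 < n)%N -> P X) ->
  forall x, P x.
Proof.
move=> PK PD PM Pal PT PX.
have P0 : P 0 by rewrite -(inK0 S); exact: PK.
have P1 : P 1 by rewrite -(inK1 (s := S)); exact: PK.
have PN x : P x -> P (- x).
  by move=> Px; rewrite -mulN1r -(inK1 (s := S)) -inKN; exact: PM.
have Psum I (r : seq I) (Q : pred I) (F : I -> S) :
    (forall i, Q i -> P (F i)) -> P (\sum_(i <- r | Q i) F i).
  by move=> h; apply: (big_ind P).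
have Pexp x r : P x -> P (x ^+ r).
  by move=> Px; elim: r => [|r IH]; rewrite ?expr0 // exprS; exact: PM.
(* The terms of the presentation involve [TPart], under which P need not be stable; hence P is
   proved for both components at once. *)
pose Q x := P (part false x) /\ P (part true x).
have QP x : Q x -> P x by case=> h0 h1; rewrite -[x]part_sum; exact: PD.
have Qeven x : homog false x -> P x -> Q x.
  by move=> hx Px; split; rewrite ?hx // (homog_neq hx).
have QM x y : Q x -> Q y -> Q (x * y).
  by case=> x0 x1 [y0 y1]; split; rewrite partM; apply: (PD); apply: (PM).
have QX i : (i < n)%N -> P (Xs T X i).
  by elim: i => [|i IH] ln /=; [exact: PX |
    apply: (PM); [apply: (PM)|]; [exact: PT | apply: (IH); exact: ltnW | exact: PT]].
have Ptel i j : (i < n)%N -> (j < n)%N -> P (tel z b bd al i j).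
  by move=> ln jn; rewrite telE; apply: (PM) => //; apply: (Psum) => e _; apply: (PM); apply: (Pal).
have PTi i : (i.+1 < n)%N -> P (Tinv z b bd al T i).
  by move=> ln; apply: (PD); [exact: PT | apply: (PN); apply: (Ptel); lia].
have QXi i : (i < n)%N -> P (Xis z b bd c u al T X i).
  elim: i => [|i IH] ln /=; last first.
    by apply: (PM); [apply: (PM)|]; [exact: PTi | apply: (IH); exact: ltnW | exact: PTi].
  apply: (PN); apply: (PM); first exact: Pal.
  apply: (PD); first by apply: (Pexp); exact: PX.
  by apply: (Psum) => l _; apply: (PM); [exact: Pal | apply: (Pexp); exact: PX].
apply: clsP => t; apply: QP; elim: t => [[a|i|i|i]|s|s hs t ht|s hs|s hs t ht|p s hs].
- rewrite -[cl _]/(tensH a) tens_prod; apply: (big_ind Q).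
  + by apply: Qeven; [exact: homog1|].
  + exact: QM.
  + by move=> i _; split; rewrite -(al_part HA); exact: Pal.
- rewrite -[cl _]/(cl (tX A i)) cls_tX; apply: Qeven; last exact: QX.
  exact: (Xs_even HH).
- rewrite -[cl _]/(cl (tXinv A i)) cls_tXinv; apply: Qeven; last exact: QXi.
  exact: (Xis_even tr_sym b_basis bd_dual c_central uc cu HH).
- have ln := pos1_subproof i.
  rewrite -[cl _]/(cl (tT A i)) -THE; apply: Qeven; last exact: PT.
  exact: (T_even HH).
- by apply: Qeven; [exact: (@homogK k S s) | exact: (PK s)].
- by rewrite clsD; case: hs ht => h1 h2 [h3 h4]; split; rewrite partD; exact: PD.
- by rewrite clsN; case: hs => h1 h2; split; rewrite partN; exact: PN.
- by rewrite clsM; exact: QM.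
- rewrite cls_part; case: hs => h1 h2; split; rewrite part_part.
    by case: p.
  by case: p.
Qed.
End Generation.

Section InclGens.
Variable n : nat.
Notation incl := (incl z b bd c n).

Let incl_cls t : incl (cls _ t) = eval_term (@incl_gen k z A B b bd d c n) t.
Proof. exact: (lift_cls (@incl_ok k z A B b bd d c n) t). Qed.
Let lift_val (i : 'I_n) : lift ord_max i = i :> nat.
Proof. exact: lift_max. Qed.

Lemma incl_al i x : (i < n)%N ->
  incl (alH z b bd c n i x) = alH z b bd c n.+1 i x.
Proof.
move=> ln; set o := Ordinal ln.
rewrite (alHE _ _ _ _ o x : alH _ _ _ _ _ i x = _) incl_cls /= /incl_gen.
have := alHE z b bd c (lift ord_max o) x; rewrite lift_val => ->.
congr (cls _ (tens _)); apply/ffunP => j; rewrite [RHS]ffunE ffunE.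
case: (unliftP ord_max j) => [j' ->|->] /=.
  by rewrite !ffunE (inj_eq lift_inj).
by rewrite (negPf (neq_lift _ _)) ffunE.
Qed.

Lemma incl_T i : (i.+1 < n)%N -> incl (TH z b bd c n i) = TH z b bd c n.+1 i.
Proof.
move=> ln; have hi : (i < n.-1)%N by case: (n) ln.
rewrite (THE _ _ _ _ (Ordinal hi) : TH _ _ _ _ _ i = _) incl_cls /= /incl_gen.
by have := THE z b bd c (extT (Ordinal hi)) => /= <-.
Qed.

Lemma incl_X : (0 < n)%N -> incl (XH z b bd c n) = XH z b bd c n.+1.
Proof.
move=> n0; set o := Ordinal n0.
rewrite (XHE _ _ _ _ (i := o)) // incl_cls /= /incl_gen.
by have := XHE z b bd c (i := lift ord_max o); rewrite lift_val => ->.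
Qed.
End InclGens.
End HfGenerated.

(** * Induction *)

Section Transversal.
Variables (k : comNzRingType) (z : k) (A : superAlgType k).
Variables (B : finType) (b bd : B -> A) (d : nat) (c : 'I_d -> A).
Variable tr : A -> k.
Hypothesis tr_sym : symmetrizing tr.
Variable par : B -> bool.
Hypothesis b_basis : homogeneous_basis b par.
Hypothesis bd_dual : dual_basis tr b bd.
Variables (S : superAlgType k) (n : nat).
Variables (al : nat -> A -> S) (T : nat -> S) (X : S).
Hypothesis HH : hecke z b bd c n.+1 al T X.
Notation zt := (tel z b bd al).
Notation Td := (Td T).
Notation Tu := (Tu T).

Lemma T_Tu_far i j m : (i.+1 < j)%N -> (j + m <= n)%N -> T i * Tu j m = Tu j m * T i.
Proof.
elim: m j => [|m IH] j ij jm /=; first by rewrite mulr1 mul1r.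
rewrite mulrA (T_far HH) //; last lia.
by rewrite -mulrA IH ?mulrA //; lia.
Qed.

Lemma T_Tu i j m : (j < i)%N -> (i < j + m)%N -> (j + m <= n)%N ->
  T i * Tu j m = Tu j m * T i.-1.
Proof.
elim: m j => [|m IH] j ji im jm /=; first lia.
case: (eqVneq i j.+1) => [->|ne].
  case: m IH im jm => [|m] IH im jm /=; first lia.
  rewrite !mulrA -(T_braid HH); last lia.
  by rewrite -!mulrA T_Tu_far //; lia.
rewrite mulrA -(T_far HH); try lia.
by rewrite -mulrA IH ?mulrA //; lia.
Qed.

Lemma al_Tu_far i j m x : (i < j)%N -> (j + m <= n)%N ->
  al i x * Tu j m = Tu j m * al i x.
Proof.
elim: m j => [|m IH] j ij jm /=; first by rewrite mulr1 mul1r.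
rewrite mulrA (al_T HH); try lia.
rewrite /swp !ifF; try lia.
by rewrite -!mulrA IH //; lia.
Qed.

Lemma al_Tu i j m x : (j < i)%N -> (i <= j + m)%N -> (j + m <= n)%N ->
  al i x * Tu j m = Tu j m * al i.-1 x.
Proof.
elim: m j => [|m IH] j ji im jm /=; first lia.
rewrite mulrA (al_T HH); try lia.
have nij : (i == j) = false by lia.
rewrite /swp nij; case: eqP => [->|ne]; rewrite -!mulrA.
  by rewrite al_Tu_far //; lia.
by rewrite IH //; lia.
Qed.

Lemma X_Tu j m : (0 < j)%N -> (j + m <= n)%N -> X * Tu j m = Tu j m * X.
Proof.
elim: m j => [|m IH] j j0 jm /=; first by rewrite mulr1 mul1r.
by rewrite mulrA (X_T HH) ?mulrA -?mulrA ?IH //; lia.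
Qed.

Let Xr (y : S) r : X * y = y * X -> X ^+ r * y = y * X ^+ r.
Proof. by move=> h; apply: commr_sym; apply: commrX; exact: commr_sym. Qed.

(* A basis of the algebra as a right module over the one on n strands: the
   cosets of the complex reflection group G(d, 1, n + 1) by G(d, 1, n). *)
Definition coset_rep (j r : nat) : S :=
  if r == 0%N then Tu j (n - j) else Td j * X ^+ r * Tu 0 n.

Lemma E_pos j r : (0 < r)%N -> coset_rep j r = Td j * X ^+ r * Tu 0 n.
Proof. by case: r. Qed.
Lemma E_0 r : coset_rep 0 r = X ^+ r * Tu 0 n.
Proof. by case: r => [|r]; rewrite /coset_rep /= ?subn0 mul1r. Qed.
Lemma E_last : coset_rep n 0 = 1.
Proof. by rewrite /coset_rep subnn. Qed.

Lemma al_E i j r x : (i <= n)%N -> (j <= n)%N -> i <> j ->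
  al i x * coset_rep j r = coset_rep j r * al (unb j i) x.
Proof.
move=> hi jn ij; case: (posnP r) => [->|r0].
  rewrite /coset_rep /= /unb; case: ltnP => ji; first by rewrite al_Tu //; lia.
  by rewrite al_Tu_far //; lia.
rewrite E_pos // !mulrA (al_Td HH) // ifF; last by apply/eqP.
set i' := if _ then _ else _; have hi' : (0 < i' <= n)%N.
  by rewrite /i'; case: ifP; lia.
rewrite -[Td j * _ * _]mulrA -(Xr r (X_al HH _ _)); last lia.
rewrite !mulrA -[_ * al i' x * _]mulrA al_Tu; try lia.
by rewrite mulrA; congr (_ * al _ x); rewrite /i' /unb; do !case: ifP; lia.
Qed.

Lemma T_E_lt i j r : (j < i)%N -> (i < n)%N -> T i * coset_rep j r = coset_rep j r * T i.-1.
Proof.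
move=> ji hi; case: (posnP r) => [->|r0].
  by rewrite /coset_rep /= T_Tu //; lia.
have TX : X * T i = T i * X by rewrite (X_T HH) //; lia.
rewrite E_pos // !mulrA (T_Td_far HH) // -[Td j * _ * _]mulrA -(Xr r TX).
by rewrite -!mulrA T_Tu //; lia.
Qed.
Lemma T_E_gt i j r : (i.+1 < j)%N -> (j <= n)%N -> T i * coset_rep j r = coset_rep j r * T i.
Proof.
move=> ij jn; case: (posnP r) => [->|r0].
  by rewrite /coset_rep /= T_Tu_far //; lia.
have TX : X * T i.+1 = T i.+1 * X by rewrite (X_T HH) //; lia.
rewrite E_pos // !mulrA (T_Td_near HH) // -[Td j * _ * _]mulrA -(Xr r TX).
by rewrite -!mulrA T_Tu //; lia.
Qed.
Lemma T_E_up i r : (0 < r)%N -> T i * coset_rep i r = coset_rep i.+1 r.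
Proof. by move=> r0; rewrite !E_pos //= !mulrA. Qed.
Lemma T_E_dn i r : (i < n)%N -> (0 < r)%N ->
  T i * coset_rep i.+1 r = coset_rep i r + zt i i.+1 * coset_rep i.+1 r.
Proof.
move=> hi r0; rewrite -T_E_up // mulrA (T_quad HH) // mulrDl mul1r mulrA addrC.
by [].
Qed.
Lemma T_E_up0 i : (i < n)%N -> T i * coset_rep i.+1 0 = coset_rep i 0.
Proof.
move=> hi; rewrite /coset_rep /=.
by have -> : (n - i = (n - i.+1).+1)%N by [lia].
Qed.
Lemma T_E_dn0 i : (i < n)%N -> T i * coset_rep i 0 = coset_rep i.+1 0 + zt i i.+1 * coset_rep i 0.
Proof.
by move=> hi; rewrite -T_E_up0 // mulrA (T_quad HH) // mulrDl mul1r mulrA addrC.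
Qed.

Lemma X_E0 r : X * coset_rep 0 r = coset_rep 0 r.+1.
Proof. by rewrite !E_0 mulrA exprS. Qed.
Lemma X_Ej0 j : (0 < j)%N -> (j <= n)%N -> X * coset_rep j 0 = coset_rep j 0 * X.
Proof. by move=> j0 jn; rewrite /coset_rep /= X_Tu //; lia. Qed.
(** For coset 1 this is [typeB_comm] with P = X^r, multiplied on the right by T_1 ... T_{n-1}, which
    commutes with X. Each further T_{j+1} commutes with X, passes the representatives of coset 0 as
    T_j, and turns [zt 0 j.+1] into [zt 0 j.+2]. *)
Lemma X_Ejr j r : (j < n)%N -> (0 < r)%N ->
  X * coset_rep j.+1 r = coset_rep j.+1 r * X
    + zt 0 j.+1 * (coset_rep 0 1 * (Td j * X ^+ r) - coset_rep 0 r * (Td j * X)).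
Proof.
move=> jn r0; elim: j jn => [|j IH] jn.
  have [m hm] : exists m, n = m.+1 by exists n.-1; rewrite prednK.
  have XTu : X * Tu 1 m = Tu 1 m * X by rewrite X_Tu // hm.
  have PX : X ^+ r * X = X * X ^+ r by rewrite -exprS -exprSr.
  have Pz : X ^+ r * zt 0 1 = zt 0 1 * X ^+ r by apply: Xr; rewrite (X_tel HH).
  have PY : X ^+ r * (T 0 * X * T 0) = T 0 * X * T 0 * X ^+ r.
    by apply: Xr; rewrite !mulrA (X_typeB HH).
  have key := typeB_comm tr_sym b_basis bd_dual HH jn PY Pz.
  rewrite E_pos // !E_0 hm /= !mulr1 !mulrA key !mulrDl mulrBr mulrBl !mulrA expr1.
  rewrite -[_ * X * Tu 1 m]mulrA XTu.
  rewrite -[_ * X * T 0 * X ^+ r * Tu 1 m]mulrA (Xr r XTu).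
  rewrite -[zt 0 1 * X ^+ r * T 0 * X * Tu 1 m]mulrA XTu.
  by rewrite !mulr1 mulrBr !mulrA.
rewrite -T_E_up // mulrA (X_T HH) // -mulrA IH; last lia.
have h : T j.+1 * (coset_rep 0 1 * (Td j * X ^+ r) - coset_rep 0 r * (Td j * X))
    = coset_rep 0 1 * (Td j.+1 * X ^+ r) - coset_rep 0 r * (Td j.+1 * X).
  have t q : T j.+1 * coset_rep 0 q = coset_rep 0 q * T j by rewrite T_E_lt.
  move: (t 1%N) (t r); move: (coset_rep 0 1) (coset_rep 0 r) => e1 e2 t1 t2.
  by rewrite mulrBr /= !mulrA t1 t2.
rewrite mulrDr [T j.+1 * (zt _ _ * _)]mulrA (T_tel HH); try lia.
have -> : swp j.+1 0 = 0%N by [].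
have -> : swp j.+1 j.+1 = j.+2 by rewrite /swp eqxx.
by rewrite -[zt _ _ * _ * _]mulrA h mulrA.
Qed.
End Transversal.

Section Induction.
Variables (k : comNzRingType) (z : k) (A : superAlgType k).
Variables (B : finType) (b bd : B -> A) (d : nat) (c : 'I_d -> A).
Variable tr : A -> k.
Hypothesis tr_sym : symmetrizing tr.
Variable par : B -> bool.
Hypothesis b_basis : homogeneous_basis b par.
Hypothesis bd_dual : dual_basis tr b bd.
Hypothesis c_central : forall l, homog false (c l) /\ supercentral (c l).
Hypothesis d_gt0 : (0 < d)%N.
Variable u : A.
Hypothesis uc : u * c (Ordinal d_gt0) = 1.
Hypothesis cu : c (Ordinal d_gt0) * u = 1.

Section LiftGens.
Variables (S : superAlgType k) (n : nat).
Variables (al : nat -> A -> S) (T : nat -> S) (X : S).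
Hypothesis HH : hecke z b bd c n al T X.
Notation lift := (Hf_lift tr_sym b_basis bd_dual c_central uc cu HH).
Lemma Hf_lift_al i x : (i < n)%N -> lift (alH z b bd c n i x) = al i x.
Proof.
move=> ln; set o := Ordinal ln.
rewrite (alHE _ _ _ _ o x : alH _ _ _ _ _ i x = _) Hf_liftE.
exact: (apply_at HH o x).
Qed.
Lemma Hf_lift_T i : (i.+1 < n)%N -> lift (TH z b bd c n i) = T i.
Proof.
move=> ln; have hi : (i < n.-1)%N by case: (n) ln.
by rewrite (THE _ _ _ _ (Ordinal hi) : TH _ _ _ _ _ i = _) Hf_liftE.
Qed.
Lemma Hf_lift_X : (0 < n)%N -> lift (XH z b bd c n) = X.
Proof. by move=> n0; rewrite (XHE _ _ _ _ (i := Ordinal n0)) // Hf_liftE. Qed.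
End LiftGens.

Variable n : nat.
Notation H := (Hf z b bd c n).
Notation H' := (Hf z b bd c n.+1).
Notation al := (alH z b bd c n).
Notation T := (TH z b bd c n).
Notation X := (XH z b bd c n).
Notation al' := (alH z b bd c n.+1).
Notation T' := (TH z b bd c n.+1).
Notation X' := (XH z b bd c n.+1).
Notation phi := (incl z b bd c n).
Let HH : hecke z b bd c n al T X := Hf_hecke z b bd c n.
Let HH' : hecke z b bd c n.+1 al' T' X' := Hf_hecke z b bd c n.+1.
Let HA' := hecke_al HH'.
Variable M : superModType H.
Notation W := (wmod par n d M).
Notation e := (@wpure k A B bd d tr par H n M).
Notation aW := (aW b bd d tr_sym par n al M).
Notation TW := (TW z b bd d tr_sym par n al T M).
Notation XW := (XW z b bd c tr_sym par n al T X M).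
Notation E := (coset_rep n T' X').
Notation zt := (tel z b bd aW).
Notation zt' := (tel z b bd al').
Let HW : hecke z b bd c n.+1 aW TW XW :=
  W_hecke tr_sym b_basis bd_dual c_central d_gt0 HH M.

Let aWs := aW_same tr_sym b_basis bd_dual al (d := d) (n := n) (M := M).
Let aWh := aW_homog tr_sym b_basis bd_dual HH (M := M).
Let Tlt := TW_lt z tr_sym b_basis bd_dual al T (d := d) (n := n) (M := M).
Let Tgt := TW_gt z tr_sym b_basis bd_dual d_gt0 al T (d := d) (n := n) (M := M).
Let Tup := TW_up z tr_sym b_basis bd_dual d_gt0 al T (d := d) (n := n) (M := M).
Let Tup0 := TW_up0 z tr_sym b_basis bd_dual d_gt0 al T (d := d) (n := n) (M := M).
Let Tdn := TW_dn z tr_sym b_basis bd_dual d_gt0 al T (d := d) (n := n) (M := M).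
Let Tdn0 := TW_dn0 z tr_sym b_basis bd_dual d_gt0 al T (d := d) (n := n) (M := M).
Let X0 := XW_0 z c tr_sym b_basis bd_dual n al T X (M := M).
Let Xtop := XW_top z c tr_sym b_basis bd_dual n al T X (M := M).
Let Xj0 := XW_j0 z c tr_sym b_basis bd_dual d_gt0 al T X (n := n) (M := M).
Let Xjr := XW_jr z c tr_sym b_basis bd_dual al T X (n := n) (M := M).

Definition rho : superAlgHom H' (kend W) :=
  Hf_lift tr_sym b_basis bd_dual c_central uc cu HW.
Lemma rho_al i x : (i <= n)%N -> rho (al' i x) = aW i x.
Proof. by move=> ln; rewrite /rho Hf_lift_al. Qed.
Lemma rho_T i : (i < n)%N -> rho (T' i) = TW i.
Proof. by move=> ln; rewrite /rho Hf_lift_T. Qed.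
Lemma rho_X : rho X' = XW.
Proof. by rewrite /rho Hf_lift_X. Qed.

(** The trivial coset (n, 0) carries a copy of M as an H-module, which is what makes [Phi] well
    defined on the tensor product. *)
Lemma rho_incl h m : rho (phi h) (e n 0 1 m) = e n 0 1 (h *: m).
Proof.
move: h m; apply: (Hf_ind tr_sym b_basis bd_dual c_central uc cu).
- move=> s m; rewrite !sa_mapK kend_constE (eZ bd d tr par) //.
- by move=> x y hx hy m; rewrite !rmorphD kend_addE hx hy scalerDl eDr.
- by move=> x y hx hy m; rewrite !rmorphM kend_mulE hy hx scalerA.
- move=> i x ln m; rewrite incl_al // rho_al ?(ltnW ln) //.
  have ni : i <> n by lia.
  rewrite (aW_diff tr_sym b_basis bd_dual al) // (sgn_homog (@homog1 k A)).
  rewrite -eDr -scalerDl -(alD (hecke_al HH)) part_sum.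
  by rewrite /unb ltnNge (ltnW ln).
- move=> i ln m; rewrite incl_T // rho_T; last exact: ltnW.
  by rewrite Tgt.
- by move=> n0 m; rewrite incl_X // rho_X Xj0.
Qed.

Let gPhi (h : H') (m : M) : W := rho h (e n 0 1 m).
Let gPhiDl h h' m : gPhi (h + h') m = gPhi h m + gPhi h' m.
Proof. by rewrite /gPhi rmorphD. Qed.
Let gPhiDr h m m' : gPhi h (m + m') = gPhi h m + gPhi h m'.
Proof. by rewrite /gPhi eDr kendD. Qed.
Let gPhiB h r m : gPhi (h * phi r) m = gPhi h (r *: m).
Proof. by rewrite /gPhi rmorphM kend_mulE rho_incl. Qed.
Definition Phi : tensor phi M -> W := tlift gPhi.
Lemma Phi_pure h m : Phi (pure phi h m) = rho h (e n 0 1 m).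
Proof. exact: (tlift_pure gPhiDl gPhiDr gPhiB). Qed.
Lemma PhiD : {morph Phi : x y / x + y}.
Proof. exact: (tliftD gPhiDl gPhiDr gPhiB). Qed.

Definition Psi (w : W) : tensor phi M :=
  \sum_(y : 'I_n.+1 * 'I_d * B)
     pure phi (al' y.1.1 (b y.2) * E y.1.1 y.1.2) (w y).
Lemma PsiD : {morph Psi : v w / v + w}.
Proof.
by move=> v w; rewrite -big_split; apply: eq_bigr => y _; rewrite ffunE pureDr.
Qed.
Let pure0 h : pure phi h (0 : M) = 0.
Proof. by apply: (addIr (pure phi h 0)); rewrite -pureDr !add0r. Qed.
Let pureBl h h' (m : M) : pure phi (h - h') m = pure phi h m - pure phi h' m.
Proof. by apply: (addIr (pure phi h' m)); rewrite -pureDl !subrK. Qed.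
Lemma Psi0 : Psi 0 = 0.
Proof. by apply: (addIr (Psi 0)); rewrite -PsiD !add0r. Qed.
Lemma PsiN v : Psi (- v) = - Psi v.
Proof. by apply: (addIr (Psi v)); rewrite -PsiD !addNr Psi0. Qed.

Lemma Psi_e j r a m : (j <= n)%N -> (r < d)%N ->
  Psi (e j r a m) = pure phi (al' j a * E j r) m.
Proof.
rewrite -ltnS => jn rd; set j' := Ordinal jn; set r' := Ordinal rd.
transitivity (\sum_(x : 'I_n.+1 * 'I_d) \sum_(i : B)
    pure phi (al' x.1 (b i) * E x.1 x.2) (e j r a m (x, i))).
  by rewrite pair_bigA; apply: eq_bigr => -[].
rewrite (bigD1 (j', r')) //= [X in _ + X]big1 ?addr0; last first.
  move=> [y1 y2] y12; apply: big1 => i _; rewrite ffunE /=.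
  case: ifP => [/andP[/eqP e1 /eqP e2]|_]; last exact: pure0.
  by case/eqP: y12; congr (_, _); exact: val_inj.
rewrite {2}(bcoefE tr_sym b_basis bd_dual a) (al_sum HA') mulr_suml.
rewrite (big_morph (fun h => pure phi h m) (fun x y => pureDl phi x y m) (_ : _ = 0)); last first.
  by apply: (addIr (pure phi 0 m)); rewrite -pureDl !add0r.
apply: eq_bigr => i _; rewrite ffunE /= !eqxx /= -pure_balanced sa_mapK.
by rewrite -inKC mulrA -(alK HA' _ jn) -(alM HA').
Qed.

(** The factors of a representative, applied one by one to the trivial coset, run through cosets
    without ever meeting a correction term: T_{n-1}, ..., T_j lead to (j, 0); for r > 0 one descends
    to (0, 0), raises the power of X, and climbs to (j, r). *)
Lemma Phi_Psi w : Phi (Psi w) = w.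
Proof.
have Phi0 : Phi 0 = 0 by apply: (addIr (Phi 0)); rewrite -PhiD !add0r.
have h j r a m : (j <= n)%N -> (r < d)%N -> Phi (Psi (e j r a m)) = e j r a m.
  move=> jn rd; rewrite Psi_e // Phi_pure rmorphM kend_mulE rho_al //.
  suff -> : rho (E j r) (e n 0 1 m) = e j r 1 m by rewrite aWs // mulr1.
  have tu i : (i <= n)%N -> rho (Tu T' i (n - i)) (e n 0 1 m) = e i 0 1 m.
    move=> hi; have [l ll] : exists l, (l = n - i)%N by exists (n - i)%N.
    rewrite -ll; elim: l i hi ll => [|l IH] i hi ll.
      have -> : i = n by lia.
      by rewrite rmorph1.
    rewrite -[Tu T' i l.+1]/(T' i * Tu T' i.+1 l) rmorphM kend_mulE IH; try lia.
    by rewrite rho_T; [rewrite Tup0 //; lia|lia].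
  case: (posnP r) rd => [->|r0] rd; first by rewrite /coset_rep /= tu.
  have := tu 0%N (leq0n n); rewrite subn0 => tu0.
  rewrite E_pos // !rmorphM !kend_mulE tu0.
  rewrite rmorphXn rho_X.
  have Xr l : (l < d)%N -> (XW ^+ l) (e 0 0 1 m) = e 0 l 1 m.
    elim: l => [|l IH] ld; first by rewrite expr0.
    by rewrite exprS kend_mulE IH ?X0 // ltnW.
  rewrite Xr //; elim: j jn => [|j IH] jn; first by rewrite rmorph1.
  by rewrite -[Td T' j.+1]/(T' j * Td T' j) rmorphM kend_mulE IH ?rho_T ?Tup // ltnW.
rewrite [in RHS](w_dec bd_dual w) {1}(w_dec bd_dual w).
rewrite (big_morph Psi PsiD Psi0) (big_morph Phi PhiD Phi0).
by apply: eq_bigr => y _; apply: h => //; rewrite -ltnS.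
Qed.

Let add_ext (V : zmodType) (f g : W -> V) :
  {morph f : x y / x + y} -> {morph g : x y / x + y} ->
  (forall j r p a m, (j <= n)%N -> (r < d)%N -> homog p a ->
     f (e j r a m) = g (e j r a m)) -> f =1 g.
Proof.
move=> fD gD fg w.
have f0 : f 0 = 0 by apply: (addIr (f 0)); rewrite -fD !add0r.
have g0 : g 0 = 0 by apply: (addIr (g 0)); rewrite -gD !add0r.
rewrite (w_dec bd_dual w) (big_morph f fD f0) (big_morph g gD g0).
apply: eq_bigr => -[[j r] i] _ /=.
exact: fg (ltn_ord j) (ltn_ord r) (homog_b b_basis i).
Qed.

Lemma PsiK (s : k) w : Psi (s%:K *: w) = s%:K *: Psi w.
Proof.
move: w; apply: (add_ext (f := fun w => Psi (s%:K *: w))).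
- by move=> x y; rewrite scalerDr PsiD.
- by move=> x y; rewrite PsiD scalerDr.
move=> j r p a m jn rd _; rewrite -(eZ bd d tr par) !Psi_e // scale_pure.
by rewrite -pure_balanced sa_mapK inKC.
Qed.

Lemma Psi_aW i x w : (i <= n)%N -> Psi (aW i x w) = al' i x *: Psi w.
Proof.
move=> hi; suff h p y v : homog p y -> Psi (aW i y v) = al' i y *: Psi v.
  rewrite -[x]part_sum (alD (hecke_al HW)) (alD HA') kend_addE PsiD scalerDl.
  by rewrite !(h _ _ _ (homog_part _ _)).
move=> hy; move: v; apply: (add_ext (f := fun w => Psi (aW i y w))).
- by move=> v w'; rewrite kendD PsiD.
- by move=> v w'; rewrite PsiD scalerDr.
move=> j r q a m jn rd ha; rewrite Psi_e // scale_pure mulrA.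
case: (eqVneq i j) => [->|/eqP ij]; first by rewrite aWs // Psi_e // (alM HA').
rewrite (aWh _ jn rd ij hy ha) (al_comm HA' _ _ ij hy ha) //.
have -> : Psi ((-1) ^+ (p && q) *: e j r a (al (unb j i) y *: m))
    = (-1) ^+ (p && q) *: Psi (e j r a (al (unb j i) y *: m)).
  by rewrite !scaler_sign; case: (p && q); rewrite ?PsiN.
have un : (unb j i < n)%N by rewrite /unb; case: ifP; lia.
rewrite Psi_e // -pure_balanced incl_al //.
by rewrite scale_pure -[al' j a * _ * _]mulrA -(al_E HH' _ _ hi jn ij) !mulrA.
Qed.

Lemma Psi_zt i j w : (i <= n)%N -> (j <= n)%N -> Psi (zt i j w) = zt' i j *: Psi w.
Proof.
move=> hi hj; rewrite !telE kend_mulE kend_constE PsiK kend_sumE -scalerA.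
rewrite (big_morph Psi PsiD Psi0) scaler_suml; congr (_ *: _).
by apply: eq_bigr => f _; rewrite kend_mulE !Psi_aW // scalerA.
Qed.

Lemma Psi_TW i w : (i < n)%N -> Psi (TW i w) = T' i *: Psi w.
Proof.
move=> hi; move: w; apply: (add_ext (f := fun w => Psi (TW i w))).
- by move=> v w'; rewrite kendD PsiD.
- by move=> v w'; rewrite PsiD scalerDr.
move=> j r q a m jn rd ha; rewrite Psi_e // scale_pure mulrA (T_al HH') //.
case: (ltnP j i) => ji.
  have -> : swp i j = j by rewrite /swp; do !case: ifP; lia.
  rewrite Tlt // Psi_e // -pure_balanced incl_T; last lia.
  by rewrite -!mulrA (T_E_lt HH').
case: (ltnP i.+1 j) => ij.
  have -> : swp i j = j by rewrite /swp; do !case: ifP; lia.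
  rewrite Tgt // Psi_e // -pure_balanced incl_T; last lia.
  by rewrite -!mulrA (T_E_gt HH').
have za : al' i.+1 a * zt' i i.+1 = zt' i i.+1 * al' i a.
  by rewrite (al_tel_r z tr_sym b_basis bd_dual HA') //; lia.
have za' : al' i a * zt' i i.+1 = zt' i i.+1 * al' i.+1 a.
  by rewrite (al_tel_l z tr_sym b_basis bd_dual HA') //; lia.
have s1 : swp i i = i.+1 by rewrite /swp eqxx.
have s2 : swp i i.+1 = i by rewrite /swp eqxx ifF //; lia.
case: (eqVneq j i) => [->|ne].
  rewrite s1; case: (posnP r) rd => [->|r0] rd.
    rewrite Tdn0 // PsiD Psi_zt // ?(ltnW hi) // !Psi_e // ?(ltnW hi) // scale_pure.
    rewrite -mulrA (T_E_dn0 HH') // mulrDr pureDl !mulrA za //.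
  by rewrite Tup // Psi_e // -mulrA T_E_up.
have -> : j = i.+1 by lia.
rewrite s2; case: (posnP r) rd => [->|r0] rd.
  by rewrite Tup0 // Psi_e ?(ltnW hi) // -mulrA T_E_up0.
rewrite Tdn // PsiD Psi_zt ?(ltnW hi) // !Psi_e ?(ltnW hi) // scale_pure.
by rewrite -mulrA (T_E_dn HH') // mulrDr pureDl !mulrA za'.
Qed.

Lemma phi_Td j : (j < n)%N -> phi (Td T j) = Td T' j.
Proof.
elim: j => [|j IH] jn; first by rewrite rmorph1.
by rewrite -[Td T j.+1]/(T j * Td T j) rmorphM IH ?incl_T // ltnW.
Qed.

Let pure0l (m : M) : pure phi 0 m = 0.
Proof. by apply: (addIr (pure phi 0 m)); rewrite -pureDl !add0r. Qed.

Lemma Psi_XW w : Psi (XW w) = X' *: Psi w.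
Proof.
move: w; apply: (add_ext (f := fun w => Psi (XW w))).
- by move=> v w'; rewrite kendD PsiD.
- by move=> v w'; rewrite PsiD scalerDr.
move=> j r q a m jn rd ha; rewrite Psi_e // scale_pure mulrA (X_al HH') //.
case: j jn => [|j] jn.
  rewrite -mulrA X_E0; case: (ltnP r.+1 d) => rd'.
    by rewrite X0 // Psi_e.
  have hr : r.+1 = d by lia.
  rewrite Xtop // PsiN (big_morph Psi PsiD Psi0) hr.
  have Xd : X' ^+ d = - \sum_(l < d) al' 0 (c l) * X' ^+ l.
    by have /eqP := X_f HH' (ltn0Sn n); rewrite addr_eq0 => /eqP.
  have pN h : pure phi (- h) m = - pure phi h m.
    by apply: (addIr (pure phi h m)); rewrite -pureDl !addNr pure0l.
  rewrite E_0 Xd mulNr mulrN pN mulr_suml mulr_sumr; congr (- _).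
  rewrite (big_morph (fun h => pure phi h m) (fun x y => pureDl phi x y m) (pure0l m)).
  apply: eq_bigr => l _; rewrite Psi_e // (even_central a (c_central l)).
  by rewrite (alM HA') E_0 !mulrA.
have n0 : (0 < n)%N by lia.
case: (posnP r) rd => [->|r0] rd.
  by rewrite Xj0 // Psi_e // -pure_balanced incl_X // -!mulrA (X_Ej0 HH').
have rd1 : (1 < d)%N by lia.
have za : al' j.+1 a * zt' 0 j.+1 = zt' 0 j.+1 * al' 0 a.
  by rewrite (al_tel_r z tr_sym b_basis bd_dual HA') //; lia.
rewrite Xjr // PsiD Psi_zt // PsiD PsiN !Psi_e // -!pure_balanced.
rewrite !rmorphM !rmorphXn !phi_Td // incl_X // -pureBl scale_pure -pureDl.
congr (pure phi _ m); rewrite -[RHS]mulrA.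
rewrite (X_Ejr tr_sym b_basis bd_dual HH') //.
move: (E 0 1) (E 0 r) (E j.+1 r) za => e1 er ej; move: (zt' _ _) => zz za.
by rewrite [RHS]mulrDr [_ * (zz * _)]mulrA za !mulrBr !mulrA.
Qed.

(** The operators were modelled on the products of generators with coset representatives, so
    linearity over the larger algebra is checked generator by generator. *)
Lemma Psi_rho h w : Psi (rho h w) = h *: Psi w.
Proof.
move: h w; apply: (Hf_ind tr_sym b_basis bd_dual c_central uc cu).
- by move=> s w; rewrite sa_mapK kend_constE PsiK.
- by move=> x y hx hy w; rewrite rmorphD kend_addE PsiD hx hy scalerDl.
- by move=> x y hx hy w; rewrite rmorphM kend_mulE hx hy scalerA.
- by move=> i x hi w; rewrite rho_al // Psi_aW.
- by move=> i hi w; rewrite rho_T // Psi_TW.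
- by move=> _ w; rewrite rho_X Psi_XW.
Qed.

(** By linearity of [Psi] it is enough to look at the trivial coset, whose representative is 1. *)
Lemma Psi_Phi x : Psi (Phi x) = x.
Proof.
move: x; apply: (tens_ext (u := fun x => Psi (Phi x)) (v := id)) => // [x y|h m].
  by rewrite PhiD PsiD.
rewrite Phi_pure Psi_rho Psi_e // E_last (al1 HA') // scale_pure.
by rewrite !mulr1.
Qed.
End Induction.

(** * Changing the basis of the last position *)

Lemma unipotent_inverse (R : pzRingType) (x : R) l : x ^+ l = 0 ->
  exists y, (1 + x) * y = 1 /\ y * (1 + x) = 1.
Proof.
move=> x0; exists (\sum_(i < l) (- x) ^+ i).
have h : (1 + x) * (\sum_(i < l) (- x) ^+ i) = 1.
  by apply: oppr_inj; rewrite -mulNr opprD addrC -subrX1 exprNn x0 mulr0 add0r.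
split=> //; rewrite -[RHS]h; apply: commr_sym; apply: commr_sum => i _.
apply: commrX; apply: commrN; apply: commr_sym; apply: commrD => //.
exact: commr1.
Qed.

Section Triangular.
Variables (k : comNzRingType) (z : k) (A : superAlgType k).
Variables (B : finType) (b bd : B -> A) (d : nat) (c : 'I_d -> A).
Variable tr : A -> k.
Hypothesis tr_sym : symmetrizing tr.
Variable par : B -> bool.
Hypothesis b_basis : homogeneous_basis b par.
Hypothesis bd_dual : dual_basis tr b bd.
Hypothesis c_central : forall l, homog false (c l) /\ supercentral (c l).
Hypothesis d_gt0 : (0 < d)%N.
Variables (H : superAlgType k) (n : nat).
Variables (al : nat -> A -> H) (T : nat -> H) (X : H).
Hypothesis HH : hecke z b bd c n al T X.
Variable M : superModType H.
Notation W := (wmod par n d M).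
Notation e := (@wpure k A B bd d tr par H n M).
Notation aW := (aW b bd d tr_sym par n al M).
Notation TW := (TW z b bd d tr_sym par n al T M).
Notation XW := (XW z b bd c tr_sym par n al T X M).
Notation zt := (tel z b bd aW).
Let HW : hecke z b bd c n.+1 aW TW XW :=
  W_hecke tr_sym b_basis bd_dual c_central d_gt0 HH M.

Let aWs := aW_same tr_sym b_basis bd_dual al (d := d) (n := n) (M := M).
Let aWh := aW_homog tr_sym b_basis bd_dual HH (M := M).
Let Tlt := TW_lt z tr_sym b_basis bd_dual al T (d := d) (n := n) (M := M).
Let Tgt := TW_gt z tr_sym b_basis bd_dual d_gt0 al T (d := d) (n := n) (M := M).
Let Tin := TW_in z tr_sym b_basis bd_dual d_gt0 al T (d := d) (n := n) (M := M).
Let Tup := TW_up z tr_sym b_basis bd_dual d_gt0 al T (d := d) (n := n) (M := M).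
Let Tup0 := TW_up0 z tr_sym b_basis bd_dual d_gt0 al T (d := d) (n := n) (M := M).
Let Tdn0 := TW_dn0 z tr_sym b_basis bd_dual d_gt0 al T (d := d) (n := n) (M := M).
Let X0 := XW_0 z c tr_sym b_basis bd_dual n al T X (M := M).
Let Xtop := XW_top z c tr_sym b_basis bd_dual n al T X (M := M).
Let Xj0 := XW_j0 z c tr_sym b_basis bd_dual d_gt0 al T X (n := n) (M := M).
Let Xjr := XW_jr z c tr_sym b_basis bd_dual al T X (n := n) (M := M).
Notation XsW := (Xs TW XW).

(* The order on coordinates for which the action of the X_q is triangular. *)
Definition before (q r j s : nat) : bool := (j < q)%N || ((j == q) && (s < r)%N).

Definition below (q r : nat) (w : W) : Prop :=
  forall y : 'I_n.+1 * 'I_d * B, ~~ before q r y.1.1 y.1.2 -> w y = 0.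

Lemma below0 q r : below q r 0.
Proof. by move=> y _; rewrite ffunE. Qed.
Lemma belowD q r v w : below q r v -> below q r w -> below q r (v + w).
Proof. by move=> hv hw y hy; rewrite ffunE hv // hw // addr0. Qed.
Lemma belowN q r v : below q r v -> below q r (- v).
Proof. by move=> hv y hy; rewrite ffunE hv // oppr0. Qed.
Lemma belowZ q r (h : H) v : below q r v -> below q r (h *: v).
Proof. by move=> hv y hy; rewrite ffunE hv // scaler0. Qed.
Lemma below_sum q r I (s : seq I) (F : I -> W) :
  (forall i, below q r (F i)) -> below q r (\sum_(i <- s) F i).
Proof.
move=> h; elim: s => [|i s IH]; first by rewrite big_nil; exact: below0.
by rewrite big_cons; exact: belowD.
Qed.
Lemma below_e q r j s a m : before q r j s -> below q r (e j s a m).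
Proof.
move=> h y; rewrite ffunE; case: ifP => // /andP[/eqP -> /eqP ->].
by rewrite h.
Qed.
Lemma below_le q r r' w : (r <= r')%N -> below q r w -> below q r' w.
Proof.
move=> rr h y hy; apply: (h); apply: contra hy; rewrite /before.
by case/orP=> [->//|/andP[-> l]]; rewrite (leq_trans l rr) orbT.
Qed.

Lemma below_kend q r q' r' (f : kend W) w :
  (forall j s p a m, (j <= n)%N -> (s < d)%N -> homog p a -> before q r j s ->
     below q' r' (f (e j s a m))) ->
  below q r w -> below q' r' (f w).
Proof.
move=> h hw; rewrite [w](w_dec bd_dual) kend_sum; apply: below_sum => -[[j s] i].
case: (boolP (before q r j s)) => bj.
  exact: h (ltn_ord j) (ltn_ord s) (homog_b b_basis i) bj.
by rewrite hw // e0r kend0; exact: below0.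
Qed.

Lemma below_aW i x q r w : (i <= n)%N -> below q r w -> below q r (aW i x w).
Proof.
move=> hi hw.
suff h p y : homog p y -> below q r (aW i y w).
  rewrite -[x]part_sum (alD (hecke_al HW)) kend_addE.
  by apply: belowD; apply: (h) (homog_part _ _).
move=> hy; apply: below_kend hw => j s p' a m jn sd ha bj.
case: (eqVneq i j) => [->|/eqP ij]; first by rewrite aWs //; exact: below_e.
rewrite (aWh _ jn sd ij hy ha) scaler_sign.
by case: ifP => _; [apply: belowN|]; exact: below_e.
Qed.

Lemma below_zt i j q r w : (i <= n)%N -> (j <= n)%N ->
  below q r w -> below q r (zt i j w).
Proof.
move=> hi hj hw; rewrite telE kend_mulE kend_constE kend_sumE.
by apply: belowZ; apply: below_sum => f; rewrite kend_mulE; do !apply: below_aW.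
Qed.

(** T_i only mixes the cosets i and i + 1, both of which come before q. *)
Lemma below_TW i q r w : (i.+1 < q)%N -> (i < n)%N ->
  below q r w -> below q r (TW i w).
Proof.
move=> iq ni; apply: below_kend => j s p a m jn sd ha bj.
case: (ltnP j i) => ji; first by rewrite Tlt //; exact: below_e.
case: (ltnP i.+1 j) => ij; first by rewrite Tgt //; exact: below_e.
rewrite Tin //; last lia.
apply: belowD; first by apply: below_e; rewrite /before /swp; do !case: ifP; lia.
by case: ifP => _; [apply: below_zt; [lia|lia|exact: below_e]|exact: below0].
Qed.

Lemma below_TW_up q r w : (q < n)%N -> below q r w -> below q.+1 r (TW q w).
Proof.
move=> qn; apply: below_kend => j s p a m jn sd ha bj.
have bj' : before q.+1 r j s by move: bj; rewrite /before; lia.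
case: (ltnP j q) => jq; first by rewrite Tlt //; exact: below_e.
have jq' : j = q by move: bj; rewrite /before; lia.
rewrite Tin // ?jq' ?eqxx //; apply: belowD.
  apply: below_e; move: bj; rewrite /before /swp jq' eqxx; lia.
rewrite jq' in bj'.
by case: ifP => _; [apply: below_zt; [lia|lia|exact: below_e]|exact: below0].
Qed.

(** Apart from the coset it acts on, X only produces terms on cosets (0, l), which come before (q,
    r) as q > 0. *)
Lemma below_XW q r w : (0 < q)%N -> below q r w -> below q r (XW w).
Proof.
move=> q0; apply: below_kend => -[|j] s p a m jn sd ha bj.
  have b0 l : before q r 0 l by rewrite /before q0.
  case: (ltnP s.+1 d) => sd'; first by rewrite X0 //; exact: below_e.
  rewrite Xtop; last lia.
  by apply: belowN; apply: below_sum => l; exact: below_e.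
case: (posnP s) sd bj => [->|s0] sd bj; first by rewrite Xj0 //; exact: below_e.
have b0 l : before q r 0 l by rewrite /before q0.
rewrite Xjr //; apply: belowD; first exact: below_e.
apply: below_zt => //; apply: belowD; first exact: below_e.
by apply: belowN; exact: below_e.
Qed.

Lemma XsW_e0 i j a m : (i < j)%N -> (j <= n)%N ->
  XsW i (e j 0 a m) = e j 0 a (Xs T X i *: m).
Proof.
elim: i m => [|i IH] m ij jn; first by rewrite Xj0.
change (XsW i.+1) with (TW i * XsW i * TW i).
rewrite !kend_mulE Tgt // IH //; last exact: ltnW.
by rewrite Tgt // !scalerA.
Qed.

Lemma XsW_e1 q a m : (1 < d)%N -> (q <= n)%N -> XsW q (e q 0 a m) = e q 1 a m.
Proof.
move=> d1; elim: q => [|q IH] qn; first by rewrite X0.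
change (XsW q.+1) with (TW q * XsW q * TW q).
by rewrite !kend_mulE Tup0 // IH ?Tup // ltnW.
Qed.

(** From X_{q+1} T_q = T_q X_q T_q^2 by the quadratic relation, the teleporter commuting with X_q
    and T_q. *)
Lemma TXs_e q s a m : (1 < d)%N -> (q < n)%N -> (s < d)%N ->
  XsW q.+1 (TW q (e q s a m))
    = TW q (XsW q (e q s a m)) + zt q q.+1 (XsW q.+1 (e q s a m)).
Proof.
move=> d1 qn sd.
have Xz : XsW q * zt q q.+1 = zt q q.+1 * XsW q.
  by apply: conj_tel => x; rewrite (Xs_al HW) //; lia.
have Tz : TW q * zt q q.+1 = zt q q.+1 * TW q.
  by apply: (T_tel_same tr_sym b_basis bd_dual HW); lia.
have TT : TW q * TW q = zt q q.+1 * TW q + 1 by rewrite (T_quad HW).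
have : XsW q.+1 * TW q = TW q * XsW q + zt q q.+1 * XsW q.+1.
  change (XsW q.+1) with (TW q * XsW q * TW q).
  rewrite -[LHS]mulrA TT mulrDr mulr1 addrC; congr (_ + _).
  by rewrite !mulrA -[_ * XsW q * zt _ _]mulrA Xz mulrA Tz.
by move/(congr1 (fun f : kend W => f (e q s a m))); rewrite kend_addE !kend_mulE.
Qed.

(** X_{q+1} commutes with X and with the T_i for i < q, and these preserve the span of the cosets
    before (q + 1, 2). All (j, s) with j at most q are reached by them from (q, 0), the only coset
    that needs a computation. *)
Lemma below_Xs q j s a m : (1 < d)%N -> (q < n)%N -> (j <= q)%N -> (s < d)%N ->
  below q.+1 2 (XsW q.+1 (e j s a m)).
Proof.
move=> d1 qn; set Q := fun w => below q.+1 2 (XsW q.+1 w).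
have QT i w : (i < q)%N -> Q w -> Q (TW i w).
  move=> iq hw; rewrite /Q -kend_mulE -(T_Xs_gt d_gt0 HW) // kend_mulE.
  by apply: below_TW => //; lia.
have QX w : Q w -> Q (XW w).
  move=> hw; rewrite /Q -kend_mulE -(X_Xs HW) // kend_mulE.
  exact: below_XW.
have Q0 : Q (e q 0 a m).
  rewrite /Q; change (XsW q.+1) with (TW q * XsW q * TW q).
  rewrite !kend_mulE Tdn0 // !kendD XsW_e0 // Tup0 //; apply: belowD.
    by apply: below_e; rewrite /before ltnSn.
  have Xz : XsW q * zt q q.+1 = zt q q.+1 * XsW q.
    by apply: conj_tel => x; rewrite (Xs_al HW) //; lia.
  rewrite -[XsW q _]kend_mulE Xz kend_mulE XsW_e1 //; last exact: ltnW.
  rewrite -[TW q _]kend_mulE (T_tel_same tr_sym b_basis bd_dual HW) // kend_mulE Tup //.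
  by apply: below_zt; [lia|lia|apply: below_e; rewrite /before eqxx orbT].
have Qj0 l : (l <= q)%N -> Q (e (q - l) 0 a m).
  elim: l => [|l IH] lq; first by rewrite subn0.
  have e1 : (q - l = (q - l.+1).+1)%N by lia.
  have := IH (ltnW lq); rewrite e1 => h.
  by rewrite -Tup0; [apply: QT h; lia|lia].
move=> jq; case: (posnP s) => [-> _|s0 sd].
  by have := Qj0 (q - j)%N (leq_subr _ _); rewrite subKn.
have Qs l : (l < d)%N -> Q (e 0 l a m).
  elim: l => [|l IH] ld; first by have := Qj0 q (leqnn q); rewrite subnn.
  by rewrite -X0 //; apply: QX; apply: IH; exact: ltnW.
elim: j jq => [|j IH] jq; first exact: Qs.
by rewrite -Tup //; [apply: QT => //; apply: IH; exact: ltnW|lia].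
Qed.

(** Induction on q by [TXs_e]. Its second term lies before (q + 1, 2) by [below_Xs], hence before (q
    + 1, r + 1) because r > 0. *)
Lemma Xs_leading q r a m : (q <= n)%N -> (0 < r)%N -> (r.+1 < d)%N ->
  below q r.+1 (XsW q (e q r a m) - e q r.+1 a m).
Proof.
move=> qn r0 rd; elim: q qn => [|q IH] qn.
  by rewrite X0 // subrr; exact: below0.
have d1 : (1 < d)%N by lia.
rewrite -{1}Tup //; last exact: ltnW.
rewrite TXs_e //; last exact: ltnW.
rewrite addrAC; apply: belowD; last first.
  apply: below_zt => //; first exact: ltnW.
  apply: (@below_le _ 2) => //; apply: below_Xs => //; exact: ltnW.
by rewrite -Tup // -kendB; apply: below_TW_up => //; apply: IH; exact: ltnW.
Qed.

(** Cosets with j < n are sent before (n, 2), which is early enough as r > 0; on the cosets (n, s),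
    X_n raises s by one up to earlier terms. *)
Lemma below_Xs_last r w : (0 < r)%N -> (r < d)%N -> below n r w ->
  below n r.+1 (XsW n w).
Proof.
move=> r0 rd; apply: below_kend => j s p a m jn sd ha bj.
have d1 : (1 < d)%N by lia.
case: (ltnP j n) => jn'.
  have [q nq] : exists q, n = q.+1 by exists n.-1; rewrite prednK //; lia.
  have -> : below n r.+1 = below q.+1 r.+1 by rewrite -nq.
  have -> : XsW n = XsW q.+1 by rewrite -nq.
  apply: (@below_le _ 2) => //; apply: below_Xs => //; lia.
have jE : j = n by lia.
have sr : (s < r)%N by move: bj; rewrite /before jE ltnn eqxx.
rewrite jE; case: (posnP s) sd => [->|s0] sd.
  by rewrite XsW_e1 //; apply: below_e; rewrite /before eqxx /= ltnS r0 orbT.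
rewrite -[XsW n _](subrK (e n s.+1 a m)); apply: belowD.
  by apply: (@below_le _ s.+1); [lia|apply: Xs_leading => //; lia].
by apply: below_e; rewrite /before eqxx /= ltnS sr orbT.
Qed.

Lemma Xs_exp_leading r a m : (r < d)%N ->
  below n r ((XsW n ^+ r) (e n 0 a m) - e n r a m).
Proof.
elim: r => [|r IH] rd; first by rewrite expr0 subrr; exact: below0.
have d1 : (1 < d)%N by lia.
case: (posnP r) rd IH => [->|r0] rd IH.
  by rewrite expr1 XsW_e1 // subrr; exact: below0.
rewrite exprS kend_mulE.
have := below_Xs_last r0 (ltnW rd) (IH (ltnW rd)); rewrite kendB => h.
rewrite -(subrK (XsW n (e n r a m)) (XsW n _)) -addrA.
by apply: belowD => //; exact: Xs_leading.
Qed.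

Let GF_good (j r : nat) :
  good (fun a m => if j == n then (XsW n ^+ r) (e n 0 a m) else e j r a m).
Proof.
case: eqP => _; last exact: good_e1.
by apply: good_kend; exact: good_e1.
Qed.

(** G - 1 lowers the filtration by the cosets (n, r) by one step and vanishes on the cosets with j <
    n, so that G is unipotent. *)
Lemma last_position_change : exists G G' : kend W,
  [/\ G * G' = 1, G' * G = 1 &
   forall j r a m, (j <= n)%N -> (r < d)%N ->
     G (e j r a m) = if j == n then (XsW n ^+ r) (e n 0 a m) else e j r a m].
Proof.
pose G := op b GF_good.
have GE j r a m : (j <= n)%N -> (r < d)%N ->
    G (e j r a m) = if j == n then (XsW n ^+ r) (e n 0 a m) else e j r a m.
  by move=> jn rd; rewrite /G (opE tr_sym b_basis bd_dual).
pose D := G - 1.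
have DS r w : below n r.+1 w -> below n r (D w).
  apply: below_kend => j s p a m jn sd ha bj.
  rewrite /D kend_addE kend_oppE kend_oneE GE //.
  case: eqP => [jE|_]; last by rewrite subrr; exact: below0.
  rewrite jE; apply: (@below_le _ s); last exact: Xs_exp_leading.
  by move: bj; rewrite /before jE ltnn eqxx.
have D0 w : below n 0 w -> D w = 0.
  move=> hw; rewrite [w](w_dec bd_dual) kend_sum; apply: big1 => -[[j s] i] _.
  case: (boolP (before n 0 j s)) => bj; last by rewrite hw // e0r kend0.
  have jn : (j < n)%N by move: bj; rewrite /before andbF orbF.
  rewrite /D kend_addE kend_oppE kend_oneE GE //; last exact: ltnW.
  by rewrite ltn_eqF // subrr.
have Dl l w : (l <= d)%N -> below n (d - l) ((D ^+ l) w).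
  elim: l => [|l IH] ld.
    rewrite subn0 => y /negP[]; rewrite /before ltn_ord andbT.
    by have := ltn_ord y.1.1; rewrite ltnS leq_eqVlt orbC.
  rewrite exprS kend_mulE; apply: DS.
  have -> : ((d - l.+1).+1 = d - l)%N by lia.
  by apply: IH; exact: ltnW.
(* After d steps only cosets with j < n remain; one further application kills them. *)
have : D ^+ d.+1 = 0.
  apply: kend_ext => w; rewrite exprS kend_mulE; apply: D0.
  by have := Dl d w (leqnn d); rewrite subnn.
case/unipotent_inverse => G'; rewrite /D addrC subrK => -[e1 e2].
by exists G, G'.
Qed.
End Triangular.

(** * The Mackey decomposition *)

(** On homogeneous x this is the sign (-1)^{p|x|}; p will be the parity of a basis element that x
    has to pass. *)
Definition twist (V : superZmodType) (p : bool) (x : V) : V :=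
  if p then part false x - part true x else x.
Arguments twist : simpl never.

Section Twist.
Variables (V : superZmodType).
Implicit Types x y : V.
Lemma twistD p : {morph @twist V p : x y / x + y}.
Proof. by case: p => x y //; rewrite /twist !partD opprD addrACA. Qed.
Lemma twist_part p q x : part q (twist p x) = twist p (part q x).
Proof.
case: p => //; rewrite /twist partD partN !part_part.
by case: q => /=; rewrite ?subr0 ?sub0r.
Qed.
Lemma twist_twist p x : twist p (twist p x) = x.
Proof.
case: p => //; rewrite {1}/twist !twist_part /twist !part_part /= subr0 sub0r opprK.
exact: part_sum.
Qed.
Lemma twist_homog p q x : homog q x -> twist p x = if p && q then - x else x.
Proof.
case: p => // hx; rewrite /twist; case: q hx => hx; rewrite hx (homog_neq hx) //.
  by rewrite sub0r.
by rewrite subr0.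
Qed.
End Twist.

Lemma twist_scale k (H : superAlgType k) (M : superModType H) p (h : H) (m : M) :
  twist p (h *: m) = twist p h *: twist p m.
Proof.
case: p => //; rewrite /twist !part_scale /= scalerBl !scalerBr; zmod.
Qed.
Lemma twistM k (S : superAlgType k) p (x y : S) :
  twist p (x * y) = twist p x * twist p y.
Proof.
case: p => //; rewrite /twist !partM /= mulrBl !mulrBr; zmod.
Qed.
Lemma twist_modhom k (H : superAlgType k) (M N : superModType H)
  (f : superModHom M N) p m : f (twist p m) = twist p (f m).
Proof. by case: p => //; rewrite /twist linearB !sm_map_part. Qed.

Section Mackey.
Variables (k : comNzRingType) (z : k) (A : superAlgType k).
Variables (B : finType) (b bd : B -> A) (d : nat) (c : 'I_d -> A).
Variable tr : A -> k.
Hypothesis tr_sym : symmetrizing tr.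
Variable par : B -> bool.
Hypothesis b_basis : homogeneous_basis b par.
Hypothesis bd_dual : dual_basis tr b bd.
Hypothesis c_central : forall l, homog false (c l) /\ supercentral (c l).
Hypothesis d_gt0 : (0 < d)%N.
Variable u : A.
Hypothesis uc : u * c (Ordinal d_gt0) = 1.
Hypothesis cu : c (Ordinal d_gt0) * u = 1.
Variable n : nat.
Notation H := (Hf z b bd c n.+1).
Notation K := (Hf z b bd c n.+2).
Notation al := (alH z b bd c n.+1).
Notation T := (TH z b bd c n.+1).
Notation X := (XH z b bd c n.+1).
Notation al' := (alH z b bd c n.+2).
Notation T' := (TH z b bd c n.+2).
Notation X' := (XH z b bd c n.+2).
Notation phi0 := (incl z b bd c n).
Notation phi := (incl z b bd c n.+1).
Let HH : hecke z b bd c n.+1 al T X := Hf_hecke z b bd c n.+1.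
Let HH' : hecke z b bd c n.+2 al' T' X' := Hf_hecke z b bd c n.+2.
Let HA' := hecke_al HH'.
Let hind n := @Hf_ind k z A B b bd d c tr tr_sym par b_basis bd_dual c_central
  d_gt0 u uc cu n.

(* Supercommutes with the algebra on n + 1 strands, by [topel_comm]. *)
Definition topel (y : 'I_d * B) : K :=
  Xs T' X' n.+1 ^+ y.1 * al' n.+1 (b y.2).

Lemma homog_topel y : homog (par y.2) (topel y).
Proof.
rewrite -[par _]addFb; apply: homog_mul.
  by apply: homog_exp; apply: (Xs_even HH').
by apply: (al_homog HA'); exact: homog_b b_basis _.
Qed.

Lemma al_twist p i x : twist p (al i x) = al i (twist p x).
Proof.
case: p => //; rewrite /twist -!(al_part (hecke_al HH)).
have alN y : al i (- y) = - al i y.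
  by apply: (addIr (al i y)); rewrite -(alD (hecke_al HH)) !addNr (al0 (hecke_al HH)).
by rewrite (alD (hecke_al HH)) alN.
Qed.

Lemma al_swap i j p x y : (i < n.+2)%N -> (j < n.+2)%N -> i <> j -> homog p y ->
  al' i x * al' j y = al' j y * al' i (twist p x).
Proof.
move=> hi hj ij hy; rewrite -[x]part_sum twistD !(alD HA') mulrDl mulrDr.
have h q : al' i (part q x) * al' j y = al' j y * al' i (twist p (part q x)).
  have hq := homog_part q x.
  rewrite (twist_homog p hq) (al_comm HA' hi hj ij hq hy) mulr_sign andbC.
  case: ifP => // _.
  have -> : al' i (- part q x) = - al' i (part q x).
    by apply: (addIr (al' i (part q x))); rewrite -(alD HA') !addNr (al0 HA').
  by rewrite mulrN.
by rewrite !h.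
Qed.

(** Both sides are compatible with sums and products in h, so generators suffice. All of them
    commute with [Xs T' X' n.+1], and only elements of A can meet a sign at the last position. *)
Lemma topel_comm h y : phi h * topel y = topel y * phi (twist (par y.2) h).
Proof.
have Xr (g : K) : g * Xs T' X' n.+1 = Xs T' X' n.+1 * g ->
    g * Xs T' X' n.+1 ^+ y.1 = Xs T' X' n.+1 ^+ y.1 * g.
  by move=> e; apply: commrX.
have tw_even (x : H) : homog false x -> twist (par y.2) x = x.
  by move=> hx; rewrite (twist_homog _ hx) andbF.
move: h; apply: (hind (n := n.+1)).
- by move=> s; rewrite (tw_even _ (homogK _)) sa_mapK inKC.
- by move=> v w hv hw; rewrite twistD !rmorphD mulrDl mulrDr hv hw.
- move=> v w hv hw; rewrite twistM !rmorphM.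
  by rewrite -mulrA hw mulrA hv !mulrA.
- move=> i x hi; rewrite al_twist !incl_al //.
  rewrite /topel mulrA Xr; last by rewrite (Xs_al HH') //; lia.
  rewrite -mulrA (al_swap _ _ _ _ (homog_b b_basis y.2)) ?mulrA //; lia.
- move=> i hi; rewrite (tw_even _ (T_even HH hi)) incl_T //.
  rewrite /topel mulrA Xr; last by rewrite (T_Xs_gt d_gt0 HH') //; lia.
  rewrite -!mulrA (T_al HH') //; last lia.
  by have -> : swp i n.+1 = n.+1 by rewrite /swp; do !case: ifP; lia.
- move=> _; rewrite (tw_even _ (X_even HH)) incl_X //.
  rewrite /topel mulrA Xr; last by rewrite (X_Xs HH') //; lia.
  by rewrite -!mulrA (X_al HH').
Qed.

(** The generators on n strands only involve positions below n. This makes the map h ⊗ m ↦ h T_n ⊗ m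
    balanced. *)
Lemma T_incl2 r : phi (phi0 r) * T' n = T' n * phi (phi0 r).
Proof.
move: r; apply: (hind (n := n)).
- by move=> s; rewrite !sa_mapK inKC.
- by move=> v w hv hw; rewrite !rmorphD mulrDl mulrDr hv hw.
- by move=> v w hv hw; rewrite !rmorphM -mulrA hw mulrA hv mulrA.
- move=> i x hi; rewrite incl_al // incl_al; last lia.
  rewrite (T_al HH') //; last lia.
  by have -> : swp n i = i by rewrite /swp; do !case: ifP; lia.
- move=> i hi; rewrite incl_T // incl_T; last lia.
  by rewrite (T_far HH').
- by move=> n0; rewrite !incl_X // (X_T HH').
Qed.

(** Both kinds of representatives end in the string of T's up to T_{n-1}, which T_n prolongs by
    one. *)
Lemma phi_E j r : (j <= n)%N -> phi (coset_rep n T X j r) * T' n = coset_rep n.+1 T' X' j r.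
Proof.
move=> jn.
have tu m i : (i + m = n)%N -> phi (Tu T i m) * T' n = Tu T' i m.+1.
  elim: m i => [|m IH] i im.
    by have -> : i = n by [lia]; rewrite rmorph1 mul1r /= mulr1.
  rewrite -[Tu T i m.+1]/(T i * Tu T i.+1 m) rmorphM incl_T; last lia.
  by rewrite -mulrA IH //; lia.
case: (posnP r) => [->|r0].
  by rewrite /coset_rep /= tu; [rewrite subSn|lia].
rewrite !E_pos // !rmorphM rmorphXn incl_X // -mulrA tu //.
by rewrite phi_Td.
Qed.

(** * The summands inside the restricted induced module *)

Section Module.
Variable M : superModType H.
Notation IR := (tensor phi0 (restr phi0 M)).
Notation RI := (restr phi (tensor phi M)).

Let lam0 (h : H) (m : restr phi0 M) : tensor phi M := pure phi (phi h * T' n) m.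
Let lam0Dl h h' m : lam0 (h + h') m = lam0 h m + lam0 h' m.
Proof. by rewrite /lam0 rmorphD mulrDl pureDl. Qed.
Let lam0Dr h m m' : lam0 h (m + m') = lam0 h m + lam0 h m'.
Proof. exact: pureDr. Qed.
Let lam0B h r m : lam0 (h * phi0 r) m = lam0 h (r *: m).
Proof.
by rewrite /lam0 rmorphM -mulrA T_incl2 mulrA pure_balanced.
Qed.
Definition lam : IR -> tensor phi M := tlift lam0.
Lemma lam_pure h m : lam (pure phi0 h m) = pure phi (phi h * T' n) m.
Proof. exact: (tlift_pure lam0Dl lam0Dr lam0B). Qed.
Lemma lamD : {morph lam : x y / x + y}.
Proof. exact: (tliftD lam0Dl lam0Dr lam0B). Qed.
Lemma lamZ h t : lam (h *: t) = phi h *: lam t.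
Proof.
move: t; apply: (tens_ext (u := fun t => lam (h *: t))).
- by move=> x y; rewrite scalerDr lamD.
- by move=> x y; rewrite lamD scalerDr.
by move=> h' m; rewrite scale_pure !lam_pure scale_pure rmorphM mulrA.
Qed.
Lemma lam_part p t : lam (part p t) = part p (lam t).
Proof.
move: t; apply: (tens_ext (u := fun t => lam (part p t))).
- by move=> x y; rewrite partD lamD.
- by move=> x y; rewrite lamD partD.
move=> h m; rewrite part_pure lamD !lam_pure part_pure.
have hT : homog false (T' n) by apply: (T_even HH').
have hp q : part q (phi h * T' n) = phi (part q h) * T' n.
  have hT1 : part true (T' n) = 0 by exact: homog_neq hT _.
  by rewrite sa_map_part partM; case: q; rewrite hT hT1 mulr0 ?addr0 ?add0r.
by rewrite !hp.
Qed.

Lemma pure_twist h y (m : M) :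
  pure phi (topel y) (twist (par y.2) (h *: m))
    = phi h *: pure phi (topel y) (twist (par y.2) m).
Proof. by rewrite twist_scale -pure_balanced -topel_comm scale_pure. Qed.

Definition top (I : finType) (idx : I -> 'I_d * B) (y : {ffun I -> M}) :
    tensor phi M :=
  \sum_l pure phi (topel (idx l)) (twist (par (idx l).2) (y l)).

Section Top.
Variables (I : finType) (idx : I -> 'I_d * B).
Lemma topD : {morph top idx : x y / x + y}.
Proof.
by move=> x y; rewrite -big_split; apply: eq_bigr => l _; rewrite ffunE twistD pureDr.
Qed.
Lemma topZ (h : H) (y : {ffun I -> M}) : top idx (h *: y) = phi h *: top idx y.
Proof.
by rewrite scaler_sumr; apply: eq_bigr => l _; rewrite ffunE pure_twist.
Qed.
Let pure0l m : pure phi 0 m = 0 :> tensor phi M.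
Proof. by apply: (addIr (pure phi 0 m)); rewrite -pureDl !add0r. Qed.
Lemma top_part p (y : {ffun I -> M}) :
  part p (top idx y) = top idx [ffun l => part (p (+) par (idx l).2) (y l)].
Proof.
rewrite /top (big_morph (part p) (partD p) (part0 _ p)); apply: eq_bigr => l _.
rewrite ffunE -twist_part part_pure; have := homog_topel (idx l).
case: (par _) => hl; rewrite hl (homog_neq hl) // pure0l.
  by rewrite add0r addbT.
by rewrite addr0 addbF.
Qed.
End Top.

Lemma rho_Xs i : (i <= n.+1)%N ->
  rho tr_sym b_basis bd_dual c_central uc cu M (Xs T' X' i)
  = Xs (TW z b bd d tr_sym par n.+1 al T M) (XW z b bd c tr_sym par n.+1 al T X M) i.
Proof.
elim: i => [|i IH] hi; first exact: rho_X.
change (Xs T' X' i.+1) with (T' i * Xs T' X' i * T' i).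
by rewrite !rmorphM IH ?rho_T // ltnW.
Qed.

Notation W := (wmod par n.+1 d M).
Notation e := (@wpure k A B bd d tr par H n.+1 M).
Notation Psi0 := (@Psi k z A B b bd d c par n (restr phi0 M)).

(** V is [Psi] after the change of coordinates [G] of [last_position_change], which leaves the
    cosets with j at most n alone. *)
Lemma decompose : exists V : W -> tensor phi M,
  [/\ bijective V, {morph V : x y / x + y},
   forall j r a m, (j <= n)%N -> (r < d)%N ->
     V (e j r a m) = pure phi (al' j a * coset_rep n.+1 T' X' j r) m
   & forall r i m, (r < d)%N ->
     V (e n.+1 r (b i) m) = pure phi (Xs T' X' n.+1 ^+ r * al' n.+1 (b i)) m].
Proof.
have [G [G' [GG' G'G GE]]] :=
  last_position_change tr_sym b_basis bd_dual c_central d_gt0 HH M.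
exists (fun w => Psi (G w)); split.
- exists (fun x => G' (Phi tr_sym b_basis bd_dual c_central uc cu x)) => x.
    by rewrite Phi_Psi -kend_mulE G'G.
  by rewrite -[G (G' _)]kend_mulE GG' kend_oneE Psi_Phi.
- by move=> x y; rewrite kendD PsiD.
- move=> j r a m jn rd; rewrite GE // ?(leq_trans jn) // ltn_eqF //.
  by rewrite Psi_e // (leq_trans jn).
move=> r i m rd; rewrite GE // eqxx.
set f := rho tr_sym b_basis bd_dual c_central uc cu M.
(* Everything on the last cosets comes from the trivial one by elements of the algebra; [Psi_rho]
   then turns operators into products. *)
have -> : e n.+1 0 (b i) m = f (al' n.+1 (b i)) (e n.+1 0 1 m).
  by rewrite rho_al // aW_same // mulr1.
rewrite -rho_Xs // -rmorphXn -kend_mulE -rmorphM Psi_rho Psi_e //.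
by rewrite E_last (al1 HA') // mulr1 scale_pure mulr1.
Qed.

Section Splitting.
Variables (m0 m1 : nat) (idx0 : 'I_m0 -> 'I_d * B) (idx1 : 'I_m1 -> 'I_d * B).
Hypothesis inj0 : injective idx0.
Hypothesis inj1 : injective idx1.
Hypothesis par0 : forall l, par (idx0 l).2 = false.
Hypothesis par1 : forall l, par (idx1 l).2 = true.
Hypothesis sum_idx : forall (V : zmodType) (F : 'I_d * B -> V),
  \sum_y F y = \sum_l F (idx0 l) + \sum_l F (idx1 l).

Notation D := (({ffun 'I_m0 -> M} * {ffun 'I_m1 -> parity_shift M}) * IR)%type.

Definition zeta (x : D) : RI :=
  top idx0 x.1.1 + top idx1 (x.1.2 : {ffun 'I_m1 -> M}) + lam x.2.

Lemma zetaD : {morph zeta : x y / x + y}.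
Proof.
move=> [[x0 x1] x2] [[y0 y1] y2].
transitivity ((top idx0 x0 + top idx0 y0)
  + (top idx1 (x1 : {ffun 'I_m1 -> M}) + top idx1 (y1 : {ffun 'I_m1 -> M}))
  + (lam x2 + lam y2)).
  by congr (_ + _ + _); [exact: topD | exact: topD | exact: lamD].
have ac (V : zmodType) (f f' g g' h h' : V) :
  f + f' + (g + g') + (h + h') = f + g + h + (f' + g' + h') by zmod.
exact: ac.
Qed.

Lemma zeta_linear : linear zeta.
Proof.
move=> h x y; rewrite zetaD; congr (_ + _); case: x => -[x0 x1] x2.
transitivity (phi h *: top idx0 x0 + phi h *: top idx1 (x1 : {ffun 'I_m1 -> M})
  + phi h *: lam x2).
  by congr (_ + _ + _); [exact: topZ | exact: topZ | exact: lamZ].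
by rewrite -!scalerDr.
Qed.

Lemma zeta_part p x : zeta (part p x) = part p (zeta x).
Proof.
case: x => -[x0 x1] x2.
transitivity (part p (top idx0 x0) + part p (top idx1 (x1 : {ffun 'I_m1 -> M}))
  + part p (lam x2)); last by rewrite -!partD.
rewrite !top_part -lam_part; congr (top idx0 _ + top idx1 _ + _).
  by apply/ffunP => l; rewrite !ffunE par0 addbF.
by apply/ffunP => l; rewrite !ffunE par1 addbT.
Qed.

Definition zetaHom : superModHom (D : superModType H) RI :=
  @SuperModHom k H D RI
    (HB.pack zeta (GRing.isLinear.Build H D RI *:%R zeta zeta_linear)) zeta_part.

Let low (w : W) : wmod par n d (restr phi0 M) :=
  [ffun y : 'I_n.+1 * 'I_d * B => w (widen_ord (leqnSn n.+1) y.1.1, y.1.2, y.2)].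
(** The coordinates with j at most n are those of the module induced from the restriction of M, so
    the coordinate isomorphism one level down applies to them. The twist for odd indices undoes the
    one in [top]. *)
Let split_W (w : W) : D :=
  (([ffun l => w (ord_max, (idx0 l).1, (idx0 l).2)],
    [ffun l => twist true (w (ord_max, (idx1 l).1, (idx1 l).2))]), Psi0 (low w)).
(** Inverts [idx0] and [idx1] together: at most one l contributes, and the sum spares selecting
    it. *)
Let top_sum (y : 'I_d * B) (x0 : {ffun 'I_m0 -> M}) (x1 : {ffun 'I_m1 -> M}) : M :=
  \sum_(l | idx0 l == y) x0 l + \sum_(l | idx1 l == y) twist true (x1 l).
Let glue_W (x : D) : W :=
  [ffun y : 'I_n.+2 * 'I_d * B =>
    if insub (val y.1.1) is Some j
    then Phi tr_sym b_basis bd_dual c_central uc cu x.2 (j, y.1.2, y.2)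
    else top_sum (y.1.2, y.2) x.1.1 x.1.2].

Let split_glue x : split_W (glue_W x) = x.
Proof.
have lastN : insub (nat_of_ord (@ord_max n.+1)) = None :> option 'I_n.+1.
  by rewrite insubF //= ltnn.
have i01 l l' : idx0 l == idx1 l' = false.
  by apply/eqP => e; have := par1 l'; rewrite -e par0.
case: x => -[x0 x1] x2; congr (_, _, _).
- apply/ffunP => l; rewrite !ffunE /= lastN /top_sum -surjective_pairing.
  rewrite [X in _ + X]big1 ?addr0 => [|l']; last by rewrite eq_sym i01.
  by rewrite (big_pred1 l) // => l'; exact: inj_eq.
- apply/ffunP => l; rewrite !ffunE /= lastN /top_sum -surjective_pairing.
  rewrite [X in X + _]big1 ?add0r => [|l']; last by rewrite i01.
  rewrite (big_pred1 l) ?twist_twist // => l'; exact: inj_eq.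
rewrite -[RHS](Psi_Phi tr_sym b_basis bd_dual c_central uc cu).
congr (Psi _); apply/ffunP => -[[j r] i]; rewrite !ffunE /=.
by rewrite valK.
Qed.

Let zeta_split (V : W -> tensor phi M) w : {morph V : x y / x + y} ->
  (forall j r a m, (j <= n)%N -> (r < d)%N ->
     V (e j r a m) = pure phi (al' j a * coset_rep n.+1 T' X' j r) m) ->
  (forall r i m, (r < d)%N ->
     V (e n.+1 r (b i) m) = pure phi (Xs T' X' n.+1 ^+ r * al' n.+1 (b i)) m) ->
  zeta (split_W w) = V w.
Proof.
move=> VD Vlow Vtop.
have V0 : V 0 = 0 by apply: (addIr (V 0)); rewrite -VD !add0r.
rewrite [in RHS](w_dec bd_dual w) (big_morph V VD V0).
transitivity (\sum_(j : 'I_n.+2) \sum_(y : 'I_d * B)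
    V (e j y.1 (b y.2) (w (j, y.1, y.2)))); last first.
  rewrite pair_bigA /= (reindex (fun y : 'I_n.+2 * 'I_d * B => (y.1.1, (y.1.2, y.2)))).
    by apply: eq_bigr => -[[j r] i].
  by exists (fun y => (y.1, y.2.1, y.2.2)) => [[[j r] i]|[j [r i]]].
(* The last coset gives the copies of M, sorted by parity through [sum_idx]; the others give the
   image of [lam], through [phi_E]. *)
rewrite big_ord_recr /= addrC; congr (_ + _).
  rewrite sum_idx; congr (_ + _); apply: eq_bigr => l _; rewrite ffunE Vtop //.
    by rewrite par0.
  by rewrite par1 twist_twist.
rewrite pair_bigA.
rewrite (big_morph _ lamD (_ : lam 0 = 0)); last first.
  by apply: (addIr (lam 0)); rewrite -lamD !add0r.
rewrite (reindex (fun y : 'I_n.+1 * ('I_d * B) => (y.1, y.2.1, y.2.2))); last first.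
  by exists (fun y => (y.1.1, (y.1.2, y.2))) => [[j [r i]]|[[j r] i]].
apply: eq_bigr => -[j [r i]] _ /=; rewrite Vlow //; last by rewrite -ltnS.
rewrite lam_pure rmorphM incl_al // -mulrA phi_E; last by rewrite -ltnS.
by rewrite ffunE.
Qed.

(** As zeta after [split_W] is the bijection V, a right inverse of [split_W] is all that is missing,
    and [glue_W] is one. *)
Lemma zeta_bij : bijective zeta.
Proof.
have [V [[V' VK V'K] VD Vlow Vtop]] := decompose.
have zs w : zeta (split_W w) = V w by exact: zeta_split.
exists (fun x => split_W (V' x)) => x; last by rewrite zs V'K.
by rewrite -{1}[x]split_glue zs VK split_glue.
Qed.
End Splitting.
End Module.
End Mackey.

(** * From bijections to a natural isomorphism *)

Lemma superModHom_inverse (k : comNzRingType) (H : superAlgType k)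
    (M N : superModType H) (f : superModHom M N) :
  bijective f -> exists g : superModHom N M, cancel f g /\ cancel g f.
Proof.
case=> g fg gf.
have g_linear : linear g by move=> h x y; apply: (can_inj fg); rewrite linearP !gf.
have g_part p x : g (part p x) = part p (g x).
  by apply: (can_inj fg); rewrite sm_map_part !gf.
by exists (@SuperModHom k H N M
  (HB.pack g (GRing.isLinear.Build H N M *:%R g g_linear)) g_part).
Qed.

(** The explicit map goes from the direct sum to the restricted induced module, opposite to the
    direction in the definition of natural isomorphism. *)
Lemma naturally_isomorphic_inverse (k : comNzRingType) (H K : superAlgType k)
    (F G : superFunctor H K) (zeta : forall M, superModHom (G M) (F M)) :
  (forall M, bijective (zeta M)) ->
  (forall (M N : superModType H) (f : superModHom M N) (x : G M),
     zeta N (fmap G f x) = fmap F f (zeta M x)) ->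
  naturally_isomorphic F G.
Proof.
move=> zb zn; pose eta M := sval (cid (superModHom_inverse (zb M))).
have ze M : cancel (zeta M) (eta M) /\ cancel (eta M) (zeta M).
  exact: svalP (cid (superModHom_inverse (zb M))).
exists eta; split=> [M|M N f x].
  by have [e1 e2] := ze M; exists (zeta M).
have [_ e2] := ze M; have [e1 _] := ze N.
by rewrite -{1}[x]e2 -zn e1.
Qed.

(** * Enumeration of the pairs of a power of X and a basis element of given parity *)

Section Indexing.
Variables (d : nat) (B : finType).
Lemma card_indices (Q : pred B) :
  (d * #|[pred i | Q i]| = #|[predX 'I_d & [pred i | Q i]]|)%N.
Proof. by rewrite cardX card_ord. Qed.
Definition indices (Q : pred B) (l : 'I_(d * #|[pred i | Q i]|)) : 'I_d * B :=
  enum_val (cast_ord (card_indices Q) l).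
Lemma indices_inj Q : injective (@indices Q).
Proof. by move=> l l' /enum_val_inj/cast_ord_inj. Qed.
Lemma indicesP Q l : Q (@indices Q l).2.
Proof. by have /andP[] := enum_valP (cast_ord (card_indices Q) l). Qed.
Lemma sum_indices (V : zmodType) (par : pred B) (F : 'I_d * B -> V) :
  \sum_y F y = \sum_l F (@indices (fun i => ~~ par i) l) + \sum_l F (@indices par l).
Proof.
have h Q : \sum_(l : 'I_(d * #|[pred i | Q i]|)) F (@indices Q l)
    = \sum_(y : 'I_d * B | Q y.2) F y.
  rewrite [RHS](_ : _ = \sum_(y in [predX 'I_d & [pred i | Q i]]) F y) //.
  rewrite [RHS]big_enum_val [RHS](reindex (cast_ord (card_indices Q))) //.
  by exists (cast_ord (esym (card_indices Q))) => l _; rewrite ?cast_ordK ?cast_ordKV.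
by rewrite !h [LHS](bigID (fun y : 'I_d * B => par y.2)) addrC.
Qed.
End Indexing.

(** The modules are over the algebra on n + 1 strands, so n = 0 is the case of one strand, with the
    ground ring as the smaller algebra. *)
Theorem theorem4p14
  (k : comNzRingType) (char_k : 2%N \notin [pchar k]) (z : k)
  (A : superAlgType k) (tr : A -> k) (tr_sym : symmetrizing tr)
  (B : finType) (b : B -> A) (par : B -> bool)
  (b_basis : homogeneous_basis b par)
  (bd : B -> A) (bd_dual : dual_basis tr b bd)
  (d : nat) (d_gt0 : (0 < d)%N) (c : 'I_d -> A)
  (c_central : forall l, homog false (c l) /\ supercentral (c l))
  (c0_inv : invertible (c (Ordinal d_gt0)))
  (n : nat) :
  let dimA0 := #|[pred i | ~~ par i]| in
  let dimA1 := #|[pred i | par i]| in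
  naturally_isomorphic
    (compFunctor (fRes z b bd c n.+1) (fInd z b bd c n.+1))
    (sumFunctor
       (sumFunctor (copiesFunctor (d * dimA0) (idFunctor _))
                   (copiesFunctor (d * dimA1) (parityFunctor _)))
       (compFunctor (fInd z b bd c n) (fRes z b bd c n))).
Proof.
move=> dimA0 dimA1; have [u [uc cu]] := c0_inv.
pose idx0 := @indices d B (fun i => ~~ par i).
pose idx1 := @indices d B par.
have par0 l : par (idx0 l).2 = false by exact: negbTE (indicesP l).
have par1 l : par (idx1 l).2 = true by exact: indicesP l.
set F := compFunctor _ _; set G := sumFunctor _ _.
pose zeta (M : superModType (Hf z b bd c n.+1)) : superModHom (G M) (F M) :=
  zetaHom tr_sym b_basis bd_dual c_central uc cu M par0 par1.
apply: (@naturally_isomorphic_inverse _ _ _ F G zeta) => [M|M N f x].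
  apply: (zeta_bij tr_sym b_basis bd_dual c_central uc cu M
    (@indices_inj d B _) (@indices_inj d B _) par0 par1).

  by move=> V S; exact: sum_indices.
case: x => -[x0 x1] x2.
pose g := indHom (incl z b bd c n.+1) f.
(* Morphisms preserve parity and therefore commute with [twist]. *)
have top_nat m (idx : 'I_m -> 'I_d * B) (y : {ffun 'I_m -> M}) :
    g (top par idx y) = top par idx [ffun l => f (y l)].
  rewrite linear_sum; apply: eq_bigr => l _.
  by rewrite indHom_pure twist_modhom ffunE.
have lam_nat t : g (lam t) = lam (indHom (incl z b bd c n) (resHom (incl z b bd c n) f) t).
  move: t; apply: (tens_ext (u := fun t => g (lam t))
    (v := fun t => lam (indHom (incl z b bd c n) (resHom (incl z b bd c n) f) t))).
  - by move=> v w; rewrite (lamD tr_sym b_basis bd_dual c_central uc cu) linearD.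
  - by move=> v w; rewrite linearD (lamD tr_sym b_basis bd_dual c_central uc cu).
  move=> h m; rewrite indHom_pure !(lam_pure tr_sym b_basis bd_dual c_central uc cu).
  exact: indHom_pure.
transitivity (g (top par idx0 x0)
  + g (top par idx1 (x1 : {ffun _ -> M})) + g (lam x2)).
  by rewrite !top_nat lam_nat.
by rewrite -!linearD.
Qed.
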